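(* Let $X$ be a complex Banach space and let $T\in B(X)$ be a GFS operator. Then the mapping $P\mapsto P(T)$ on the set of polynomials can be extended uniquely to a bounded homomorphism from the Besov algebra $\mathcal{B}(\mathbb{D})$ to the algebra $B(X)$. For $f\in\mathcal{B}(\mathbb{D})$, let $f(T)$ denote the operator obtained by this extension. Then for each $f\in\mathcal{B}(\mathbb{D})$, $x\in X$ and $x^*\in X^*$, $$\langle f(T)x,x^*\rangle=\frac{1}{\pi}\int_1^\infty(r^2-1)\int_0^{2\pi}\frac{e^{3it}}{r^2}\,f'\!\Big(\frac{e^{it}}{r}\Big)\langle R(re^{it},T)^2x,x^*\rangle\,dt\,dr+f(0)\langle x,x^*\rangle.$$
   Context: $\mathcal{B}(\mathbb{D})$ is the Banach algebra (under pointwise multiplication) of all holomorphic functions $f$ on the open unit disc $\mathbb{D}$ such that $\int_0^1\sup_{t\in[0,2\pi)}|f'(ue^{it})|\,du<\infty$, with norm $$\|f\|_{\mathcal{B}}=\int_0^1\sup_{t\in[0,2\pi)}|f'(ue^{it})|\,du+\sup_{z\in\mathbb{D}}|f(z)|.$$ Let $T\in B(X)$, $m\ge1$ an integer, $R(\lambda,T)=(\lambda I_X-T)^{-1}$. $T$ has property $(GFS)_m$ if $\sigma(T)\subset\overline{\mathbb{D}}$ and there is $C>0$ such that for all $r>1$, $x\in X$, $x^*\in X^*$, $\int_0^{2\pi}|\langle R(re^{it},T)^{m+1}x,x^*\rangle|\,dt\le\frac{C}{(r+1)(r-1)^m}\|x\|\|x^*\|$. If $\sigma(T)\subset\overline{\mathbb{D}}$,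 $T$ has $m$-derivative bounded functional calculus if there is $C>0$ with $\|\phi^{(m)}(T)\|\le\frac{C}{(r-1)^m}\sup_{z\in r\mathbb{D}}|\phi(z)|$ for all $r>1$ and all bounded analytic $\phi:r\mathbb{D}\to\mathbb{C}$, where $r\mathbb{D}$ is the open disc of radius $r$ centred at $0$ and $\phi^{(m)}(T)$ is defined by the Riesz–Dunford calculus. For every $m\ge1$, the following are equivalent: $(GFS)_m$; $1$-derivative bounded functional calculus; $m$-derivative bounded functional calculus. $T$ is called a GFS operator if it satisfies one (hence all) of these conditions; in particular $T$ is a GFS operator if and only if it has $(GFS)_1$. *)

(* Defs.v *)
From mathcomp Require Import all_boot all_order all_algebra.
From mathcomp Require Import complex.
From mathcomp Require Import all_classical all_reals all_analysis.

Set Implicit Arguments.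
Unset Strict Implicit.
Unset Printing Implicit Defensive.

Import Order.TTheory GRing.Theory Num.Theory.
Import numFieldNormedType.Exports.

Local Open Scope classical_set_scope.
Local Open Scope ring_scope.
Local Open Scope complex_scope.

(* Norms of normed spaces over R[i] take values in R[i]; [rnorm x] is the same
   number as an element of R. *)
Definition rnorm (R : realType) (V : normedModType R[i]) (x : V) : R :=
  complex.Re `|x|.

Section operators.
Context {R : realType}.

(* B(V, W): with W := V this is B(V), with W := R[i]^o it is the dual V^*. *)
Definition bounded_op (V W : normedModType R[i]) (A : V -> W) : Prop :=
  linear A /\ continuous A.

Definition opnorm (V W : normedModType R[i]) (A : V -> W) : R :=
  sup [set rnorm (A x) | x in [set x : V | rnorm x <= 1]].

Definition op_inverse (V : normedModType R[i]) (A S : V -> V) : Prop :=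
  [/\ bounded_op S, cancel A S & cancel S A].

Definition op_pencil (V : normedModType R[i]) (T : V -> V) (l : R[i]) : V -> V :=
  fun x => l *: x - T x.

Definition spectrum (V : normedModType R[i]) (T : V -> V) : set R[i] :=
  [set l | ~ exists S, op_inverse (op_pencil T l) S].

(* R(l, T); the junk value on the spectrum is the zero operator. *)
Definition resolvent (V : normedModType R[i]) (l : R[i]) (T : V -> V) : V -> V :=
  xget (fun=> 0) [set S | op_inverse (op_pencil T l) S].

Definition poly_op (V : normedModType R[i]) (T : V -> V) (p : {poly R[i]}) :
    V -> V :=
  fun x => \sum_(k < size p) p`_k *: iter k T x.

End operators.

Section complex_functions.
Context {R : realType}.

(* e^{it} *)
Definition cis (t : R) : R[i] := cos t +i* sin t.

Definition cintegrable (D : set R) (g : R -> R[i]) : Prop :=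
  (@lebesgue_measure R).-integrable D (fun t => (complex.Re (g t))%:E) /\
  (@lebesgue_measure R).-integrable D (fun t => (complex.Im (g t))%:E).

Definition cintegral (D : set R) (g : R -> R[i]) : R[i] :=
  (\int[lebesgue_measure]_(t in D) complex.Re (g t)) +i*
  (\int[lebesgue_measure]_(t in D) complex.Im (g t)).

Definition unit_disc : set R[i] := [set z | `|z| < 1].

(* d/dz, over the scalar field R[i] *)
Definition cderive (f : R[i] -> R[i]) : R[i] -> R[i] :=
  derive1 (f : R[i] -> R[i]^o).

Definition holomorphic_on (D : set R[i]) (f : R[i] -> R[i]) : Prop :=
  forall z, D z -> derivable (f : R[i]^o -> R[i]^o) z 1.

Definition besov_seminorm (f : R[i] -> R[i]) : \bar R :=
  (\int[lebesgue_measure]_(u in `[0%R, 1%R[)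
     ereal_sup [set (rnorm (cderive f (u%:C * cis t) : R[i]^o))%:E
               | t in `[0%R, (2 * pi)%R[])%E.

Definition besov_norm (f : R[i] -> R[i]) : \bar R :=
  (besov_seminorm f + ereal_sup [set (rnorm (f z : R[i]^o))%:E | z in unit_disc])%E.

(* Elements of the Besov algebra are represented by total functions, of which
   only the restriction to the open unit disc is meaningful. *)
Definition besov (f : R[i] -> R[i]) : Prop :=
  holomorphic_on unit_disc f /\ (besov_seminorm f < +oo)%E.

End complex_functions.

Section calculus.
Context {R : realType} (X : completeNormedModType R[i]).
Implicit Types (T : X -> X).

Definition GFS_prop (m : nat) T : Prop :=
  spectrum T `<=` [set l | `|l| <= 1] /\
  exists2 C : R, 0 < C &
  forall (r : R) (x : X) (phi : X -> R[i]^o), 1 < r -> bounded_op phi ->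
  (\int[lebesgue_measure]_(t in `[0%R, (2 * pi)%R])
     (rnorm (phi (iter m.+1 (resolvent (r%:C * cis t) T) x)))%:E
   <= (C / ((r + 1) * (r - 1) ^+ m) * rnorm x * opnorm phi)%:E)%E.

Definition GFS_operator T : Prop := bounded_op T /\ GFS_prop 1 T.

(* [Phi] is a bounded algebra homomorphism from the Besov algebra to B(X)
   extending P |-> P(T). It is given on all functions, but constrained only on
   the Besov algebra; [besov_calc_eq] makes it a function of the restriction
   to the disc. *)
Record besov_calculus T (Phi : (R[i] -> R[i]) -> X -> X) : Prop := {
  besov_calc_op : forall f, besov f -> bounded_op (Phi f);
  besov_calc_eq : forall f g, besov f -> besov g ->
    {in unit_disc, f =1 g} -> Phi f = Phi g;
  besov_calcD : forall f g, besov f -> besov g ->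
    Phi (fun z => f z + g z) = (fun x => Phi f x + Phi g x);
  besov_calcZ : forall (c : R[i]) f, besov f ->
    Phi (fun z => c * f z) = (fun x => c *: Phi f x);
  besov_calcM : forall f g, besov f -> besov g ->
    Phi (fun z => f z * g z) = Phi f \o Phi g;
  besov_calc_bounded : exists M : R, forall f, besov f ->
    ((opnorm (Phi f))%:E <= M%:E * besov_norm f)%E;
  besov_calc_poly : forall p : {poly R[i]}, Phi (horner p) = poly_op T p
}.

(* The integrand in t, for fixed r, of the formula for <f(T)x, phi>. *)
Definition besov_kernel T (f : R[i] -> R[i]) (x : X) (phi : X -> R[i]^o)
    (r t : R) : R[i] :=
  cis (3 * t) / (r ^+ 2)%:C * cderive f (cis t / r%:C)
  * phi (iter 2 (resolvent (r%:C * cis t) T) x).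

End calculus.

(* Main.v *)
(* Let M(u) be the supremum of |f'| on the circle |z| = u. The GFS bound and the
   substitution u = 1/r bound the double integral by a multiple of
   (int_0^1 M(u) du) |x| |phi|. For f = z^(n+1) it can be computed: by Cauchy's
   theorem on annuli, proved by bisection in polar coordinates, the mean of
   l^(n+2) <R(l, T)^2 x, phi> over |l| = r does not depend on r > 1, and the
   resolvent identity gives the value (n+1) <T^n x, phi>. So the formula holds
   for polynomials p, and norming functionals give |p(T)| <= K |p|_B. The
   polynomials are dense in the Besov algebra, since f(s z) approximates f as
   s -> 1 by dominated convergence; hence p |-> p(T) extends uniquely, and the
   formula passes to the limit. *)
Require Import Defs.
From mathcomp Require Import all_boot all_order all_algebra.
From mathcomp Require Import complex.
From mathcomp Require Import all_classical all_reals all_analysis.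
From mathcomp Require Import ring lra measurable_realfun.
Import Order.TTheory GRing.Theory Num.Theory.
Import numFieldNormedType.Exports.
Local Open Scope classical_set_scope.
Local Open Scope ring_scope.
Local Open Scope complex_scope.
Set Implicit Arguments.
Unset Strict Implicit.
Unset Printing Implicit Defensive.

(** The obstacle is that a member of the Besov algebra is only assumed complex differentiable at
    each point of the disc, while the seminorm and the formula involve [f'], whose continuity is not
    given. So Goursat's argument is run from pointwise differentiability, and [f'] is then handled
    as a locally uniform limit of polynomials ([poly_limit]), which yields its continuity, its
    boundedness on smaller discs and the maximum principle. The weight [r^2 - 1 = (r + 1)(r - 1)] is
    exactly the GFS denominator for [m = 1], and [dr / r^2] is the image of [du] under [u = 1/r];
    this is why the double integral sees only the seminorm. Several constants carry a factor 2:
    complex integrals are estimated through their real and imaginary parts, and so are the norming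
    functionals. This is harmless where only boundedness is at stake; in the maximum principle the
    factor is removed by taking powers. The extension uses the seminorm plus [|f(0)|], equivalent to
    the Besov norm because integrating [f'] along rays bounds [f]. *)

Notation cabs z := (@rnorm _ (_)^o z).

(** * Moduli, complex derivatives, bounded operators *)

Section rnorm_theory.
Context {R : realType} {V : normedModType R[i]}.
Implicit Types x y : V.

Lemma norm_rnorm x : `|x| = (rnorm x)%:C.
Proof. by rewrite /rnorm RRe_real // normr_real. Qed.

Lemma rnorm_ge0 x : 0 <= rnorm x.
Proof. by rewrite -ler0c -norm_rnorm. Qed.

Lemma rnorm0 : rnorm (0 : V) = 0.
Proof. by rewrite /rnorm normr0. Qed.

Lemma rnorm_eq0 x : (rnorm x == 0) = (x == 0).
Proof. by rewrite -[RHS]normr_eq0 norm_rnorm -(inj_eq (@complexI R)). Qed.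

Lemma rnormD x y : rnorm (x + y) <= rnorm x + rnorm y.
Proof. by rewrite -lecR rmorphD /= -!norm_rnorm ler_normD. Qed.

Lemma rnormN x : rnorm (- x) = rnorm x.
Proof. by rewrite /rnorm normrN. Qed.

Lemma rnormB x y : rnorm (x - y) <= rnorm x + rnorm y.
Proof. by rewrite -(rnormN y) rnormD. Qed.

Lemma rdistC x y : rnorm (x - y) = rnorm (y - x).
Proof. by rewrite /rnorm distrC. Qed.

Lemma rnormZ (a : R[i]) x : rnorm (a *: x) = cabs a * rnorm x.
Proof. by apply: (@complexI R); rewrite rmorphM /= -!norm_rnorm normrZ. Qed.

Lemma ler_rnormB x y : rnorm x - rnorm y <= rnorm (x - y).
Proof. by rewrite lerBlDr -{1}(subrK y x) rnormD. Qed.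

Lemma rnorm_le0 x : (forall e : R, 0 < e -> rnorm x <= e) -> x = 0.
Proof.
move=> h; apply/eqP; rewrite -rnorm_eq0 eq_le rnorm_ge0 andbT.
by apply/ler_addgt0Pl => e e0; rewrite addr0 h.
Qed.

(** A positive element of [R[i]] is real, so testing with positive elements of [R] loses nothing. *)
Lemma rcvgP (T : Type) (F : set_system T) (FF : Filter F) (f : T -> V) (l : V) :
  f x @[x --> F] --> l <->
  forall e : R, 0 < e -> \forall x \near F, rnorm (f x - l) <= e.
Proof.
split=> [/cvgrPdist_le h e e0|h].
  have := h e%:C; rewrite ltcR => /(_ e0).
  by apply: filterS => x; rewrite norm_rnorm lecR rdistC.
apply/cvgrPdist_le => e e0.
have eE : e = (complex.Re e)%:C by rewrite RRe_real // gtr0_real.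
have := h (complex.Re e); rewrite -ltcR -eE => /(_ e0).
by apply: filterS => x; rewrite norm_rnorm eE lecR rdistC.
Qed.

Lemma nbhs_rnormP (x : V) (P : set V) :
  nbhs x P <-> exists2 e : R, 0 < e & forall y, rnorm (y - x) < e -> P y.
Proof.
split.
  move=> /nbhs_normP[e /= e0 h]; exists (complex.Re e).
    by rewrite -ltcR RRe_real // gtr0_real.
  move=> y hy; apply: h => /=; rewrite distrC norm_rnorm.
  by rewrite -[e]RRe_real ?gtr0_real // ltcR.
case=> e e0 h; apply/nbhs_normP; exists e%:C => /=; first by rewrite ltcR.
by move=> y /=; rewrite distrC norm_rnorm ltcR => /h.
Qed.

End rnorm_theory.

Section cabs_theory.
Context {R : realType}.
Implicit Types (z w : R[i]) (x : R).

Lemma ltc_cabs z x : (`|z| < x%:C) = (cabs z < x).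
Proof. by rewrite (norm_rnorm (z : R[i]^o)) ltcR. Qed.

Lemma lec_cabs z x : (`|z| <= x%:C) = (cabs z <= x).
Proof. by rewrite (norm_rnorm (z : R[i]^o)) lecR. Qed.

Lemma cabsM z w : cabs (z * w) = cabs z * cabs w.
Proof. exact: (@rnormZ R R[i]^o). Qed.

Lemma cabs1 : cabs (1 : R[i]) = 1.
Proof. by rewrite /rnorm normr1. Qed.

Lemma cabsX z n : cabs (z ^+ n) = cabs z ^+ n.
Proof. by elim: n => [|n ih]; rewrite ?expr0 ?cabs1 // !exprS cabsM ih. Qed.

Lemma cabsV z : cabs (z^-1) = (cabs z)^-1.
Proof.
have [->|z0] := eqVneq z 0; first by rewrite invr0 !(@rnorm0 _ R[i]^o) invr0.
have c0 : cabs z != 0 by rewrite rnorm_eq0.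
by apply: (mulfI c0); rewrite -cabsM !mulfV // cabs1.
Qed.

Lemma cabs_real x : cabs x%:C = `|x|.
Proof. by rewrite /rnorm normc_def /= expr0n addr0 sqrtr_sqr. Qed.

Lemma ler_Re_cabs z : `|complex.Re z| <= cabs z.
Proof. by rewrite -lecR -(norm_rnorm (z : R[i]^o)) normc_ge_Re. Qed.

Lemma ler_Im_cabs z : `|complex.Im z| <= cabs z.
Proof.
rewrite /rnorm normc_def /= -sqrtr_sqr ler_sqrt ?lerDr ?sqr_ge0 //.
by rewrite addr_ge0 ?sqr_ge0.
Qed.

Lemma cabs_le_ReIm z : cabs z <= `|complex.Re z| + `|complex.Im z|.
Proof.
case: z => a b; rewrite /rnorm normc_def /=.
rewrite -(@ler_pXn2r _ 2) ?nnegrE ?sqrtr_ge0 ?addr_ge0 // sqr_sqrtr; last first.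
  by rewrite addr_ge0 ?sqr_ge0.
rewrite sqrrD !real_normK ?num_real //.
by rewrite -addrA lerD2l lerDr mulrn_wge0 // mulr_ge0.
Qed.

Lemma cabs_cis (t : R) : cabs (cis t) = 1.
Proof. by rewrite /rnorm normc_def /= addrC sin2cos2 subrK sqrtr1. Qed.

Lemma cisD (s t : R) : cis (s + t) = cis s * cis t.
Proof.
rewrite /cis cosD sinD; apply/eqP; rewrite eq_complex /= eqxx /=.
by rewrite addrC.
Qed.

Lemma cis0 : cis (0 : R) = 1.
Proof. by rewrite /cis cos0 sin0. Qed.

Lemma cis_nat (t : R) n : cis (n%:R * t) = cis t ^+ n.
Proof.
elim: n => [|n ih]; first by rewrite mul0r cis0.
by rewrite -natr1 mulrDl mul1r cisD ih exprSr.
Qed.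


End cabs_theory.

Section complex_derivative.
Context {R : realType}.
Implicit Types (f : R[i] -> R[i]) (z : R[i]).

(** Complex differentiability without a quotient, so [h = 0] needs no exclusion; this is the form in
    which the remainder enters Goursat's estimate. *)
Definition cdiff f z l := forall e : R, 0 < e -> exists2 d : R, 0 < d &
  forall h : R[i], cabs h < d -> cabs (f (z + h) - f z - l * h) <= e * cabs h.

Lemma cdiff_cvg f z l : cdiff f z l <->
  h^-1 *: (f (h + z) - f z : R[i]^o) @[h --> (0 : R[i]^o)^'] --> (l : R[i]^o).
Proof.
have E (h : R[i]) : h != 0 ->
    cabs (h^-1 *: (f (h + z) - f z : R[i]^o) - l) * cabs h =
    cabs (f (z + h) - f z - l * h).
  move=> h0; rewrite -cabsM; congr rnorm.
  by rewrite [h + z]addrC /GRing.scale /= mulrBl mulrAC mulVf // mul1r.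
split=> [H|/(@rcvgP _ R[i]^o) H].
  apply/(@rcvgP _ R[i]^o) => e e0; have [d d0 hd] := H e e0.
  apply/(@nbhs_rnormP _ R[i]^o); exists d => // h; rewrite subr0 => hh h0.
  rewrite -(@ler_pM2r _ (cabs h)) ?E ?hd //.
  by rewrite lt_neqAle eq_sym rnorm_eq0 h0 rnorm_ge0.
move=> e e0; have /(@nbhs_rnormP _ R[i]^o)[d d0 hd] := H e e0; exists d => // h hh.
have [->|h0] := eqVneq h 0.
  by rewrite addr0 subrr mulr0 subrr !(@rnorm0 _ R[i]^o) mulr0.
rewrite -E // ler_wpM2r ?rnorm_ge0 //; apply: hd => //.
by rewrite subr0.
Qed.

Lemma derivable1E f z :
  (fun h : R[i]^o => h^-1 *: (((f : R[i]^o -> R[i]^o) \o shift z) (h *: 1) - f z)) =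
  (fun h => h^-1 *: (f (h + z) - f z : R[i]^o)).
Proof. by apply/funext => h /=; rewrite [h *: 1]mulr1. Qed.

Lemma derivable_cdiff f z : derivable (f : R[i]^o -> R[i]^o) z 1 ->
  cdiff f z (cderive f z).
Proof. by move=> h; apply/cdiff_cvg; move: h; rewrite /derivable derivable1E. Qed.

Lemma cdiff_derivable f z l : cdiff f z l ->
  derivable (f : R[i]^o -> R[i]^o) z 1 /\ cderive f z = l.
Proof.
move=> /cdiff_cvg h; split; last exact: (cvg_lim (@norm_hausdorff _ _) h).
by rewrite /derivable derivable1E; apply/cvg_ex; exists (l : R[i]^o).
Qed.

End complex_derivative.

Section cdiff_rules.
Context {R : realType}.
Implicit Types (f g : R[i] -> R[i]) (z : R[i]).

Lemma cdiffP f z l : cdiff f z l <->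
  is_derive (z : R[i]^o) 1 (f : R[i]^o -> R[i]^o) (l : R[i]^o).
Proof.
split=> [h|h].
  have [d <-] := cdiff_derivable h.
  split; first exact: d.
  exact: esym (derive1E (f : R[i] -> R[i]^o) z).
have [d fl] := h.
have := @derivable_cdiff _ f z d.
have <- : cderive f z = l by rewrite -fl; exact: derive1E (f : R[i] -> R[i]^o) z.
by [].
Qed.

Lemma cdiff_cst (c : R[i]) z : cdiff (fun=> c) z 0.
Proof. by apply/cdiffP; exact: is_derive_cst. Qed.

Lemma cdiff_id z : cdiff id z 1.
Proof. by apply/cdiffP; exact: is_derive_id. Qed.

Lemma cdiffD f g z l m : cdiff f z l -> cdiff g z m ->
  cdiff (fun w => f w + g w) z (l + m).
Proof. by move=> /cdiffP hf /cdiffP hg; apply/cdiffP; exact: is_deriveD. Qed.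

Lemma cdiffB f g z l m : cdiff f z l -> cdiff g z m ->
  cdiff (fun w => f w - g w) z (l - m).
Proof. by move=> /cdiffP hf /cdiffP hg; apply/cdiffP; exact: is_deriveB. Qed.

Lemma cdiffM f g z l m : cdiff f z l -> cdiff g z m ->
  cdiff (fun w => f w * g w) z (f z * m + g z * l).
Proof. by move=> /cdiffP hf /cdiffP hg; apply/cdiffP; exact: is_deriveM. Qed.

Lemma cdiffZ c f z l : cdiff f z l -> cdiff (fun w => c * f w) z (c * l).
Proof. by move=> hf; have := cdiffM (cdiff_cst c z) hf; rewrite mulr0 addr0. Qed.

Lemma cdiffV f z l : cdiff f z l -> f z != 0 ->
  exists m, cdiff (fun w => (f w)^-1) z m.
Proof.
move=> /cdiff_derivable[df _] f0; exists (cderive (fun w => (f w)^-1) z).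
by apply: derivable_cdiff; exact: derivableV.
Qed.

Lemma cdiff_horner (p : {poly R[i]}) z : cdiff (horner p) z p^`().[z].
Proof.
elim/poly_ind: p => [|p c ih].
  rewrite deriv0 horner0 [horner 0](_ : _ = fun=> 0); first exact: cdiff_cst.
  by apply/funext => w; rewrite horner0.
rewrite [horner _](_ : _ = fun w => p.[w] * w + c); last first.
  by apply/funext => w; rewrite hornerMXaddC.
have := cdiffD (cdiffM ih (cdiff_id z)) (cdiff_cst c z).
congr (cdiff _ _ _).
by rewrite derivD derivM derivX derivC !(hornerD, hornerM, hornerX, hornerC); ring.
Qed.

Lemma cdiff_scale f c z l : cdiff f (c * z) l ->
  cdiff (fun w => f (c * w)) z (c * l).
Proof.
(* The tolerances are divided by [1 + cabs c] instead of [cabs c] so that [c = 0] is included. *)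
have C0 : 0 < 1 + cabs c by rewrite ltr_pwDl // rnorm_ge0.
move=> h e e0; have [d d0 hd] := h (e / (1 + cabs c)) (divr_gt0 e0 C0).
exists (d / (1 + cabs c)) => [|u hu]; first by rewrite divr_gt0.
have cu : cabs (c * u) <= (1 + cabs c) * cabs u.
  by rewrite cabsM ler_wpM2r ?rnorm_ge0 // lerDr.
rewrite mulrDr (_ : c * l * u = l * (c * u)); last by ring.
apply: le_trans (hd _ _) _.
  by apply: le_lt_trans cu _; rewrite mulrC -ltr_pdivlMr.
by rewrite -mulrA ler_pM2l // mulrC ler_pdivrMr // [leRHS]mulrC.
Qed.

Lemma cdiff_ext f g z l : (\forall w \near (z : R[i]^o), f w = g w) ->
  cdiff f z l -> cdiff g z l.
Proof.
move=> /nbhs_rnormP[d d0 fg] h e e0; have [d' d'0 hd'] := h e e0.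
exists (Num.min d d') => [|u]; first by rewrite lt_min d0.
rewrite lt_min => /andP[ud ud']; rewrite -!fg ?hd' //.
  by rewrite subrr rnorm0.
by rewrite addrC addKr.
Qed.

Lemma cdiff_continuous f z l : cdiff f z l -> {for z, continuous (f : R[i]^o -> R[i]^o)}.
Proof.
move=> /cdiffP h; apply: differentiable_continuous; apply/derivable1_diffP.
exact: ex_derive.
Qed.

End cdiff_rules.

Section bounded_operators.
Context {R : realType}.

Section theory.
Context {V W : normedModType R[i]}.
Implicit Types A : V -> W.

Lemma lin0 A : linear A -> A 0 = 0.
Proof. by move=> h; have := h (-1) 0 0; rewrite !scaleN1r !addr0 oppr0 addNr. Qed.
Lemma linD A x y : linear A -> A (x + y) = A x + A y.
Proof. by move=> h; have := h 1 x y; rewrite !scale1r. Qed.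
Lemma linZ A a x : linear A -> A (a *: x) = a *: A x.
Proof. by move=> h; have := h a x 0; rewrite (lin0 h) !addr0. Qed.
Lemma linB A x y : linear A -> A (x - y) = A x - A y.
Proof. by move=> h; rewrite -scaleN1r (linD _ _ h) (linZ _ _ h) scaleN1r. Qed.

Lemma bound_bounded_op A (K : R) : linear A ->
  (forall x, rnorm (A x) <= K * rnorm x) -> bounded_op A.
Proof.
move=> lA bA; split=> // x; apply/rcvgP => e e0.
apply/nbhs_rnormP; exists (e / (1 + `|K|)); first by rewrite divr_gt0 // ltr_pwDl.
move=> y; rewrite ltr_pdivlMr ?ltr_pwDl // => /ltW h.
rewrite -linB //; apply: le_trans (bA _) (le_trans _ h).
by rewrite mulrC ler_wpM2l ?rnorm_ge0 // (le_trans (ler_norm _)) // lerDr.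
Qed.

Lemma bounded_op_bound A : bounded_op A ->
  exists2 K : R, 0 <= K & forall x, rnorm (A x) <= K * rnorm x.
Proof.
case=> lA cA; have := cA 0; rewrite /continuous_at (lin0 lA) => /rcvgP/(_ 1 ltr01)/nbhs_rnormP.
case=> e e0 he; exists (2 / e); first by rewrite divr_ge0 // ltW.
move=> x; have [->|x0] := eqVneq x 0; first by rewrite (lin0 lA) !rnorm0 mulr0.
have nx : 0 < rnorm x by rewrite lt_neqAle eq_sym rnorm_eq0 x0 rnorm_ge0.
(* The rescaled vector has norm [e / 2 < e], where [A] is bounded by 1; homogeneity turns this into
   the factor [2 / e]. *)
have := he ((e / 2 / rnorm x)%:C *: x).
rewrite !subr0 (linZ _ _ lA) !rnormZ cabs_real ger0_norm ?divr_ge0 ?(ltW e0) ?rnorm_ge0 //.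
rewrite divfK ?gt_eqF // => /(_ _); have -> : e / 2 < e by lra.
move=> /(_ isT); rewrite -ler_pdivlMl ?divr_gt0 // => /le_trans; apply.
rewrite mulr1 !invfM !invrK; lra.
Qed.

Lemma opnorm_has_sup A : bounded_op A ->
  has_sup [set rnorm (A x) | x in [set x : V | rnorm x <= 1]].
Proof.
move=> /bounded_op_bound[K K0 bA]; split.
  by exists (rnorm (A 0)), 0 => //=; rewrite rnorm0.
exists K => _ [x /= x1 <-]; apply: le_trans (bA x) _.
by rewrite -[leRHS]mulr1 ler_wpM2l.
Qed.

Lemma opnorm_ge0 A : bounded_op A -> 0 <= opnorm A.
Proof.
move=> bA; apply: (@le_trans _ _ (rnorm (A 0))); first exact: rnorm_ge0.
apply: ub_le_sup; first by case: (opnorm_has_sup bA).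
by exists 0 => //=; rewrite rnorm0.
Qed.

Lemma le_opnorm A x : bounded_op A -> rnorm (A x) <= opnorm A * rnorm x.
Proof.
move=> bA; have [lA _] := bA.
have [->|x0] := eqVneq x 0; first by rewrite (lin0 lA) !rnorm0 mulr0.
have nx : 0 < rnorm x by rewrite lt_neqAle eq_sym rnorm_eq0 x0 rnorm_ge0.
rewrite -ler_pdivrMr //; apply: ub_le_sup; first by case: (opnorm_has_sup bA).
exists ((rnorm x)^-1%:C *: x) => /=.
  by rewrite rnormZ cabs_real ger0_norm ?invr_ge0 ?rnorm_ge0 // mulVf ?gt_eqF.
by rewrite linZ // rnormZ cabs_real ger0_norm ?invr_ge0 ?rnorm_ge0 // mulrC.
Qed.

Lemma opnorm_le A (K : R) : 0 <= K ->
  (forall x, rnorm (A x) <= K * rnorm x) -> opnorm A <= K.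
Proof.
move=> K0 bA; apply: ge_sup.
  by exists (rnorm (A 0)), 0 => //=; rewrite rnorm0.
move=> _ [x /= x1 <-]; apply: le_trans (bA x) _.
by rewrite -[leRHS]mulr1 ler_wpM2l.
Qed.

End theory.

Lemma bounded_op_comp (V W U : normedModType R[i]) (A : V -> W) (B : W -> U) :
  bounded_op A -> bounded_op B -> bounded_op (B \o A).
Proof.
move=> [lA cA] [lB cB]; split.
  by move=> a x y /=; rewrite lA lB.
by move=> x; apply: continuous_comp; [exact: cA|exact: cB].
Qed.

End bounded_operators.

(** * Complex-valued integrals *)

Section complex_integral.
Context {R : realType}.
Notation mu := (@lebesgue_measure R).
Implicit Types (g h : R -> R[i]) (D E : set (measurableTypeR R)) (a b c : R).

Lemma cReD (x y : R[i]) : complex.Re (x + y) = complex.Re x + complex.Re y.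
Proof. by case: x; case: y. Qed.
Lemma cImD (x y : R[i]) : complex.Im (x + y) = complex.Im x + complex.Im y.
Proof. by case: x; case: y. Qed.
Lemma cReB (x y : R[i]) : complex.Re (x - y) = complex.Re x - complex.Re y.
Proof. by case: x; case: y. Qed.
Lemma cImB (x y : R[i]) : complex.Im (x - y) = complex.Im x - complex.Im y.
Proof. by case: x; case: y. Qed.
Lemma cReM (x y : R[i]) : complex.Re (x * y) =
  complex.Re x * complex.Re y - complex.Im x * complex.Im y.
Proof. by case: x; case: y. Qed.
Lemma cImM (x y : R[i]) : complex.Im (x * y) =
  complex.Re x * complex.Im y + complex.Im x * complex.Re y.
Proof. by case: x => ? ?; case: y => ? ? /=. Qed.
Lemma complexP (x y : R[i]) : complex.Re x = complex.Re y ->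
  complex.Im x = complex.Im y -> x = y.
Proof. by case: x; case: y => /= ? ? ? ? -> ->. Qed.

Lemma cvg_Re (T : Type) (F : set_system T) (FF : Filter F) (f : T -> R[i]) (l : R[i]) :
  (f x : R[i]^o) @[x --> F] --> (l : R[i]^o) ->
  complex.Re (f x) @[x --> F] --> complex.Re l.
Proof.
move=> /rcvgP h; apply/cvgrPdist_le => e /h; apply: filterS => x.
by rewrite distrC -cReB; exact/le_trans/ler_Re_cabs.
Qed.

Lemma cvg_Im (T : Type) (F : set_system T) (FF : Filter F) (f : T -> R[i]) (l : R[i]) :
  (f x : R[i]^o) @[x --> F] --> (l : R[i]^o) ->
  complex.Im (f x) @[x --> F] --> complex.Im l.
Proof.
move=> /rcvgP h; apply/cvgrPdist_le => e /h; apply: filterS => x.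
by rewrite distrC -cImB; exact/le_trans/ler_Im_cabs.
Qed.

Lemma cvg_ReIm (T : Type) (F : set_system T) (FF : Filter F) (f : T -> R[i]) (l : R[i]) :
  complex.Re (f x) @[x --> F] --> complex.Re l ->
  complex.Im (f x) @[x --> F] --> complex.Im l ->
  (f x : R[i]^o) @[x --> F] --> (l : R[i]^o).
Proof.
move=> /cvgrPdist_le hr /cvgrPdist_le hi; apply/rcvgP => e e0.
have e2 : 0 < e / 2 by rewrite divr_gt0.
apply: filterS2 (hr _ e2) (hi _ e2) => x hx hy.
apply: le_trans (cabs_le_ReIm _) _.
by rewrite cReB cImB distrC (distrC (complex.Im _)) [leRHS]splitr lerD.
Qed.

Definition ccont (g : R -> R[i]) (t : R) := {for t, continuous (g : R -> R[i]^o)}.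

Lemma ccont_ReIm g t : ccont g t <->
  {for t, continuous (@complex.Re R \o g)} /\ {for t, continuous (@complex.Im R \o g)}.
Proof.
split=> [h|[hr hi]]; last exact: cvg_ReIm.
by split; [exact: cvg_Re|exact: cvg_Im].
Qed.

Lemma ccont_cst (c : R[i]) t : ccont (fun=> c) t.
Proof. exact: cvg_cst. Qed.

Lemma ccontM g h t : ccont g t -> ccont h t -> ccont (fun s => g s * h s) t.
Proof. exact: cvgM. Qed.

Lemma ccont_real (f : R -> R) t : {for t, continuous f} -> ccont (fun s => (f s)%:C) t.
Proof. by move=> h; apply/ccont_ReIm; split=> //; exact: cvg_cst. Qed.

Lemma ccont_cis t : ccont cis t.
Proof.
by apply/ccont_ReIm; split; [exact: continuous_cos|exact: continuous_sin].
Qed.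

Lemma ccont_comp (f : R[i] -> R[i]) g t : ccont g t ->
  {for g t, continuous (f : R[i]^o -> R[i]^o)} -> ccont (fun s => f (g s)) t.
Proof. by move=> hg hf; exact: (@continuous_comp _ R[i]^o R[i]^o g f t hg hf). Qed.

Lemma ccont_cdiff (f : R[i] -> R[i]) g t l : ccont g t -> cdiff f (g t) l ->
  ccont (fun s => f (g s)) t.
Proof.
by move=> hg /cdiff_continuous; exact: ccont_comp.
Qed.

Lemma in_continuous_integrable (f : R -> R) a b :
  {in `[a, b], continuous f} -> mu.-integrable `[a, b] (EFin \o f).
Proof.
move=> cf; apply: continuous_compact_integrable; first exact: segment_compact.
by apply: continuous_in_subspaceT => x; rewrite inE => /cf.
Qed.

Lemma cintegrable_cont g a b : {in `[a, b], forall t, ccont g t} ->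
  cintegrable `[a, b] g.
Proof.
move=> cg; split; apply: in_continuous_integrable => t /cg /ccont_ReIm[hr hi] //.
Qed.

Lemma eq_cintegral D g h : {in D, g =1 h} -> cintegral D g = cintegral D h.
Proof.
by move=> gh; rewrite /cintegral; congr (_ +i* _); apply: eq_Rintegral => t /gh ->.
Qed.

Lemma cintegralD D g h : measurable D -> cintegrable D g -> cintegrable D h ->
  cintegral D (fun t => g t + h t) = cintegral D g + cintegral D h.
Proof.
move=> mD [gr gi] [hr hi]; apply: complexP.
  rewrite cReD /= -RintegralD //; apply: eq_Rintegral => t _.
  by rewrite cReD.
rewrite cImD /= -RintegralD //; apply: eq_Rintegral => t _.
by rewrite cImD.
Qed.

Lemma integrable_scale D (k : R) (f : R -> R) : measurable D ->
  mu.-integrable D (EFin \o f) -> mu.-integrable D (EFin \o (fun t => k * f t)).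
Proof.
move=> mD hf; apply: (eq_integrable mD _ _ _ (integrableZl mD k hf)) => // t _.
Qed.

Lemma cintegrableZ D (c : R[i]) g : measurable D -> cintegrable D g ->
  cintegrable D (fun t => c * g t).
Proof.
move=> mD [gr gi]; split.
  apply: (eq_integrable mD _ _ _ (integrableB mD (integrable_scale (complex.Re c) mD gr)
    (integrable_scale (complex.Im c) mD gi))) => // t _ /=.
  by rewrite cReM EFinB.
apply: (eq_integrable mD _ _ _ (integrableD mD (integrable_scale (complex.Re c) mD gi)
    (integrable_scale (complex.Im c) mD gr))) => // t _ /=.
by rewrite cImM EFinD.
Qed.

Lemma cintegralZ D (c : R[i]) g : measurable D -> cintegrable D g ->
  cintegral D (fun t => c * g t) = c * cintegral D g.
Proof.
move=> mD [gr gi]; apply: complexP.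
  rewrite cReM /= -!RintegralZl // -RintegralB //; try exact: integrable_scale.
  by apply: eq_Rintegral => t _; rewrite cReM.
rewrite cImM /= -!RintegralZl // -RintegralD //; try exact: integrable_scale.
by apply: eq_Rintegral => t _; rewrite cImM.
Qed.

Lemma cintegralB D g h : measurable D -> cintegrable D g -> cintegrable D h ->
  cintegral D (fun t => g t - h t) = cintegral D g - cintegral D h.
Proof.
move=> mD ig ih; rewrite -mulN1r -cintegralZ // -cintegralD //.
  by apply: eq_cintegral => t _; rewrite mulN1r.
exact: cintegrableZ.
Qed.

(** The factor 2 comes from estimating the real and the imaginary part separately. *)
Lemma le_cintegral D g (f : R -> R) : measurable D -> cintegrable D g ->
  mu.-integrable D (EFin \o f) -> (forall t, D t -> cabs (g t) <= f t) ->
  cabs (cintegral D g) <= 2 * \int[mu]_(t in D) f t.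
Proof.
move=> mD [gr gi] hf gf; apply: le_trans (cabs_le_ReIm _) _.
rewrite mulr_natl mulr2n /=; apply: lerD.
  apply: le_trans (le_normr_Rintegral mD gr) _.
  apply: le_Rintegral => //; first exact: (integrable_norm gr).
  by move=> t Dt; apply: le_trans (ler_Re_cabs _) (gf _ Dt).
apply: le_trans (le_normr_Rintegral mD gi) _.
apply: le_Rintegral => //; first exact: (integrable_norm gi).
by move=> t Dt; apply: le_trans (ler_Im_cabs _) (gf _ Dt).
Qed.

Lemma Rintegral_itv_cst a b k : a <= b ->
  \int[mu]_(t in `[a, b]) k = k * (b - a).
Proof.
move=> ab; rewrite Rintegral_cst //= lebesgue_measure_itv /= lte_fin.
by case: ltgtP ab => // -> _; rewrite subrr.
Qed.

Lemma le_cintegral_itv a b g M : a <= b -> cintegrable `[a, b] g ->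
  {in `[a, b], forall t, cabs (g t) <= M} ->
  cabs (cintegral `[a, b] g) <= 2 * (M * (b - a)).
Proof.
move=> ab ig gM; rewrite -Rintegral_itv_cst //; apply: le_cintegral => //.
by apply: in_continuous_integrable => t _; exact: cvg_cst.
Qed.

Lemma cintegral_itv_cst a b (c : R[i]) : a <= b ->
  cintegral `[a, b] (fun=> c) = (b - a)%:C * c.
Proof.
move=> ab; apply: complexP; rewrite ?cReM ?cImM /= Rintegral_itv_cst //; ring.
Qed.

Lemma cintegrableS D E g : measurable D -> measurable E -> D `<=` E ->
  cintegrable E g -> cintegrable D g.
Proof.
by move=> mD mE DE [gr gi]; split; [apply: integrableS gr|apply: integrableS gi].
Qed.

Lemma cintegral_split a b c g : a <= c <= b -> cintegrable `[a, b] g ->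
  cintegral `[a, b] g = cintegral `[a, c] g + cintegral `[c, b] g.
Proof.
move=> /andP[ac cb] ig; have [gr gi] := ig.
have [cr ci] : cintegrable `]c, b] g.
  by apply: cintegrableS ig => //; apply: subset_itv => //; rewrite bnd_simp.
apply: complexP; rewrite ?cReD ?cImD /=.
  have := @Rintegral_itvB _ _ (BLeft a) (BRight b) c gr.
  rewrite !bnd_simp => /(_ ac cb) + .
  by rewrite Rintegral_itv_obnd_cbnd // => <-; rewrite addrC subrK.
have := @Rintegral_itvB _ _ (BLeft a) (BRight b) c gi.
rewrite !bnd_simp => /(_ ac cb).
by rewrite Rintegral_itv_obnd_cbnd // => <-; rewrite addrC subrK.
Qed.

End complex_integral.

(** * Cauchy's theorem on annuli *)

Section bisection.
Context {R : realType}.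
Notation half n := ((2^-1 : R) ^+ n).

Lemma pow_halfS n : half n = half n.+1 + half n.+1.
Proof. by rewrite exprSr; field. Qed.

Lemma pow_half_gt0 n : 0 < half n.
Proof. by rewrite exprn_gt0 // invr_gt0. Qed.

Lemma pow_half_small (d : R) : 0 < d -> exists n, half n < d.
Proof.
move=> d0.
have /cvgrPdist_lt/(_ _ d0) : (fun n => half n) @ \oo --> (0 : R).
  by apply: cvg_expr; rewrite ger0_norm ?invr_ge0 // invf_lt1 // ltr1n.
case=> N _ /(_ N (leqnn N)) /=; rewrite sub0r normrN ger0_norm ?ltW ?pow_half_gt0 //.
by exists N.
Qed.

(** Compactness of a rectangle in the form Goursat uses: [P n a c] speaks of the rectangle with
    corner [(a, c)] and sides [l1 / 2^n], [l2 / 2^n]. If the claim passes from the four quarters to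
    the whole, a counterexample produces nested bad rectangles, which shrink to a point and
    contradict the local hypothesis there. It is used for Cauchy's theorem and for boundedness of
    continuous functions on annuli. *)
Lemma bisection (P : nat -> R -> R -> Prop) (a0 c0 l1 l2 : R) :
  0 <= l1 -> 0 <= l2 ->
  (forall n a c, (forall q1 q2 : bool,
      P n.+1 (a + q1%:R * (l1 * half n.+1)) (c + q2%:R * (l2 * half n.+1))) ->
    P n a c) ->
  (forall x y, a0 <= x <= a0 + l1 -> c0 <= y <= c0 + l2 -> exists2 d : R, 0 < d &
    forall n a c, a <= x <= a + l1 * half n -> c <= y <= c + l2 * half n ->
    half n < d -> P n a c) ->
  P 0 a0 c0.
Proof.
move=> l1_ge0 l2_ge0 Psplit Ploc; apply: contrapT => nP.
(* The implication stands under the existential so that [choice] gives a total function selecting a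
   bad quarter. *)
have step (s : nat * R * R) : exists q : bool * bool, ~ P s.1.1 s.1.2 s.2 ->
    ~ P s.1.1.+1 (s.1.2 + q.1%:R * (l1 * half s.1.1.+1))
                 (s.2 + q.2%:R * (l2 * half s.1.1.+1)).
  case: s => [[n a] c] /=.
  have [Pn|nPn] := pselect (P n a c); first by exists (true, true).
  apply: contrapT => /forallNP h; apply: nPn; apply: Psplit => q1 q2.
  by apply: contrapT => h'; apply: (h (q1, q2)).
have [g gP] := choice step.
pose s := fix s n := if n is m.+1 then
   let q := g (m, (s m).1, (s m).2) in
   ((s m).1 + q.1%:R * (l1 * half m.+1), (s m).2 + q.2%:R * (l2 * half m.+1))
  else (a0, c0).
have nPs n : ~ P n (s n).1 (s n).2.
  by elim: n => [//|n ih]; exact: gP (n, (s n).1, (s n).2) ih.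
have half_ge0 n : 0 <= half n by exact/ltW/pow_half_gt0.
(* Nested intervals in one coordinate: left endpoints increase, right endpoints decrease, and the
   supremum of the left endpoints lies in every interval. *)
have lim (l z0 : R) (u : nat -> R) : 0 <= l -> u 0%N = z0 ->
    (forall n, exists q : bool, u n.+1 = u n + q%:R * (l * half n.+1)) ->
    exists x, forall n, u n <= x <= u n + l * half n.
  move=> l0 u0 uS.
  have up n k : u n <= u (n + k)%N.
    elim: k => [|k ih]; first by rewrite addn0.
    rewrite addnS; have [q ->] := uS (n + k)%N; apply: le_trans ih _.
    by rewrite lerDl mulr_ge0 // mulr_ge0.
  have dn n k : u (n + k)%N + l * half (n + k) <= u n + l * half n.
    elim: k => [|k ih]; first by rewrite addn0.
    rewrite addnS; have [q ->] := uS (n + k)%N; apply: le_trans ih.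
    rewrite -addrA lerD2l (pow_halfS (n + k)) mulrDr lerD2r -[leRHS]mul1r.
    by rewrite ler_wpM2r ?mulr_ge0 //; case: q => /=.
  have ub n m : u m <= u n + l * half n.
    apply: (@le_trans _ _ (u (n + m)%N)); first by rewrite addnC up.
    by apply: le_trans (dn n m); rewrite lerDl mulr_ge0.
  exists (sup (range u)) => n; apply/andP; split.
    apply: ub_le_sup; last by exists n.
    by exists (u 0%N + l * half 0) => _ [m _ <-].
  by apply: ge_sup; [exists (u 0%N), 0%N|move=> _ [m _ <-]].
have [x xP] : exists x, forall n, (s n).1 <= x <= (s n).1 + l1 * half n.
  by apply: (lim _ a0) => // n /=; eexists; reflexivity.
have [y yP] : exists x, forall n, (s n).2 <= x <= (s n).2 + l2 * half n.
  by apply: (lim _ c0) => // n /=; eexists; reflexivity.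
have [||d d0 hd] := Ploc x y.
- by have := xP 0%N; rewrite expr0 mulr1.
- by have := yP 0%N; rewrite expr0 mulr1.
by have [n nd] := pow_half_small d0; apply: (nPs n); exact: hd.
Qed.

End bisection.

Section polar_goursat.
Context {R : realType}.
Notation mu := (@lebesgue_measure R).
Notation half n := ((2^-1 : R) ^+ n).
Implicit Types (f g : R[i] -> R[i]) (a b c d r t : R).

Lemma in_continuous_FTC2 (f F : R -> R) a b : a <= b ->
  {in `[a, b], continuous f} ->
  (forall x, a <= x <= b -> is_derive x (1 : R) F (f x)) ->
  \int[mu]_(x in `[a, b]) f x = F b - F a.
Proof.
rewrite le_eqVlt => /predU1P[<- _ _|ab cf dF].
  by rewrite set_itv1 Rintegral_set1 subrr.
have cF x : a <= x <= b -> {for x, continuous F}.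
  move=> xab; apply: differentiable_continuous; apply/derivable1_diffP.
  by case: (dF x xab).
have oo x : x \in `]a, b[ -> a <= x <= b.
  by rewrite in_itv /= => /andP[ax xb]; rewrite !ltW.
rewrite /Rintegral (@continuous_FTC2 _ f F) //.
- by apply: continuous_in_subspaceT => x; rewrite inE => /cf.
- split=> [x /oo/dF[]//||].
  + by apply: cvg_at_right_filter; apply: cF; rewrite lexx ltW.
  + by apply: cvg_at_left_filter; apply: cF; rewrite lexx andbT ltW.
- by move=> x /oo/dF[_ <-]; rewrite derive1E.
Qed.

Lemma cintegral_cis c d : c <= d -> 'i * cintegral `[c, d] cis = cis d - cis c.
Proof.
move=> cd; apply: complexP.
  have dc x : is_derive x (1 : R) (fun t => - cos t) (sin x).
    by apply: is_derive_eq; rewrite opprK.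
  rewrite cReM cReB /= mul0r sub0r mul1r.
  rewrite (in_continuous_FTC2 cd _ (fun x _ => dc x)); first by ring.
  by move=> x _; exact: continuous_sin.
rewrite cImM cImB /= mul0r add0r mul1r.
apply: (in_continuous_FTC2 cd _ (fun x _ => is_derive_sin x)).
by move=> x _; exact: continuous_cos.
Qed.

(** The difference is an integral of a function of modulus 1; the 2 is that of [le_cintegral]. *)
Lemma cabs_cisB c d : cabs (cis c - cis d) <= 2 * `|c - d|.
Proof.
wlog cd : c d / c <= d => [th|].
  by have [/th//|/ltW/th] := leP c d; rewrite rdistC distrC.
rewrite rdistC distrC ger0_norm ?subr_ge0 // -cintegral_cis // cabsM.
have -> : cabs ('i : R[i]) = 1.
  by rewrite /rnorm normc_def /= expr0n add0r expr1n sqrtr1.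
rewrite mul1r -[d - c]mul1r; apply: le_cintegral_itv => //.
  by apply: cintegrable_cont => t _; exact: ccont_cis.
by move=> t _; rewrite cabs_cis.
Qed.

(* The integral of the form f(z) dz/z along the boundary of the polar
   rectangle a <= |z| <= b, c <= arg z <= d. *)
Definition polar_boundary f a b c d : R[i] :=
  cintegral `[a, b] (fun r => f (r%:C * cis c) / r%:C) -
  cintegral `[a, b] (fun r => f (r%:C * cis d) / r%:C) +
  'i * (cintegral `[c, d] (fun t => f (b%:C * cis t)) -
        cintegral `[c, d] (fun t => f (a%:C * cis t))).

Definition cdiff_annulus f r1 r2 :=
  forall z : R[i], r1 <= cabs z <= r2 -> exists l, cdiff f z l.

Lemma cabs_polar r t : 0 <= r -> cabs (r%:C * cis t) = r.
Proof. by move=> r0; rewrite cabsM cabs_cis mulr1 cabs_real ger0_norm. Qed.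

Section annulus.
Variables (r1 r2 : R).
Hypothesis r1_gt0 : 0 < r1.

Lemma annulus_ge0 a : r1 <= a -> 0 < a. Proof. exact: lt_le_trans. Qed.

Lemma arc_cintegrable f a c d : cdiff_annulus f r1 r2 -> r1 <= a <= r2 ->
  cintegrable `[c, d] (fun t => f (a%:C * cis t)).
Proof.
move=> hf ha; apply: cintegrable_cont => t _.
have [|l hl] := hf (a%:C * cis t).
  by rewrite cabs_polar // ltW // annulus_ge0 //; case/andP: ha.
apply: ccont_cdiff hl; apply: ccontM; [exact: ccont_cst|exact: ccont_cis].
Qed.

Lemma radius_cintegrable f a b c : cdiff_annulus f r1 r2 -> r1 <= a -> b <= r2 ->
  cintegrable `[a, b] (fun r => f (r%:C * cis c) / r%:C).
Proof.
move=> hf ha hb; apply: cintegrable_cont => r; rewrite in_itv /= => /andP[ar rb].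
have r0 : 0 < r by apply: annulus_ge0; exact: le_trans ar.
have [|l hl] := hf (r%:C * cis c).
  by rewrite cabs_polar ?(ltW r0) // (le_trans ha ar) (le_trans rb hb).
apply: ccontM.
  apply: ccont_cdiff hl; apply: ccontM; last exact: ccont_cst.
  by apply: ccont_real; exact: cvg_id.
have -> : (fun s : R => s%:C^-1) = (fun s : R => (s^-1)%:C).
  by apply/funext => s; rewrite fmorphV.
by apply: ccont_real; apply: cvgV => //; rewrite gt_eqF.
Qed.

Lemma polar_boundaryB f g a b c d : cdiff_annulus f r1 r2 ->
  cdiff_annulus g r1 r2 -> r1 <= a <= b -> b <= r2 ->
  polar_boundary (fun z => f z - g z) a b c d =
  polar_boundary f a b c d - polar_boundary g a b c d.
Proof.
move=> hf hg /andP[ra ab] br; rewrite /polar_boundary.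
have ar : r1 <= a <= r2 by rewrite ra (le_trans ab).
have rbr : r1 <= b <= r2 by rewrite br (le_trans ra).
rewrite !cintegralB //; try exact: arc_cintegrable.
under eq_cintegral do rewrite mulrBl.
rewrite cintegralB //; try exact: radius_cintegrable.
under [X in _ - X + _ = _]eq_cintegral do rewrite mulrBl.
rewrite cintegralB //; try exact: radius_cintegrable.
ring.
Qed.

(** The terms in [al] cancel between opposite sides. For the linear term the radial sides give
    [be (b - a) (cis c - cis d)] and the arcs, by [cintegral_cis], its opposite. *)
Lemma polar_boundary_affine (al be : R[i]) a b c d : 0 < a -> a <= b -> c <= d ->
  polar_boundary (fun z => al + be * z) a b c d = 0.
Proof.
move=> a0 ab cd; rewrite /polar_boundary.
have rE t : cintegral `[a, b] (fun r => (al + be * (r%:C * cis t)) / r%:C) =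
    cintegral `[a, b] (fun r => al / r%:C) + (b - a)%:C * (be * cis t).
  rewrite -cintegral_itv_cst // -cintegralD //; last first.
  - by apply: cintegrable_cont => r _; exact: ccont_cst.
  - apply: cintegrable_cont => r; rewrite in_itv /= => /andP[ar _].
    apply: ccontM; first exact: ccont_cst.
    have -> : (fun s : R => s%:C^-1) = (fun s : R => (s^-1)%:C).
      by apply/funext => s; rewrite fmorphV.
    by apply: ccont_real; apply: cvgV => //; rewrite gt_eqF // (lt_le_trans a0).
  apply: eq_cintegral => r; rewrite inE /= in_itv /= => /andP[ar _].
  have r0 : r%:C != 0 :> R[i].
    by rewrite (inj_eq (@complexI R)) gt_eqF // (lt_le_trans a0).
  by field.
have tE r : cintegral `[c, d] (fun t => al + be * (r%:C * cis t)) =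
    (d - c)%:C * al + be * r%:C * cintegral `[c, d] cis.
  have ic : cintegrable `[c, d] (@cis R).
    by apply: cintegrable_cont => t _; exact: ccont_cis.
  rewrite -cintegral_itv_cst // -cintegralZ // -cintegralD //.
  - by apply: eq_cintegral => t _; ring.
  - by apply: cintegrable_cont => t _; exact: ccont_cst.
  - exact: cintegrableZ.
rewrite !rE !tE [X in _ + X](_ : _ =
  be * (b%:C - a%:C) * ('i * cintegral `[c, d] cis)); last by ring.
by rewrite cintegral_cis // rmorphB /=; ring.
Qed.

(** For [dr / r] a radial side has length at most [(b - a) / r1]. The 4 counts two sides of each
    kind and the factor 2 of [le_cintegral]. *)
Lemma le_polar_boundary f a b c d M : cdiff_annulus f r1 r2 ->
  r1 <= a <= b -> b <= r2 -> c <= d ->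
  (forall r t, a <= r <= b -> c <= t <= d -> cabs (f (r%:C * cis t)) <= M) ->
  cabs (polar_boundary f a b c d) <= 4 * (M * ((b - a) / r1 + (d - c))).
Proof.
move=> hf /andP[ra ab] br cd fM; rewrite /polar_boundary.
have ar : r1 <= a <= r2 by rewrite ra (le_trans ab).
have rbr : r1 <= b <= r2 by rewrite br (le_trans ra).
have aa : a <= a <= b by rewrite lexx.
have bb : a <= b <= b by rewrite lexx andbT.
have M0 : 0 <= M by apply: le_trans (fM a c _ _); rewrite ?rnorm_ge0 ?lexx.
have Hr t : c <= t <= d ->
    cabs (cintegral `[a, b] (fun r => f (r%:C * cis t) / r%:C)) <=
    2 * (M / r1 * (b - a)).
  move=> ht; apply: le_cintegral_itv => //; first exact: radius_cintegrable.
  move=> r; rewrite in_itv /= => /andP[a_r rb].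
  have r0 : 0 < r by apply: annulus_ge0; exact: le_trans a_r.
  rewrite cabsM cabsV cabs_real gtr0_norm // ler_pM ?rnorm_ge0 ?invr_ge0 ?(ltW r0) //.
    by apply: fM; rewrite ?a_r.
  by rewrite lef_pV2 ?posrE // (le_trans ra).
have Ht r : a <= r <= b ->
    cabs (cintegral `[c, d] (fun t => f (r%:C * cis t))) <= 2 * (M * (d - c)).
  move=> /andP[a_r rb]; apply: le_cintegral_itv => //.
    by apply: arc_cintegrable => //; rewrite (le_trans ra) // (le_trans rb).
  by move=> t; rewrite in_itv /= => ht; apply: fM; rewrite ?a_r.
have i1 : cabs ('i : R[i]) = 1.
  by rewrite /rnorm normc_def /= expr0n add0r expr1n sqrtr1.
apply: le_trans (rnormD _ _) _; rewrite cabsM i1 mul1r.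
apply: le_trans (lerD (rnormB _ _) (rnormB _ _)) _.
apply: le_trans (lerD (lerD (Hr c _) (Hr d _)) (lerD (Ht b _) (Ht a _))) _;
  rewrite ?lexx ?andbT //.
by rewrite le_eqVlt; apply/predU1P; left; field; exact: lt0r_neq0.
Qed.

Lemma polar_boundary_split f a b c d m n : cdiff_annulus f r1 r2 ->
  r1 <= a -> a <= m <= b -> b <= r2 -> c <= n <= d ->
  polar_boundary f a b c d =
  polar_boundary f a m c n + polar_boundary f m b c n +
  polar_boundary f a m n d + polar_boundary f m b n d.
Proof.
move=> hf ra amb br cnd; have /andP[am mb] := amb; have /andP[cn nd] := cnd.
rewrite /polar_boundary.
have rs t := cintegral_split amb (radius_cintegrable t hf ra br).
have ts r (rr : r1 <= r <= r2) := cintegral_split cnd (arc_cintegrable c d hf rr).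
have ha : r1 <= a <= r2 by rewrite ra (le_trans am) // (le_trans mb).
have hb : r1 <= b <= r2 by rewrite br (le_trans ra) // (le_trans am).
by rewrite (rs c) (rs d) (ts a ha) (ts b hb); ring.
Qed.

(** In polar coordinates the pieces of a bisected annulus are again polar rectangles, so no
    deformation of contours is needed. On a small piece [f] differs from its tangent affine function
    by [o(diameter)], and the perimeter is also of order [2^-n], which gives [e / 4^n]. *)
Lemma polar_goursat f c d : r1 <= r2 -> cdiff_annulus f r1 r2 -> c <= d ->
  polar_boundary f r1 r2 c d = 0.
Proof.
move=> r12 hf cd; apply: (@rnorm_le0 _ R[i]^o) => e e0.
pose l1 := r2 - r1; pose l2 := d - c.
have l1_ge0 : 0 <= l1 by rewrite subr_ge0.
have l2_ge0 : 0 <= l2 by rewrite subr_ge0.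
(* The guards keep the rectangle inside the annulus. The claimed share is [e / 4^n], so the four
   quarters add up to the bound for the whole. *)
pose P n a c := r1 <= a -> a + l1 * half n <= r2 ->
  cabs (polar_boundary f a (a + l1 * half n) c (c + l2 * half n)) <=
  e * (half n * half n).
suff : P 0%N r1 c.
  by rewrite /P expr0 !mulr1 (addrC r1) (addrC c) !subrK; apply.
apply: (@bisection _ P r1 c l1 l2) => //.
  move=> n a c' h ra ar.
  have hS : l1 * half n.+1 + l1 * half n.+1 = l1 * half n.
    by rewrite -mulrDr -pow_halfS.
  have hS2 : l2 * half n.+1 + l2 * half n.+1 = l2 * half n.
    by rewrite -mulrDr -pow_halfS.
  have p1 : 0 <= l1 * half n.+1 by rewrite mulr_ge0 // ltW // pow_half_gt0.
  have p2 : 0 <= l2 * half n.+1 by rewrite mulr_ge0 // ltW // pow_half_gt0.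
  rewrite -hS -hS2 !addrA in ar *.
  rewrite (@polar_boundary_split f _ _ _ _ (a + l1 * half n.+1)
    (c' + l2 * half n.+1)) ?lerDl ?lerDr ?p1 ?p2 //=.
  have -> : e * (half n * half n) = e * (half n.+1 * half n.+1) +
    e * (half n.+1 * half n.+1) + e * (half n.+1 * half n.+1) +
    e * (half n.+1 * half n.+1) by rewrite (pow_halfS n); ring.
  apply: le_trans (rnormD _ _) _; apply: lerD; last first.
    have := h true true; rewrite !mul1r; apply => //.
    by rewrite (le_trans ra) // lerDl.
  apply: le_trans (rnormD _ _) _; apply: lerD; last first.
    have := h false true; rewrite mul0r mul1r addr0; apply => //.
    by apply: le_trans ar; rewrite lerDl.
  apply: le_trans (rnormD _ _) _; apply: lerD; last first.
    have := h true false; rewrite mul0r mul1r addr0; apply => //.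
    by rewrite (le_trans ra) // lerDl.
  have := h false false; rewrite !mul0r !addr0; apply => //.
  by apply: le_trans ar; rewrite lerDl.
move=> x y; rewrite /l1 (addrC r1) subrK => /andP[rx xr] _.
have x0 := annulus_ge0 rx.
have [|l hl] := hf (x%:C * cis y); first by rewrite cabs_polar ?(ltW x0) ?rx.
(* [K * half n] bounds the distance from the limit point to any point of a generation [n] rectangle
   around it: [l1] is the radial share, and [2 * r2 * l2] the angular one, by [cabs_cisB]. [L] is
   the constant that [le_polar_boundary] then produces. *)
pose K := l1 + 2 * r2 * l2.
have r2_ge0 : 0 <= r2 by rewrite (le_trans (ltW r1_gt0)).
have K0 : 0 <= K by rewrite addr_ge0 // !mulr_ge0.
pose L := 4 * (K * (l1 / r1 + l2)).
have L0 : 0 <= L.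
  by rewrite mulr_ge0 // mulr_ge0 // addr_ge0 // divr_ge0 // ltW.
have L1 : 0 < 1 + L by rewrite ltr_pwDl.
have [dl dl0 hdl] := hl _ (divr_gt0 e0 L1).
exists (dl / (1 + K)); first by rewrite divr_gt0 // ltr_pwDl.
move=> n a c'; rewrite -/l1 => /andP[ax xa] /andP[cy yc].
rewrite ltr_pdivlMr ?ltr_pwDl // => nd ra ar.
(* The tangent affine function at the limit point: its boundary integral vanishes, so only the
   remainder of [f] is left to estimate. *)
pose A z := (f (x%:C * cis y) - l * (x%:C * cis y)) + l * z.
have hA : cdiff_annulus A r1 r2.
  move=> z _; exists (0 + l * 1); apply: cdiffD; first exact: cdiff_cst.
  by apply: cdiffZ; exact: cdiff_id.
have p1 : 0 <= l1 * half n by rewrite mulr_ge0 // ltW // pow_half_gt0.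
have p2 : 0 <= l2 * half n by rewrite mulr_ge0 // ltW // pow_half_gt0.
have -> : polar_boundary f a (a + l1 * half n) c' (c' + l2 * half n) =
    polar_boundary (fun z => f z - A z) a (a + l1 * half n) c' (c' + l2 * half n).
  rewrite polar_boundaryB ?ra ?lerDl //.
  by rewrite polar_boundary_affine ?subr0 ?lerDl // annulus_ge0.
apply: le_trans (@le_polar_boundary _ _ _ _ _ (e / (1 + L) * (K * half n)) _ _ _ _ _) _;
  rewrite ?ra ?lerDl //.
- move=> z /[dup] /hf[m hm] /hA[m' hm']; exists (m - m'); exact: cdiffB.
- move=> r t /andP[ar' ra'] /andP[ct tc].
  have -> : f (r%:C * cis t) - A (r%:C * cis t) =
     f (x%:C * cis y + (r%:C * cis t - x%:C * cis y)) - f (x%:C * cis y)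
     - l * (r%:C * cis t - x%:C * cis y).
    by rewrite (addrC _ (_ - _)) subrK /A; ring.
  have hn : cabs (r%:C * cis t - x%:C * cis y) <= K * half n.
    have -> : r%:C * cis t - x%:C * cis y =
        (r - x)%:C * cis t + x%:C * (cis t - cis y) :> R[i].
      by rewrite rmorphB /=; ring.
    apply: le_trans (rnormD _ _) _; rewrite !cabsM cabs_cis mulr1 !cabs_real.
    rewrite (gtr0_norm x0) /K mulrDl; apply: lerD.
      by rewrite ler_norml; lra.
    apply: le_trans (ler_wpM2l (ltW x0) (cabs_cisB _ _)) _.
    have ty : `|t - y| <= l2 * half n by rewrite ler_norml; lra.
    rewrite -!mulrA mulrCA ler_pM2l //.
    by apply: ler_pM => //; exact: ltW.
  apply: le_trans (hdl _ _) _.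
    apply: le_lt_trans hn (le_lt_trans _ nd).
    by rewrite mulrC ler_wpM2l ?(ltW (pow_half_gt0 _)) // lerDr.
  by rewrite ler_wpM2l // divr_ge0 ?ltW.
have -> : 4 * (e / (1 + L) * (K * half n) * ((a + l1 * half n - a) / r1 +
    (c' + l2 * half n - c'))) = e * (half n * half n) * (L / (1 + L)).
  by rewrite {2}/L; field; rewrite (lt0r_neq0 L1) lt0r_neq0.
rewrite -[leRHS]mulr1 ler_wpM2l //.
  by rewrite !mulr_ge0 // ?(ltW (pow_half_gt0 _)) // ltW.
by rewrite ler_pdivrMr // mul1r lerDr.
Qed.

(** The contour integral of [f(z) dz / (i z)]. With this normalisation Cauchy's theorem says that it
    does not depend on the radius. *)
Definition circle_int f r := cintegral `[0, 2 * pi] (fun t => f (r%:C * cis t)).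

End annulus.

(** For a full turn the two radial sides of the polar rectangle coincide and cancel, leaving the two
    circles. *)
Lemma circle_int_const f r1 r2 : 0 < r1 -> r1 <= r2 -> cdiff_annulus f r1 r2 ->
  circle_int f r1 = circle_int f r2.
Proof.
move=> r10 r12 hf.
have pi0 : 0 <= 2 * pi :> R by rewrite mulr_ge0 // pi_ge0.
have := polar_goursat r10 r12 hf pi0.
rewrite /polar_boundary.
have -> : cis (2 * pi) = 1 :> R[i] by rewrite /cis mulr_natl cos2pi sin2pi.
rewrite cis0 subrr add0r => /eqP; rewrite mulf_eq0 orbC => /orP[|].
  by rewrite subr_eq0 => /eqP.
by rewrite eq_complex /= oner_eq0 andbF.
Qed.

End polar_goursat.

(** * Cauchy's formula and polynomial approximation *)

Section cauchy.
Context {R : realType}.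
Notation mu := (@lebesgue_measure R).
Notation half n := ((2^-1 : R) ^+ n).
Implicit Types (f g : R[i] -> R[i]) (r s : R) (z : R[i]).

Lemma twopi_gt0 : 0 < 2 * pi :> R.
Proof. by rewrite mulr_gt0 // pi_gt0. Qed.

Lemma circle_cintegrable f r : 0 < r ->
  (forall z, cabs z = r -> exists l, cdiff f z l) ->
  cintegrable `[0, 2 * pi] (fun t => f (r%:C * cis t)).
Proof.
move=> r0 hf; apply: (@arc_cintegrable R r r r0 f) => //; last by rewrite lexx.
by move=> z /andP[a b]; apply: hf; apply/eqP; rewrite eq_le a b.
Qed.

Lemma le_circle_int f r M : 0 < r ->
  (forall z, cabs z = r -> exists l, cdiff f z l) ->
  {in `[0, 2 * pi], forall t, cabs (f (r%:C * cis t)) <= M} ->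
  cabs (circle_int f r) <= 2 * (M * (2 * pi)).
Proof.
move=> r0 hf fM.
have := le_cintegral_itv (ltW twopi_gt0) (circle_cintegrable r0 hf) fM.
by rewrite subr0.
Qed.

Lemma circle_int_cst (c : R[i]) r : circle_int (fun=> c) r = (2 * pi)%:C * c.
Proof. by rewrite /circle_int cintegral_itv_cst ?subr0 // ltW // twopi_gt0. Qed.

Lemma eq_circle_int f g r : 0 <= r -> (forall z, cabs z = r -> f z = g z) ->
  circle_int f r = circle_int g r.
Proof.
by move=> r0 fg; apply: eq_cintegral => t _; apply: fg; rewrite cabs_polar.
Qed.

Lemma circle_intB f g r : 0 < r ->
  (forall z, cabs z = r -> exists l, cdiff f z l) ->
  (forall z, cabs z = r -> exists l, cdiff g z l) ->
  circle_int (fun z => f z - g z) r = circle_int f r - circle_int g r.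
Proof. by move=> r0 hf hg; apply: cintegralB => //; exact: circle_cintegrable. Qed.

Lemma circle_intD f g r : 0 < r ->
  (forall z, cabs z = r -> exists l, cdiff f z l) ->
  (forall z, cabs z = r -> exists l, cdiff g z l) ->
  circle_int (fun z => f z + g z) r = circle_int f r + circle_int g r.
Proof. by move=> r0 hf hg; apply: cintegralD => //; exact: circle_cintegrable. Qed.

Lemma circle_intZ (c : R[i]) f r : 0 < r ->
  (forall z, cabs z = r -> exists l, cdiff f z l) ->
  circle_int (fun z => c * f z) r = c * circle_int f r.
Proof. by move=> r0 hf; apply: cintegralZ => //; exact: circle_cintegrable. Qed.

(** The circle integral does not change when the radius shrinks towards 0, where [f] is close to
    [f 0] by continuity. *)
Lemma mean_value f r : 0 < r -> (forall z, cabs z <= r -> exists l, cdiff f z l) ->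
  circle_int f r = (2 * pi)%:C * f 0.
Proof.
move=> r0 hf; have p0 := twopi_gt0.
apply/eqP; rewrite -subr_eq0; apply/eqP; apply: (@rnorm_le0 _ R[i]^o) => e e0.
have e'0 : 0 < e / (2 * (2 * pi)) by rewrite divr_gt0 // mulr_gt0.
have [|l /cdiff_continuous] := hf 0; first by rewrite rnorm0 ltW.
move=> /rcvgP/(_ _ e'0)/nbhs_rnormP[d d0 hd].
pose s := Num.min r (d / 2).
have s0 : 0 < s by rewrite lt_min r0 divr_gt0.
have sr : s <= r by rewrite ge_min lexx.
have sd : s < d.
  by rewrite /s gt_min; apply/orP; right; rewrite ltr_pdivrMr // ltr_pMr // ltr1n.
rewrite -(@circle_int_const R f s r) //; last by move=> z /andP[_]; exact: hf.
have hs z : cabs z = s -> exists l, cdiff f z l by move=> zs; apply: hf; rewrite zs.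
have hc z : cabs z = s -> exists l, cdiff (fun=> f 0) z l.
  by move=> _; exists 0; exact: cdiff_cst.
rewrite -(circle_int_cst (f 0) s) -circle_intB //.
apply: le_trans (@le_circle_int _ s (e / (2 * (2 * pi))) s0 _ _) _.
- move=> z zs; have [m hm] := hs _ zs; have [m' hm'] := hc _ zs.
  by exists (m - m'); exact: cdiffB.
- by move=> t _; apply: hd; rewrite subr0 cabs_polar // ltW.
- by rewrite mulrCA divfK // gt_eqF // mulr_gt0.
Qed.

(** Bisection again: bounds on the quarters give one on the whole by taking the maximum, and
    continuity gives a bound near each point. *)
Lemma bounded_polar (h : R[i] -> R[i]) r1 r2 : 0 < r1 -> r1 <= r2 ->
  (forall z, r1 <= cabs z <= r2 -> {for z, continuous (h : R[i]^o -> R[i]^o)}) ->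
  exists M, forall r t, r1 <= r <= r2 -> 0 <= t <= 2 * pi ->
    cabs (h (r%:C * cis t)) <= M.
Proof.
move=> r10 r12 ch.
pose l1 := r2 - r1; pose l2 : R := 2 * pi.
have l1_ge0 : 0 <= l1 by rewrite subr_ge0.
have l2_ge0 : 0 <= l2 by rewrite ltW // twopi_gt0.
pose P n a c := exists M, forall r t, a <= r <= a + l1 * half n ->
  c <= t <= c + l2 * half n -> cabs (h (r%:C * cis t)) <= M.
suff : P 0%N r1 0 by rewrite /P expr0 !mulr1 (addrC r1) subrK add0r.
apply: (@bisection _ P r1 0 l1 l2) => //.
  move=> n a c hP.
  have [M11 h11] := hP true true; have [M10 h10] := hP true false.
  have [M01 h01] := hP false true; have [M00 h00] := hP false false.
  exists (Num.max (Num.max M11 M10) (Num.max M01 M00)) => r t.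
  rewrite (pow_halfS n) !mulrDr !addrA => /andP[ar ra] /andP[ct tc].
  rewrite !le_max.
  have [tm|mt] := leP t (c + l2 * half n.+1); have [rm|mr] := leP r (a + l1 * half n.+1).
  - by rewrite h00 ?orbT // !mul0r !addr0 ?ar ?ct.
  - by rewrite h10 ?orbT // ?mul0r ?mul1r ?addr0 ?(ltW mr) ?ct.
  - by rewrite h01 ?orbT // ?mul0r ?mul1r ?addr0 ?(ltW mt) ?ar.
  - by rewrite h11 ?orbT // ?mul0r ?mul1r ?addr0 ?(ltW mt) ?(ltW mr).
move=> x y; rewrite /l1 (addrC r1) subrK => /andP[rx xr] _.
have x0 : 0 < x by exact: lt_le_trans rx.
have := ch (x%:C * cis y); rewrite cabs_polar ?(ltW x0) // rx xr => /(_ isT).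
move=> /rcvgP/(_ 1 ltr01)/nbhs_rnormP[d d0 hd].
pose K := l1 + 2 * r2 * l2.
have r2_ge0 : 0 <= r2 by rewrite (le_trans (ltW r10)).
have K0 : 0 <= K by rewrite addr_ge0 // mulr_ge0 // mulr_ge0.
exists (d / (1 + K)); first by rewrite divr_gt0 // ltr_pwDl.
move=> n a c; rewrite -/l1 => /andP[ax xa] /andP[cy yc].
rewrite ltr_pdivlMr ?ltr_pwDl // => nd.
exists (1 + cabs (h (x%:C * cis y))) => r t /andP[ar ra] /andP[ct tc].
rewrite -lerBlDr; apply: le_trans (ler_rnormB _ _) _; apply: hd.
have -> : r%:C * cis t - x%:C * cis y =
    (r - x)%:C * cis t + x%:C * (cis t - cis y) :> R[i].
  by rewrite rmorphB /=; ring.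
have n0 : 0 < half n := pow_half_gt0 n.
apply: le_lt_trans nd; apply: le_trans (rnormD _ _) _.
rewrite !cabsM cabs_cis mulr1 !cabs_real (gtr0_norm x0).
apply: (@le_trans _ _ (K * half n)); last by rewrite mulrC ler_wpM2l ?(ltW n0) // lerDr.
rewrite /K mulrDl; apply: lerD; first by rewrite ler_norml; lra.
apply: le_trans (ler_wpM2l (ltW x0) (cabs_cisB _ _)) _.
have ty : `|t - y| <= l2 * half n by rewrite ler_norml; lra.
by rewrite -!mulrA mulrCA ler_pM2l //; apply: ler_pM => //; [exact: ltW|rewrite mulrA].
Qed.

(** Continuity under the integral sign, dominated by the constant of [bounded_polar]. It serves to
    cross the radius [cabs z] in Cauchy's formula, and later for the inner integral of the Besov
    formula, whose integrand is continuous but involves moduli. *)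
Lemma circle_int_continuous (h : R[i] -> R[i]) r1 r2 s : 0 < r1 -> r1 < s < r2 ->
  (forall z, r1 <= cabs z <= r2 -> {for z, continuous (h : R[i]^o -> R[i]^o)}) ->
  ccont (circle_int h) s.
Proof.
move=> r10 /andP[r1s sr2] ch.
have [M hM] := bounded_polar r10 (ltW (lt_trans r1s sr2)) ch.
have cht r t : r1 < r < r2 -> ccont (fun t => h (r%:C * cis t)) t.
  move=> /andP[r1r rr2]; have r0 : 0 < r by exact: lt_trans r1r.
  apply: ccont_comp.
    by apply: ccontM; [exact: ccont_cst|exact: ccont_cis].
  by apply: ch; rewrite cabs_polar ?ltW // (ltW r1r) ltW.
have chr t r : r1 < r < r2 -> ccont (fun r => h (r%:C * cis t)) r.
  move=> /andP[r1r rr2]; have r0 : 0 < r by exact: lt_trans r1r.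
  apply: ccont_comp.
    by apply: ccontM; [apply: ccont_real; exact: cvg_id|exact: ccont_cst].
  by apply: ch; rewrite cabs_polar ?ltW // (ltW r1r) ltW.
have sI : s \in (`]r1, r2[%classic : set R) by rewrite inE /= in_itv /= r1s.
have iM : mu.-integrable `[0, 2 * pi] (EFin \o (fun=> M)).
  by apply: in_continuous_integrable => t _; exact: cvg_cst.
apply/ccont_ReIm; split.
  apply: (@continuity_under_integral R _ _ mu
    (fun r t => complex.Re (h (r%:C * cis t))) `[0, 2 * pi] _ r1 r2 _ _ (fun=> M)) => //.
  - move=> r; rewrite /= in_itv /= => hr; apply: in_continuous_integrable => t _.
    by have /ccont_ReIm[] := cht r t hr.
  - apply: aeW => t _ r; rewrite inE /= in_itv /= => hr.
    by have /ccont_ReIm[] := chr t r hr.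
  - move=> r; rewrite /= in_itv /= => /andP[a b]; apply: aeW => t.
    rewrite /= in_itv /= => ht; apply: le_trans (ler_Re_cabs _) _.
    by apply: hM => //; rewrite (ltW a) ltW.
apply: (@continuity_under_integral R _ _ mu
  (fun r t => complex.Im (h (r%:C * cis t))) `[0, 2 * pi] _ r1 r2 _ _ (fun=> M)) => //.
- move=> r; rewrite /= in_itv /= => hr; apply: in_continuous_integrable => t _.
  by have /ccont_ReIm[] := cht r t hr.
- apply: aeW => t _ r; rewrite inE /= in_itv /= => hr.
  by have /ccont_ReIm[] := chr t r hr.
- move=> r; rewrite /= in_itv /= => /andP[a b]; apply: aeW => t.
  rewrite /= in_itv /= => ht; apply: le_trans (ler_Im_cabs _) _.
  by apply: hM => //; rewrite (ltW a) ltW.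
Qed.

End cauchy.

(** * Cauchy's integral formula *)

Section cauchy_formula.
Context {R : realType}.
Implicit Types (f g : R[i] -> R[i]) (r rho s : R) (z w : R[i]).

Definition cdiff_disc f r := forall z, cabs z <= r -> exists l, cdiff f z l.

Lemma cabs_neq (x y : R[i]) : cabs x != cabs y -> x != y.
Proof. by apply: contraNneq => ->. Qed.

Lemma cdiff_kernel z w : w != z -> exists l, cdiff (fun w => (w - z)^-1) w l.
Proof.
move=> wz; apply: (@cdiffV _ (fun w => w - z) w (1 - 0)); last by rewrite subr_eq0.
by apply: cdiffB; [exact: cdiff_id|exact: cdiff_cst].
Qed.

(** The pattern for contour integrals that do not depend on the radius [s] and decay as [s]
    grows. *)
Lemma cvg0_unique (V : normedModType R[i]) (x : V) (A B : R) :
  0 <= A -> (forall s, B < s -> rnorm x <= A / (s - B)) -> x = 0.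
Proof.
move=> A0 h; apply: rnorm_le0 => e e0.
have := h (B + (A + 1) / e); rewrite ltrDl divr_gt0 // ?ltr_pwDr // => /(_ isT).
move=> /le_trans; apply; rewrite addrC addKr invf_div mulrA.
by rewrite ler_pdivrMr ?ltr_pwDr // mulrC ler_pM2l // lerDl.
Qed.

(** Write [w / (w - z) = 1 + z / (w - z)]: the second term integrates to 0, because its integral is
    the same on every larger circle and decays with the radius. *)
Lemma circle_int_kernel z rho : cabs z < rho ->
  circle_int (fun w => w / (w - z)) rho = (2 * pi)%:C.
Proof.
move=> zr; have r0 : 0 < rho := le_lt_trans (rnorm_ge0 _) zr.
have hd s w : cabs z < s -> cabs w = s -> exists l, cdiff (fun w => (w - z)^-1) w l.
  by move=> zs ws; apply: cdiff_kernel; apply: cabs_neq; rewrite ws gt_eqF.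
have E s : cabs z < s -> circle_int (fun w => w / (w - z)) s =
    (2 * pi)%:C + z * circle_int (fun w => (w - z)^-1) s.
  move=> zs; have s0 : 0 < s := le_lt_trans (rnorm_ge0 _) zs.
  rewrite -circle_intZ // => [|w ws]; last exact: hd ws.
  rewrite -[(2 * pi)%:C]mulr1 -(circle_int_cst 1 s) -circle_intD //.
  - apply: eq_circle_int => [|w ws]; first exact: ltW.
    have wz : w - z != 0 by rewrite subr_eq0; apply: cabs_neq; rewrite ws gt_eqF.
    by field.
  - by move=> w _; exists 0; exact: cdiff_cst.
  - by move=> w /(hd _ _ zs)[l hl]; exists (z * l); exact: cdiffZ.
rewrite E //; suff -> : circle_int (fun w => (w - z)^-1) rho = 0 by rewrite mulr0 addr0.
apply: (@cvg0_unique R[i]^o _ (2 * (2 * pi)) rho).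
  by rewrite mulr_ge0 // ltW // twopi_gt0.
move=> s rs; have zs := lt_trans zr rs.
have s0 : 0 < s := lt_trans r0 rs.
rewrite (circle_int_const r0 (ltW rs)); last first.
  move=> w /andP[rw _]; apply: cdiff_kernel; apply: cabs_neq.
  by rewrite gt_eqF // (lt_le_trans zr).
rewrite -mulrA [_ / (s - rho)]mulrC.
apply: le_circle_int => //; first by move=> w; exact: hd.
move=> t _; rewrite cabsV lef_pV2 ?posrE ?subr_gt0 //; last first.
  rewrite lt_neqAle rnorm_ge0 andbT eq_sym rnorm_eq0 subr_eq0; apply: cabs_neq.
  by rewrite cabs_polar ?(ltW s0) // gt_eqF.
apply: le_trans (ler_rnormB _ _); rewrite cabs_polar ?(ltW s0) //.
by rewrite lerD2l lerN2 ltW.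
Qed.

(** After subtracting [f z], the integrand extends continuously over [w = z] to a function [h],
    differentiable elsewhere. As a function of the radius its circle integral is 0 below [cabs z],
    constant above, and continuous at [cabs z]; so it is 0 throughout. *)
Lemma cauchy_formula f z rho : cdiff_disc f rho -> cabs z < rho ->
  circle_int (fun w => f w * (w / (w - z))) rho = (2 * pi)%:C * f z.
Proof.
move=> hf zr; have r0 : 0 < rho := le_lt_trans (rnorm_ge0 _) zr.
have hk w : w != z -> exists l, cdiff (fun w => w / (w - z)) w l.
  move=> wz; have [l hl] := cdiff_kernel wz.
  by eexists; apply: (cdiffM (cdiff_id w) hl).
have fk w : w != z -> cabs w <= rho -> exists l, cdiff (fun w => f w * (w / (w - z))) w l.
  move=> /hk[l hl] /hf[m hm]; eexists; exact: cdiffM hm hl.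
have ck w : w != z -> exists l, cdiff (fun w => f z * (w / (w - z))) w l.
  by move=> /hk[l hl]; eexists; exact: cdiffZ hl.
apply/eqP; rewrite -subr_eq0 mulrC -(circle_int_kernel zr) -circle_intZ //; last first.
  by move=> w wr; apply: hk; apply: cabs_neq; rewrite wr gt_eqF.
rewrite -circle_intB //; last 2 first.
- by move=> w wr; apply: fk; [apply: cabs_neq; rewrite wr gt_eqF|rewrite wr].
- by move=> w wr; apply: ck; apply: cabs_neq; rewrite wr gt_eqF.
have [l hl] := hf z (ltW zr).
(* The value at [z] is the limit: the difference quotient tends to [l] and the factor [w] to [z]. *)
pose h w := if w == z then z * l else (f w - f z) * (w / (w - z)).
have hE w : w != z -> f w * (w / (w - z)) - f z * (w / (w - z)) = h w.
  by move=> wz; rewrite /h (negPf wz) mulrBl.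
rewrite (@eq_circle_int _ _ h) ?(ltW r0) // => [|w wr]; last first.
  by apply: hE; apply: cabs_neq; rewrite wr gt_eqF.
have hd w : w != z -> cabs w <= rho -> exists l, cdiff h w l.
  move=> wz wr; have [a ha] := fk _ wz wr; have [b hb] := ck _ wz.
  exists (a - b); apply: cdiff_ext (cdiffB ha hb).
  apply/nbhs_rnormP; exists (cabs (w - z)).
    by rewrite lt_neqAle rnorm_ge0 andbT eq_sym rnorm_eq0 subr_eq0.
  move=> v; rewrite -[v - w]opprB rnormN => vw; apply: hE.
  by apply: contraTneq vw => ->; rewrite ltxx.
(* At [z = 0] no radius lies below [cabs z]; there the kernel is 1 on the circle and the mean value
   property applies directly. *)
have [z0|z0] := eqVneq z 0.
  have hc : cdiff_disc (fun w => f w - f z) rho.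
    by move=> w /hf[m hm]; exists (m - 0); apply: cdiffB => //; exact: cdiff_cst.
  have := mean_value r0 hc; rewrite z0 subrr mulr0 => <-.
  apply/eqP/eq_circle_int; first exact: ltW.
  move=> w wr; have w0 : w != 0 by apply: cabs_neq; rewrite wr rnorm0 gt_eqF.
  by rewrite /h z0 (negPf w0) subr0 divff // mulr1.
have hcont w : cabs w <= rho -> {for w, continuous (h : R[i]^o -> R[i]^o)}.
  move=> wr; have [->|wz] := eqVneq w z; last by have [m /cdiff_continuous] := hd w wz wr.
  apply/(@rcvgP R R[i]^o R[i]^o (nbhs (z : R[i]^o)) _ h (h z)) => e e0.
  have K0 : 0 < cabs z + 1 + cabs l by rewrite -addrA ltr_pwDr ?rnorm_ge0 // ltr_pwDl ?rnorm_ge0.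
  have [d d0 dP] := hl _ (divr_gt0 e0 K0).
  pose del := Num.min (Num.min d 1) (e / (cabs z + 1 + cabs l)).
  apply/nbhs_rnormP; exists del; first by rewrite !lt_min d0 ltr01 divr_gt0.
  move=> v; rewrite !lt_min => /andP[/andP[vd v1] ve].
  rewrite /h eqxx; case: eqP => [_|/eqP vz]; first by rewrite subrr rnorm0 ltW.
  have vz0 : v - z != 0 by rewrite subr_eq0.
  have -> : (f v - f z) * (v / (v - z)) - z * l =
      (f (z + (v - z)) - f z - l * (v - z)) * (v / (v - z)) + l * (v - z).
    by rewrite (addrC z) subrK; field.
  apply: le_trans (rnormD _ _) _.
  have nv : cabs v <= cabs z + 1.
    rewrite -lerBlDl; apply: le_trans (ler_rnormB _ _) (ltW v1).
  have := dP _ vd; set A := cabs (_ - _) => hA.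
  have vz1 : 0 < cabs (v - z) by rewrite lt_neqAle rnorm_ge0 andbT eq_sym rnorm_eq0.
  have := @rnorm_ge0 _ R[i]^o l; have := @rnorm_ge0 _ R[i]^o v => v0 l0.
  rewrite !cabsM cabsV -/A.
  have hA' : A * (cabs v / cabs (v - z)) <=
      e / (cabs z + 1 + cabs l) * (cabs z + 1).
    rewrite mulrCA mulrC ler_pM ?mulr_ge0 ?invr_ge0 ?(@rnorm_ge0 _ R[i]^o) //.
    by rewrite ler_pdivrMr.
  apply: (@le_trans _ _ (e / (cabs z + 1 + cabs l) * (cabs z + 1) +
    cabs l * (e / (cabs z + 1 + cabs l)))).
    by rewrite lerD // ler_wpM2l // ltW.
  by rewrite [cabs l * _]mulrC -mulrDr divfK // gt_eqF.
have zp : 0 < cabs z by rewrite lt_neqAle rnorm_ge0 andbT eq_sym rnorm_eq0.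
have h00 : h 0 = 0 by rewrite /h eq_sym (negPf z0) mul0r mulr0.
(* Below [cabs z] the function [h] is differentiable on the whole disc and its mean value is
   [h 0 = 0]. *)
have lo s : 0 < s -> s < cabs z -> circle_int h s = 0.
  move=> s0 sz; rewrite mean_value // ?h00 ?mulr0 //.
  move=> w ws; apply: hd; last by rewrite (le_trans ws) // ltW // (lt_trans sz).
  by apply: cabs_neq; rewrite lt_eqF // (le_lt_trans ws).
have hi s : cabs z < s -> s <= rho -> circle_int h s = circle_int h rho.
  move=> zs sr; apply: circle_int_const => //; first exact: lt_trans zs.
  move=> w /andP[sw wr]; apply: hd => //.
  by apply: cabs_neq; rewrite gt_eqF // (lt_le_trans zs).
have : ccont (circle_int h) (cabs z).
  apply: (@circle_int_continuous R h (cabs z / 2) rho).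
  - by rewrite divr_gt0.
  - by rewrite zr ltr_pdivrMr // ltr_pMr // ltr1n.
  - by move=> w /andP[_]; exact: hcont.
move=> /rcvgP cA; apply/eqP; apply: (@rnorm_le0 _ R[i]^o) => e e0.
have e2 : 0 < e / 2 by rewrite divr_gt0.
have /(@nbhs_ballP R R)[d /= d0 hdd] := cA _ e2.
(* A step so small that [cabs z - m] and [cabs z + m] are admissible radii on either side of the
   jump, both within the modulus of continuity. *)
pose m := Num.min (d / 2) (Num.min ((rho - cabs z)) (cabs z / 2)).
have m0 : 0 < m by rewrite !lt_min !divr_gt0 //= subr_gt0 zr.
have md : m < d.
  by rewrite /m gt_min; apply/orP; left; rewrite ltr_pdivrMr // ltr_pMr // ltr1n.
have mr : cabs z + m <= rho by rewrite -lerBrDl /m !ge_min lexx !orbT.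
have mz : m < cabs z.
  rewrite /m !gt_min; apply/orP; right; apply/orP; right.
  by rewrite ltr_pdivrMr // ltr_pMr // ltr1n.
have B1 : cabs (circle_int h (cabs z + m) - circle_int h (cabs z)) <= e / 2.
  by apply: hdd; rewrite /ball /= opprD addNKr normrN gtr0_norm.
have B2 : cabs (circle_int h (cabs z - m) - circle_int h (cabs z)) <= e / 2.
  by apply: hdd; rewrite /ball /= opprB addrC subrK gtr0_norm.
rewrite hi ?ltrDl // in B1.
rewrite lo ?subr_gt0 ?gtrBl // sub0r rnormN in B2.
rewrite -(subrK (circle_int h (cabs z)) (circle_int h rho)) [e]splitr.
by apply: le_trans (rnormD _ _) _; rewrite lerD.
Qed.

(** Here [f] is replaced by [g] on the circle only. Taking [g = f (1 - (z/w)^N)] yields polynomial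
    approximation, and [g = 0] a crude bound for [f z]. *)
Lemma le_cauchy f g z rho M : cdiff_disc f rho -> cabs z < rho ->
  (forall w, cabs w = rho -> exists l, cdiff g w l) ->
  {in `[0, 2 * pi], forall t, cabs (f (rho%:C * cis t) - g (rho%:C * cis t)) <= M} ->
  cabs ((2 * pi)%:C * f z - circle_int (fun w => g w * (w / (w - z))) rho) <=
  2 * (M * (rho / (rho - cabs z)) * (2 * pi)).
Proof.
move=> hf zr hg hM; have r0 : 0 < rho := le_lt_trans (rnorm_ge0 _) zr.
have hk w : cabs w = rho -> exists l, cdiff (fun w => w / (w - z)) w l.
  move=> wr; have [|l hl] := @cdiff_kernel z w; first by apply: cabs_neq; rewrite wr gt_eqF.
  by eexists; apply: (cdiffM (cdiff_id w) hl).
have fk w : cabs w = rho -> exists l, cdiff (fun w => f w * (w / (w - z))) w l.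
  move=> wr; have [l hl] := hk w wr; have [|m hm] := hf w; first by rewrite wr.
  by eexists; exact: cdiffM hm hl.
have gk w : cabs w = rho -> exists l, cdiff (fun w => g w * (w / (w - z))) w l.
  move=> wr; have [l hl] := hk w wr; have [m hm] := hg w wr.
  by eexists; exact: cdiffM hm hl.
rewrite -(cauchy_formula hf zr) -circle_intB //.
apply: le_circle_int => // [w wr|t ht].
  have [a ha] := fk w wr; have [b hb] := gk w wr.
  by exists (a - b); exact: cdiffB.
rewrite -mulrBl cabsM ler_pM ?rnorm_ge0 //; first exact: hM.
rewrite cabsM cabsV cabs_polar ?(ltW r0) // ler_pM2l // lef_pV2 ?posrE ?subr_gt0 //.
  by apply: le_trans (ler_rnormB _ _); rewrite cabs_polar // ltW.
rewrite lt_neqAle rnorm_ge0 andbT eq_sym rnorm_eq0 subr_eq0; apply: cabs_neq.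
by rewrite cabs_polar ?(ltW r0) // gt_eqF.
Qed.

End cauchy_formula.

(** * Taylor truncation, Cauchy estimates and the maximum modulus principle *)

Section polynomial_approximation.
Context {R : realType}.
Implicit Types (f g : R[i] -> R[i]) (r rho s e M : R) (z w : R[i]).

Lemma circle_int_sum n (F : nat -> R[i] -> R[i]) r : 0 < r ->
  (forall k w, cabs w = r -> exists l, cdiff (F k) w l) ->
  circle_int (fun w => \sum_(k < n) F k w) r = \sum_(k < n) circle_int (F k) r /\
  forall w, cabs w = r -> exists l, cdiff (fun w => \sum_(k < n) F k w) w l.
Proof.
move=> r0 hF; elim: n => [|n [ih1 ih2]].
  have E : (fun w => \sum_(k < 0) F k w) = fun=> 0.
    by apply/funext => w; rewrite big_ord0.
  rewrite E big_ord0 circle_int_cst mulr0; split=> // w _.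
  by exists 0; exact: cdiff_cst.
have E : (fun w => \sum_(k < n.+1) F k w) = fun w => \sum_(k < n) F k w + F n w.
  by apply/funext => w; rewrite big_ord_recr.
rewrite E big_ord_recr /= circle_intD ?ih1 //; last exact: hF.
split=> // w wr; have [l hl] := ih2 w wr; have [m hm] := hF n w wr.
by exists (l + m); exact: cdiffD.
Qed.

Lemma cdiffX f w l n : cdiff f w l -> exists m, cdiff (fun w => f w ^+ n) w m.
Proof.
move=> hf; elim: n => [|n [m hm]]; first by exists 0; exact: cdiff_cst.
by eexists; under [fun _ => _]funext do rewrite exprS; exact: cdiffM hf hm.
Qed.

Lemma expr_small (q e : R) : 0 <= q -> q < 1 -> 0 < e -> exists n, q ^+ n <= e.
Proof.
move=> q0 q1 e0.
have /cvgrPdist_le/(_ _ e0) : (fun n => q ^+ n) @ \oo --> (0 : R).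
  by apply: cvg_expr; rewrite ger0_norm.
case=> N _ /(_ N (leqnn N)) /=; rewrite sub0r normrN ger0_norm ?exprn_ge0 //.
by exists N.
Qed.

Lemma circle_bounded f r : 0 < r -> cdiff_disc f r ->
  exists2 M, 0 < M & forall t, 0 <= t <= 2 * pi -> cabs (f (r%:C * cis t)) <= M.
Proof.
move=> r0 hf; have [|M hM] := @bounded_polar _ f r r r0 (lexx _).
  by move=> z /andP[_ /hf[l /cdiff_continuous]].
exists (1 + `|M|); first by rewrite ltr_pwDl.
move=> t ht; apply: le_trans (hM r t _ ht) _; first by rewrite lexx.
by rewrite (le_trans (ler_norm _)) // lerDr.
Qed.

(** The Cauchy kernel [w / (w - z)] is the geometric series in [z / w]. Keeping [N] terms gives a
    polynomial in [z], and the error is of order [(s / rho)^N]. *)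
Lemma poly_approx f rho s e : 0 < rho -> cdiff_disc f rho -> s < rho -> 0 < e ->
  exists p : {poly R[i]}, forall z, cabs z <= s -> cabs (f z - p.[z]) <= e.
Proof.
move=> r0 hf sr e0.
have [s_lt0|s0] := ltP s 0.
  exists 0 => z /le_lt_trans/(_ s_lt0).
  by rewrite ltNge rnorm_ge0.
have [M M0 hM] := circle_bounded r0 hf.
pose q := s / rho.
have q0 : 0 <= q by rewrite divr_ge0 // ltW.
have q1 : q < 1 by rewrite ltr_pdivrMr // mul1r.
have rs0 : 0 < rho - s by rewrite subr_gt0.
have K0 : 0 < 2 * M * (rho / (rho - s)) by rewrite !mulr_gt0 // invr_gt0.
have [N hN] := expr_small q0 q1 (divr_gt0 e0 K0).
pose F k w := f w * w^-1 ^+ k.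
have hF k w : cabs w = rho -> exists l, cdiff (F k) w l.
  move=> wr; have w0 : w != 0 by apply: cabs_neq; rewrite wr rnorm0 gt_eqF.
  have [m hm] := cdiffV (cdiff_id w) w0.
  have [m' hm'] := cdiffX k hm; have [|l hl] := hf w; first by rewrite wr.
  by eexists; exact: cdiffM hl hm'.
exists ((2 * pi)%:C^-1 *: \sum_(k < N) (circle_int (F k) rho)%:P * 'X^k) => z zs.
have zr : cabs z < rho := le_lt_trans zs sr.
have p0 : 0 < 2 * pi :> R by exact: twopi_gt0.
have pC0 : (2 * pi)%:C != 0 :> R[i] by rewrite (inj_eq (@complexI R)) gt_eqF.
(* The factor [1 - (z/w)^N] turns the Cauchy kernel into its truncated geometric series, so the
   Cauchy integral of [g] is the polynomial chosen above. *)
pose g w := f w * (1 - (z * w^-1) ^+ N).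
have hg w : cabs w = rho -> exists l, cdiff g w l.
  move=> wr; have w0 : w != 0 by apply: cabs_neq; rewrite wr rnorm0 gt_eqF.
  have [m hm] := cdiffV (cdiff_id w) w0.
  have [m' hm'] := cdiffX N (cdiffZ z hm); have [|l hl] := hf w; first by rewrite wr.
  by eexists; exact: cdiffM hl (cdiffB (cdiff_cst 1 w) hm').
have gE : circle_int (fun w => g w * (w / (w - z))) rho =
    (2 * pi)%:C * ((2 * pi)%:C^-1 *: \sum_(k < N) (circle_int (F k) rho)%:P * 'X^k).[z].
  rewrite hornerZ mulrA divff // mul1r horner_sum.
  rewrite (eq_bigr (fun k : 'I_N => circle_int (fun w => z ^+ k * F k w) rho)); last first.
    by move=> k _; rewrite hornerM hornerC hornerXn mulrC circle_intZ //; exact: hF.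
  have hzF k w : cabs w = rho -> exists l, cdiff (fun w => z ^+ k * F k w) w l.
    by move=> wr; have [l hl] := hF k w wr; eexists; exact: cdiffZ hl.
  have [<- _] := @circle_int_sum N (fun k w => z ^+ k * F k w) rho r0 hzF.
  apply: eq_circle_int; first exact: ltW.
  move=> w wr; have w0 : w != 0 by apply: cabs_neq; rewrite wr rnorm0 gt_eqF.
  have wz : w - z != 0 by rewrite subr_eq0; apply: cabs_neq; rewrite wr gt_eqF.
  rewrite /g -[1 - _]opprB subrX1 -mulNr opprB.
  have -> : f w * ((1 - z / w) * (\sum_(i < N) (z / w) ^+ i)) * (w / (w - z)) =
      f w * \sum_(i < N) (z / w) ^+ i by field; rewrite ?w0 ?wz.
  rewrite mulr_sumr; apply: eq_bigr => k _.
  by rewrite /F exprMn; ring.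
have := @le_cauchy _ f g z rho (M * q ^+ N) hf zr hg.
rewrite gE -mulrBr cabsM cabs_real gtr0_norm // => h.
rewrite -(ler_pM2l p0); apply: le_trans (h _) _.
  move=> t; rewrite in_itv /= => ht; rewrite /g mulrBr mulr1 opprB addrCA subrr addr0.
  rewrite cabsM cabsX cabsM cabsV cabs_polar ?(ltW r0) //.
  rewrite ler_pM ?rnorm_ge0 ?exprn_ge0 ?mulr_ge0 ?invr_ge0 ?rnorm_ge0 ?(ltW r0) //.
    exact: hM.
  by rewrite lerXn2r ?nnegrE ?mulr_ge0 ?invr_ge0 ?rnorm_ge0 ?(ltW r0) // ler_pM2r ?invr_gt0.
rewrite [leLHS](_ : _ = 2 * pi * (2 * (M * q ^+ N * (rho / (rho - cabs z))))); last by ring.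
rewrite ler_pM2l //; apply: (@le_trans _ _ (2 * (M * q ^+ N * (rho / (rho - s))))).
  rewrite ler_pM2l // ler_wpM2l ?mulr_ge0 ?exprn_ge0 ?(ltW M0) //.
  by rewrite ler_pM2l // lef_pV2 ?posrE ?subr_gt0 // lerD2l lerN2.
rewrite (_ : 2 * _ = q ^+ N * (2 * M * (rho / (rho - s)))); last by ring.
by rewrite -ler_pdivlMr.
Qed.

(** A complex derivative is determined by one direction, so a small real increment suffices. *)
Lemma cdiff_le_lipschitz f z l (L : R) d : 0 < d -> 0 <= L -> cdiff f z l ->
  (forall u, cabs u < d -> cabs (f (z + u) - f z) <= L * cabs u) -> cabs l <= L.
Proof.
move=> d0 L0 hl hL; apply/ler_addgt0Pr => e e0.
have [d' d'0 hd'] := hl e e0.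
pose u : R := Num.min d d' / 2.
have m0 : 0 < Num.min d d' by rewrite lt_min d0.
have u0 : 0 < u by rewrite divr_gt0.
have : u < Num.min d d' by rewrite ltr_pdivrMr // ltr_pMr // ltr1n.
have cu : cabs u%:C = u by rewrite cabs_real gtr0_norm.
rewrite lt_min => /andP[ud ud'].
have := hL u%:C; have := hd' u%:C; rewrite cu => /(_ ud') h1 /(_ ud) h2.
rewrite -(ler_pM2r u0) -{1}cu -cabsM.
rewrite -[l * _](subKr (f (z + u%:C) - f z)) mulrDl.
by apply: le_trans (rnormB _ _) _; rewrite lerD.
Qed.

(** Instead of differentiating under the integral, Cauchy's formulas at [z] and [z + u] are
    subtracted: the kernels differ by [u w / ((w - z - u)(w - z))]. Both denominators are at least
    [d = (rho - s) / 2], and [2 M rho / d^2] is the stated bound. *)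
Lemma cauchy_estimate h rho s M z l : 0 <= M -> cdiff_disc h rho -> s < rho ->
  {in `[0, 2 * pi], forall t, cabs (h (rho%:C * cis t)) <= M} ->
  cabs z <= s -> cdiff h z l -> cabs l <= 8 * M * rho / (rho - s) ^+ 2.
Proof.
move=> M0 hh sr hM zs hl.
have s0 : 0 <= s := le_trans (rnorm_ge0 _) zs.
have r0 : 0 < rho := le_lt_trans s0 sr.
pose d := (rho - s) / 2.
have d0 : 0 < d by rewrite divr_gt0 // subr_gt0.
have p0 : 0 < 2 * pi :> R := twopi_gt0.
have -> : 8 * M * rho / (rho - s) ^+ 2 = 2 * (M * (rho / d / d)).
  by rewrite /d; field; rewrite subr_eq0 gt_eqF.
apply: (@cdiff_le_lipschitz h z l _ d) => //.
  by rewrite !mulr_ge0 ?invr_ge0 ?(ltW d0) ?(ltW r0).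
move=> u ud.
have dist v : cabs v <= s + d -> forall w, cabs w = rho -> d <= cabs (w - v).
  move=> vs w wr; apply: le_trans (ler_rnormB _ _); rewrite wr.
  by move: vs; rewrite /d; lra.
have zd : cabs z <= s + d by rewrite (le_trans zs) // lerDl ltW.
have zud : cabs (z + u) <= s + d by apply: le_trans (rnormD _ _) _; rewrite lerD // ltW.
have sdr : s + d < rho by rewrite /d; lra.
have neq v : cabs v <= s + d -> forall w, cabs w = rho -> w != v.
  by move=> vs w wr; apply: cabs_neq; rewrite wr gt_eqF // (le_lt_trans vs).
have hk v : cabs v <= s + d -> forall w, cabs w = rho ->
    exists l, cdiff (fun w => h w * (w / (w - v))) w l.
  move=> vs w wr; have [m hm] := cdiff_kernel (neq v vs w wr).
  have [|a ha] := hh w; first by rewrite wr.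
  by eexists; exact: cdiffM ha (cdiffM (cdiff_id w) hm).
have hk2 : forall w, cabs w = rho ->
    exists l, cdiff (fun w => h w * (w / (w - (z + u))) * (w - z)^-1) w l.
  move=> w wr; have [m hm] := cdiff_kernel (neq z zd w wr).
  by have [a ha] := hk _ zud w wr; eexists; exact: cdiffM ha hm.
rewrite -(ler_pM2l p0) -{1}[2 * pi]gtr0_norm // -cabs_real -cabsM mulrBr.
rewrite -(cauchy_formula hh (le_lt_trans zud sdr)) -(cauchy_formula hh (le_lt_trans zd sdr)).
rewrite -circle_intB //; try exact: hk.
rewrite (@eq_circle_int _ _ (fun w => u * (h w * (w / (w - (z + u))) * (w - z)^-1))) ?(ltW r0) //; last first.
  move=> w wr; have a := neq _ zd w wr; have b := neq _ zud w wr.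
  by field; rewrite !subr_eq0 a b.
rewrite circle_intZ // cabsM [leRHS](_ : _ = cabs u * (2 * (M * (rho / d / d) * (2 * pi)))); last by ring.
rewrite ler_wpM2l ?rnorm_ge0 //; apply: le_circle_int => // t ht.
have wr : cabs (rho%:C * cis t) = rho by rewrite cabs_polar // ltW.
rewrite !cabsM !cabsV -mulrA ler_pM ?rnorm_ge0 ?hM //.
  by rewrite !mulr_ge0 ?invr_ge0 ?rnorm_ge0.
rewrite -!cabsM wr ler_pM ?mulr_ge0 ?invr_ge0 ?rnorm_ge0 ?(ltW r0) //.
  rewrite ler_pM2l // lef_pV2 ?posrE ?(lt_le_trans d0) //; exact: dist.
rewrite lef_pV2 ?posrE ?(lt_le_trans d0) //; exact: dist.
Qed.

(** Approximate [f] on an intermediate disc of radius [t] and apply [cauchy_estimate] to the error;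
    the tolerance is divided by the constant of that estimate. *)
Lemma poly_approx_deriv f rho s e : 0 < rho -> cdiff_disc f rho -> s < rho -> 0 < e ->
  exists p : {poly R[i]}, forall z, cabs z <= s ->
    cabs (f z - p.[z]) <= e /\ cabs (cderive f z - p^`().[z]) <= e.
Proof.
move=> r0 hf sr e0; pose t := (Num.max s 0 + rho) / 2.
have [m0 mr] : 0 <= Num.max s 0 /\ Num.max s 0 < rho by rewrite le_max lexx orbT gt_max sr.
have ms : s <= Num.max s 0 by rewrite le_max lexx.
have t0 : 0 < t by rewrite divr_gt0 // ltr_wpDl.
have st : s < t by rewrite /t; lra.
have tr : t < rho by rewrite /t; lra.
have K0 : 0 < 8 * t / (t - s) ^+ 2.
  by apply: divr_gt0; [exact: mulr_gt0|rewrite exprn_gt0 // subr_gt0].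
have e'0 : 0 < Num.min e (e / (8 * t / (t - s) ^+ 2)) by rewrite lt_min e0 divr_gt0.
have [p hp] := poly_approx r0 hf tr e'0.
exists p => z zs; have zt : cabs z <= t by rewrite (le_trans zs) // ltW.
split; first by apply: le_trans (hp z zt) _; rewrite ge_min lexx.
have hh : cdiff_disc (fun w => f w - p.[w]) t.
  move=> w wt; have [|l hl] := hf w; first by rewrite (le_trans wt) // ltW.
  by eexists; exact: cdiffB hl (cdiff_horner p w).
have [|l hl] := hf z; first by rewrite (le_trans zt) // ltW.
have [_ fl] := cdiff_derivable hl.
apply: le_trans (@cauchy_estimate _ t s _ z _ (ltW e'0) hh st _ zs _) _.
- by move=> a _; apply: hp; rewrite cabs_polar // ltW.
- by rewrite fl; exact: cdiffB hl (cdiff_horner p z).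
rewrite (_ : 8 * _ * t / _ = Num.min e (e / (8 * t / (t - s) ^+ 2)) * (8 * t / (t - s) ^+ 2)).
  by rewrite -ler_pdivlMr // ge_min lexx orbT.
by ring.
Qed.

(** If [a > b > 0], Bernoulli's inequality makes [(a/b)^k] grow at least linearly in [k], past any
    [K]. *)
Lemma pow_bound (a b K : R) : 0 <= a -> 0 <= b ->
  (forall k, a ^+ k <= K * b ^+ k) -> a <= b.
Proof.
move=> a0 b0 h; rewrite leNgt; apply/negP => ba.
have [bE|bn0] := eqVneq b 0.
  by have := h 1%N; rewrite bE !expr1 mulr0 leNgt -bE ba.
have bp : 0 < b by rewrite lt_neqAle eq_sym bn0.
have hK k : 1 + k%:R * (a / b - 1) <= K.
  have : (a / b) ^+ k <= K by rewrite exprMn exprVn ler_pdivrMr ?exprn_gt0.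
  apply: le_trans; elim: k => [|k ih]; first by rewrite mul0r addr0 expr0.
  have x1 : 1 <= a / b by rewrite ler_pdivlMr // mul1r ltW.
  rewrite exprS; apply: le_trans (_ : (a / b) * (1 + k%:R * (a / b - 1)) <= _); last first.
    by rewrite ler_wpM2l // (le_trans _ x1).
  rewrite -natr1 -subr_ge0 (_ : _ - _ = k%:R * (a / b - 1) ^+ 2); last by ring.
  by rewrite mulr_ge0 // sqr_ge0.
have c0 : 0 < a / b - 1 by rewrite subr_gt0 ltr_pdivlMr // mul1r.
have := hK (Num.truncn (K / (a / b - 1))).+1.
have := truncnS_gt (K / (a / b - 1)); rewrite ltr_pdivrMr // => lt1 le1.
have := lt_le_trans lt1 (le_trans (_ : _ <= 1 + _) le1).
by rewrite lerDr ler01 ltxx => /(_ isT).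
Qed.

(** Cauchy's formula bounds [q z] by a constant times [M]. Applied to [q^k] the constant stays the
    same, and [pow_bound] removes it. *)
Lemma max_modulus_poly (q : {poly R[i]}) rho M z : cabs z < rho ->
  {in `[0, 2 * pi], forall t, cabs q.[rho%:C * cis t] <= M} -> cabs q.[z] <= M.
Proof.
move=> zr hM; have r0 : 0 < rho := le_lt_trans (rnorm_ge0 _) zr.
have p0 : 0 < 2 * pi :> R := twopi_gt0.
have M0 : 0 <= M by apply: le_trans (hM 0 _); rewrite ?rnorm_ge0 // in_itv /= lexx ltW.
apply: (@pow_bound _ _ (2 * (rho / (rho - cabs z)))) => // [|k]; first exact: rnorm_ge0.
have hq : cdiff_disc (fun w => (q ^+ k).[w]) rho.
  by move=> w _; eexists; exact: cdiff_horner.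
have := @le_cauchy _ _ (fun=> 0) z rho (M ^+ k) hq zr.
have -> : circle_int (fun w => 0 * (w / (w - z))) rho = 0.
  rewrite (@eq_circle_int _ _ (fun=> 0)) ?(ltW r0) // ?circle_int_cst ?mulr0 //.
  by move=> w _; rewrite mul0r.
rewrite subr0 cabsM cabs_real gtr0_norm // horner_exp cabsX => h.
rewrite -(ler_pM2l p0) [leRHS](_ : _ = 2 * (M ^+ k * (rho / (rho - cabs z)) * (2 * pi))); last by ring.
apply: h => [w _|t ht]; first by exists 0; exact: cdiff_cst.
by rewrite subr0 horner_exp cabsX lerXn2r ?nnegrE ?rnorm_ge0 // hM.
Qed.

End polynomial_approximation.

(** * Norming functionals *)

Section hahn_banach.
Context {R : realType} {V : normedModType R[i]}.
Implicit Types (x y : V) (a b : R) (G : set (V * R)).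

(* Partially defined real functionals, encoded by their graphs. *)
Definition dominated_graph G :=
  (forall x y a b r, G (x, a) -> G (y, b) -> G (r%:C *: x + y, r * a + b)) /\
  (forall x a, G (x, a) -> a <= rnorm x).

(** Domination forces single values: [b - a] is a value at 0, hence at most the norm of 0. *)
Lemma dominated_graph_fun G x a b : dominated_graph G ->
  G (x, a) -> G (x, b) -> a = b.
Proof.
move=> [lG dG]; wlog ab : a b / a <= b => [th Ga Gb|Ga Gb].
  by have [/th->//|/ltW/th->] := leP a b.
apply/eqP; rewrite eq_le ab /= -subr_ge0 -oppr_le0 opprB.
have := dG _ _ (lG _ _ _ _ (-1) Ga Gb).
by rewrite rmorphN1 scaleN1r addNr rnorm0 mulN1r addrC.
Qed.

Definition line_graph x0 : set (V * R) :=
  [set p | exists r : R, p = (r%:C *: x0, r * rnorm x0)].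

Lemma dominated_line x0 : dominated_graph (line_graph x0).
Proof.
split=> [x y a b r [s [-> ->]] [t [-> ->]]|x a [r [-> ->]]].
  exists (r * s + t); rewrite rmorphD rmorphM scalerDl scalerA mulrDl mulrA //.
by rewrite rnormZ cabs_real ler_wpM2r ?rnorm_ge0 // ler_norm.
Qed.

Lemma dominated_extend G y : dominated_graph G -> G (0, 0) ->
  (forall b, ~ G (y, b)) -> exists H, [/\ dominated_graph H, G `<=` H & exists b, H (y, b)].
Proof.
move=> dGG G0 ny; have [lG dG] := dGG.
(* Lower bounds for the value at [y], forced by domination at the points [x - y]. By [ubL] they lie
   below the upper bounds forced at the points [x + y], so their supremum [c] is an admissible
   value. *)
pose L := [set q.2 - rnorm (q.1 - y) | q in G].
have ubL x a : G (x, a) -> ubound L (rnorm (x + y) - a).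
  move=> Ga _ [[x' a'] Ga' /= <-]; rewrite lerBlDr addrAC lerBrDr.
  have := dG _ _ (lG _ _ _ _ 1 Ga' Ga); rewrite scale1r mul1r => /le_trans; apply.
  have -> : x' + x = (x' - y) + (x + y) by rewrite addrACA addNr addr0.
  by rewrite [leRHS]addrC rnormD.
have L0 : L !=set0 by exists (0 - rnorm (0 - y)), (0, 0).
pose c := sup L.
have c_ge x a : G (x, a) -> a - rnorm (x - y) <= c.
  by move=> Ga; apply: ub_le_sup; [eexists; exact: ubL G0|exists (x, a)].
have c_le x a : G (x, a) -> c <= rnorm (x + y) - a.
  by move=> Ga; apply: ge_sup => //; exact: ubL.
pose H : set (V * R) := [set p | exists x a t, G (x, a) /\ p = (x + t%:C *: y, a + t * c)].
exists H; split.
- split.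
    move=> _ _ _ _ r [x [a [t [Ga [-> ->]]]]] [x' [a' [t' [Ga' [-> ->]]]]].
    exists (r%:C *: x + x'), (r * a + a'), (r * t + t'); split; first exact: lG.
    congr (_, _); last by ring.
    by rewrite rmorphD rmorphM scalerDr scalerDl scalerA addrACA.
  move=> _ _ [x [a [t [Ga [-> ->]]]]].
  have sc s x1 a1 : G (x1, a1) -> G (s%:C *: x1, s * a1).
    by move=> G1; have := lG _ _ _ _ s G1 G0; rewrite !addr0.
  (* Dividing by the modulus of [t] reduces to the coefficients -1 and 1 of [y], which are [c_ge]
     and [c_le]. *)
  have [t0|t0|->] := ltgtP t 0; last by rewrite scale0r mul0r !addr0; exact: dG.
    have nt : 0 < - t by rewrite oppr_gt0.
    have := c_ge _ _ (sc (- t)^-1 _ _ Ga).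
    rewrite -(ler_pM2l nt) mulrBr mulVKf ?gt_eqF // => h.
    have {h} : a + t * c <= - t * rnorm ((- t)^-1%:C *: x - y) by lra.
    move=> /le_trans; apply.
    rewrite -{1}[- t]gtr0_norm // -cabs_real -rnormZ.
    by rewrite scalerBr scalerA -rmorphM mulfV ?gt_eqF // scale1r rmorphN scaleNr opprK.
  have := c_le _ _ (sc t^-1 _ _ Ga).
  rewrite -(ler_pM2l t0) mulrBr mulVKf ?gt_eqF // lerBrDl => /le_trans; apply.
  rewrite -{1}[t]gtr0_norm // -cabs_real -rnormZ.
  by rewrite scalerDr scalerA -rmorphM mulfV ?gt_eqF // scale1r.
- by move=> [x a] Ga; exists x, a, 0; rewrite scale0r mul0r !addr0.
- by exists c, 0, 0, 1; rewrite scale1r mul1r !add0r.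
Qed.

Lemma real_hahn_banach x0 : exists f : V -> R,
  [/\ forall r x y, f (r%:C *: x + y) = r * f x + f y,
      forall x, f x <= rnorm x & f x0 = rnorm x0].
Proof.
pose L := line_graph x0.
have L00 : L (0, 0) by exists 0; rewrite scale0r mul0r.
(* Joining [L] inside the predicate settles the empty chain, whose union is empty, and keeps the
   prescribed value at [x0] in every extension. *)
have [F FP tot|A [dA Amax]] := @Zorn_bigcup (V * R) [set G | dominated_graph (G `|` L)].
  have [F0|/set0P[G0 FG0]] := eqVneq F set0.
    by rewrite F0 /= bigcup_set0 set0U; exact: dominated_line.
  have inF p : (\bigcup_(X in F) X `|` L) p -> exists2 G, F G & (G `|` L) p.
    by case=> [[G FG Gp]|Lp]; [exists G => //; left|exists G0 => //; right].
  split=> [x y a b r /inF[G FG Gx] /inF[H FH Hy]|x a /inF[G FG Gx]]; last first.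
    by have [_ dG] := FP _ FG; exact: dG.
  have sub (G1 G2 : set (V * R)) p : G1 `<=` G2 -> (G1 `|` L) p -> (G2 `|` L) p.
    by move=> G12 [/G12|]; [left|right].
  have up G1 p : F G1 -> (G1 `|` L) p -> (\bigcup_(X in F) X `|` L) p.
    by move=> FG1; apply: sub => q G1q; exists G1.
  have [GH|HG] := tot _ _ FG FH.
    by have [lH _] := FP _ FH; apply: (up H) => //; apply: lH => //; exact: sub GH Gx.
  by have [lG _] := FP _ FG; apply: (up G) => //; apply: lG => //; exact: sub HG Hy.
pose G := A `|` L; have [lG dG] := dA.
have tot x : exists a, G (x, a).
  apply: contrapT => /forallNP nx.
  have [H [dH GH [b Hb]]] := dominated_extend dA (or_intror L00) nx.
  apply: (Amax H).
    split; first by move=> p Ap; apply: GH; left.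
    by move=> /(_ (x, b) Hb) Ab; apply: (nx b); left.
  rewrite /=; have -> : H `|` L = H by apply/setUidPl => p Lp; apply: GH; right.
  exact: dH.
have [f hf] := choice tot.
exists f; split=> [r x y|x|].
- apply: (dominated_graph_fun dA (hf _)).
  by apply: lG; exact: hf.
- exact: dG (hf x).
- apply: (dominated_graph_fun dA (hf _)); right.
  by exists 1; rewrite scale1r mul1r.
Qed.

(** The complexification [f x - i f(i x)] of a real norming functional. Its norm is bounded by 2
    since both parts are at most the norm of [x]. *)
Lemma norming_functional x0 : exists phi : V -> R[i]^o,
  [/\ bounded_op phi, opnorm phi <= 2 & rnorm x0 <= cabs (phi x0)].
Proof.
have [f [lf df fx0]] := real_hahn_banach x0.
have f0 : f 0 = 0.
  by have := lf (-1) 0 0; rewrite scaler0 addr0 mulN1r addNr.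
have fD x y : f (x + y) = f x + f y by have := lf 1 x y; rewrite scale1r mul1r.
have fZ r x : f (r%:C *: x) = r * f x by have := lf r x 0; rewrite f0 !addr0.
have fN x : f (- x) = - f x by have := fZ (-1) x; rewrite rmorphN1 scaleN1r mulN1r.
have af x : `|f x| <= rnorm x.
  by rewrite ler_norml df lerNl -fN -rnormN df.
pose phi (x : V) : R[i]^o := f x +i* (- f ('i *: x)).
have lphi : linear phi.
  move=> [a b] x y; rewrite /phi.
  have E1 : f ((a +i* b) *: x + y) = a * f x + b * f ('i *: x) + f y.
    rewrite fD; congr (_ + _); rewrite -!fZ -fD; congr f.
    rewrite scalerA -scalerDl; congr (_ *: _).
    by apply/eqP; rewrite eq_complex /=; apply/andP; split; apply/eqP; ring.
  have E2 : f ('i *: ((a +i* b) *: x + y)) = a * f ('i *: x) - b * f x + f ('i *: y).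
    rewrite scalerDr fD; congr (_ + _); rewrite -mulNr -!fZ -fD; congr f.
    rewrite !scalerA -scalerDl; congr (_ *: _).
    by apply/eqP; rewrite eq_complex /=; apply/andP; split; apply/eqP; ring.
  rewrite E1 E2 /GRing.scale /=.
  by apply/eqP; rewrite eq_complex /=; apply/andP; split; apply/eqP; ring.
have bphi x : cabs (phi x) <= 2 * rnorm x.
  apply: le_trans (cabs_le_ReIm _) _; rewrite /= normrN mulr_natl mulr2n lerD //.
  apply: le_trans (af _) _; rewrite rnormZ.
  have -> : cabs ('i : R[i]) = 1.
    by rewrite /rnorm normc_def /= expr0n add0r expr1n sqrtr1.
  by rewrite mul1r.
exists phi; split; first exact: bound_bounded_op lphi bphi.
  by apply: opnorm_le.
by rewrite -fx0; apply: le_trans (ler_Re_cabs _); exact: ler_norm.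
Qed.

Lemma le_rnorm_dual x (K : R) : 0 <= K ->
  (forall phi : V -> R[i]^o, bounded_op phi -> cabs (phi x) <= K * opnorm phi) ->
  rnorm x <= 2 * K.
Proof.
move=> K0 h; have [phi [bphi nphi xphi]] := norming_functional x.
apply: le_trans xphi (le_trans (h _ bphi) _).
by rewrite mulrC ler_wpM2r.
Qed.

End hahn_banach.

(** * Moments of the resolvent *)

Section resolvent_moments.
Context {R : realType} {X : normedModType R[i]}.
Variable T : X -> X.
Hypothesis bT : bounded_op T.
Hypothesis sT : spectrum T `<=` [set l | `|l| <= 1].
Implicit Types (l m h : R[i]) (x y : X) (phi : X -> R[i]^o) (n : nat).

Lemma resolventP l : 1 < cabs l -> op_inverse (op_pencil T l) (resolvent l T).
Proof.
move=> l1; apply: (@xgetPex _ _ [set S | op_inverse (op_pencil T l) S]).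
apply: contrapT => nS; have /= := sT nS.
by rewrite -[1]/(1%:C) lec_cabs leNgt l1.
Qed.

Lemma resolvent_bounded l : 1 < cabs l -> bounded_op (resolvent l T).
Proof. by case/resolventP. Qed.

Lemma resolvent_linear l : 1 < cabs l -> linear (resolvent l T).
Proof. by case/resolvent_bounded. Qed.

Lemma resolventK l x : 1 < cabs l ->
  l *: resolvent l T x = x + T (resolvent l T x).
Proof. by case/resolventP => _ _ /(_ x) /eqP; rewrite subr_eq => /eqP. Qed.

Lemma resolventC l x : 1 < cabs l ->
  T (resolvent l T x) = resolvent l T (T x).
Proof.
move=> l1; have := resolventK x l1; have [_ /(_ x) + _] := resolventP l1.
rewrite /op_pencil (linB _ _ (resolvent_linear l1)) (linZ _ _ (resolvent_linear l1)).
move=> /eqP; rewrite subr_eq => /eqP -> /eqP.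
by rewrite (inj_eq (addrI x)) => /eqP.
Qed.

Lemma resolvent_identity l m x : 1 < cabs l -> 1 < cabs m ->
  resolvent m T x - resolvent l T x =
  (l - m) *: resolvent m T (resolvent l T x).
Proof.
move=> l1 m1; set y := resolvent l T x; have lm := resolvent_linear m1.
have -> : x = op_pencil T m y + (l - m) *: y.
  by rewrite /op_pencil scalerBl (resolventK _ l1) addrC subrKA addrK.
rewrite (linD _ _ lm) (linZ _ _ lm); have [_ -> _] := resolventP m1.
by rewrite addrC addKr.
Qed.

(** By the resolvent identity [R(l+h) y] differs from [R(l) y] by a term of norm at most
    [cabs h * K] times that of [R(l+h) y] itself. The first entry of the minimum keeps [l + h]
    outside the closed disc; the second makes this term at most half of the left side, which absorbs
    it. *)
Lemma resolvent_near l : 1 < cabs l -> exists K d : R, [/\ 0 < K, 0 < d &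
  forall h, cabs h < d -> 1 < cabs (l + h) /\
    forall y, rnorm (resolvent (l + h) T y) <= K * rnorm y].
Proof.
move=> l1; have [K K0 hK] := bounded_op_bound (resolvent_bounded l1).
have K1 : 0 < 2 * (1 + K) by rewrite mulr_gt0 // ltr_pwDl.
exists (2 * (1 + K)), (Num.min (cabs l - 1) (2 * (1 + K))^-1); split => //.
  by rewrite lt_min subr_gt0 l1 invr_gt0.
move=> h; rewrite lt_min => /andP[h1 h2].
have lh1 : 1 < cabs (l + h).
  rewrite -[h]opprK; apply: lt_le_trans (ler_rnormB _ _); rewrite rnormN; lra.
split=> // y; set z := resolvent (l + h) T y.
have := resolvent_identity y lh1 l1; rewrite -/z addrAC subrr add0r => E.
have : rnorm z <= K * rnorm y + cabs h * (K * rnorm z).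
  rewrite -{1}(subKr (resolvent l T y) z).
  apply: le_trans (rnormB _ _) _; rewrite lerD ?hK // E rnormZ.
  by rewrite ler_wpM2l ?rnorm_ge0 ?hK.
have : cabs h * (K * rnorm z) <= rnorm z / 2.
  rewrite mulrA [leRHS]mulrC ler_wpM2r ?rnorm_ge0 //.
  apply: (@le_trans _ _ ((2 * (1 + K))^-1 * (1 + K))).
    by rewrite ler_pM ?rnorm_ge0 ?(ltW h2) // lerDr.
  by rewrite invfM -mulrA mulVf ?mulr1 ?mul1r // gt_eqF // ltr_pwDl.
by have := rnorm_ge0 y; lra.
Qed.

Lemma cdiff_quadratic f z l (C d : R) : 0 <= C -> 0 < d ->
  (forall h, cabs h < d -> cabs (f (z + h) - f z - l * h) <= C * cabs h ^+ 2) ->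
  cdiff f z l.
Proof.
move=> C0 d0 hC e e0; exists (Num.min d (e / (1 + C))).
  by rewrite lt_min d0 divr_gt0 // ltr_pwDl.
move=> h; rewrite lt_min => /andP[/hC hd he]; apply: le_trans hd _.
rewrite expr2 mulrA ler_wpM2r ?rnorm_ge0 //.
move: he; rewrite ltr_pdivlMr ?ltr_pwDl // => he; apply: le_trans (ltW he).
by rewrite mulrC ler_wpM2l ?rnorm_ge0 // lerDr.
Qed.

Lemma resolvent_lipschitz l (K : R) h y : 1 < cabs l -> 1 < cabs (l + h) ->
  0 <= K -> (forall y, rnorm (resolvent (l + h) T y) <= K * rnorm y) ->
  (forall y, rnorm (resolvent l T y) <= K * rnorm y) ->
  rnorm (resolvent (l + h) T y - resolvent l T y) <= cabs h * (K * (K * rnorm y)).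
Proof.
move=> l1 lh1 K0 hK hK0; rewrite (resolvent_identity y l1 lh1) opprD addNKr rnormZ rnormN.
by rewrite ler_wpM2l ?rnorm_ge0 // (le_trans (hK _)) // ler_wpM2l.
Qed.

Lemma cdiff_resolvent phi x l : bounded_op phi -> 1 < cabs l ->
  exists m, cdiff (fun m => phi (resolvent m T x)) l m.
Proof.
move=> bphi l1; have lphi := bphi.1.
have [P P0 hP] := bounded_op_bound bphi.
have [K [d [K0 d0 hK]]] := resolvent_near l1.
have hK0 y : rnorm (resolvent l T y) <= K * rnorm y.
  by have [|_] := hK 0; rewrite ?rnorm0 // addr0; apply.
set y := resolvent l T x; exists (- phi (resolvent l T y)).
apply: (@cdiff_quadratic _ _ _ (P * (K * (K * rnorm y))) d) => // [|h hd].
  by rewrite !mulr_ge0 ?rnorm_ge0 // ltW.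
have [lh1 bh] := hK h hd.
rewrite mulNr opprK -(linB _ _ lphi) (resolvent_identity x l1 lh1) opprD addNKr.
rewrite [_ * h]mulrC -[h * _](linZ _ _ lphi) -(linD _ _ lphi).
rewrite scaleNr addrC -scalerBr (linZ _ _ lphi) [_ *: _]/(_ * _) cabsM.
rewrite -/y [leRHS](_ : _ = cabs h * (P * (cabs h * (K * (K * rnorm y))))); last by ring.
rewrite ler_wpM2l ?rnorm_ge0 //; apply: le_trans (hP _) _; rewrite rdistC ler_wpM2l //.
exact: resolvent_lipschitz (ltW K0) bh hK0.
Qed.

Lemma cdiff_resolvent2 phi x l : bounded_op phi -> 1 < cabs l ->
  exists m, cdiff (fun m => phi (resolvent m T (resolvent m T x))) l m.
Proof.
move=> bphi l1; have lphi := bphi.1.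
have [P P0 hP] := bounded_op_bound bphi.
have [K [d [K0 d0 hK]]] := resolvent_near l1.
have hK0 y : rnorm (resolvent l T y) <= K * rnorm y.
  by have [|_] := hK 0; rewrite ?rnorm0 // addr0; apply.
set y := resolvent l T x; exists (- 2 * phi (resolvent l T (resolvent l T y))).
apply: (@cdiff_quadratic _ _ _ (P * (3 * (K * (K * (K * rnorm y))))) d) => // [|h hd].
  by rewrite !mulr_ge0 ?rnorm_ge0 // ltW.
have [lh1 bh] := hK h hd.
set S := resolvent (l + h) T; set Q := resolvent l T.
have lS : linear S := resolvent_linear lh1.
have RI z : S z - Q z = - h *: S (Q z).
  by rewrite (resolvent_identity z l1 lh1) opprD addNKr.
have E : S (S x) - Q (Q x) = - h *: (S (S y) + S (Q y)).
  rewrite -(subrKA (S (Q x))) -(linB _ _ lS) !RI (linZ _ _ lS) -scalerDr.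
  by [].
(* The remainder is [h] times differences of resolvents, each again of order [h] by
   [resolvent_lipschitz]. *)
have -> : phi (S (S x)) - phi (Q (Q x)) - -2 * phi (Q (Q y)) * h =
    - h * phi ((S (S y) - S (Q y)) + 2%:R *: (S (Q y) - Q (Q y))).
  rewrite -(linB _ _ lphi) E (linZ _ _ lphi) (linD (S (S y)) _ lphi).
  rewrite (linD (_ - _) _ lphi) (linZ _ _ lphi) !(linB _ _ lphi) /GRing.scale /=; ring.
rewrite cabsM rnormN.
rewrite [leRHS](_ : _ = cabs h * (P * (cabs h * (3 * (K * (K * (K * rnorm y))))))); last by ring.
rewrite ler_wpM2l ?rnorm_ge0 //; apply: le_trans (hP _) _; rewrite ler_wpM2l //.
apply: le_trans (rnormD _ _) _.
have h1 z : rnorm (S z - Q z) <= cabs h * (K * (K * rnorm z)).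
  exact: resolvent_lipschitz (ltW K0) bh hK0.
have h2 : rnorm (S (S y) - S (Q y)) <= cabs h * (K * (K * (K * rnorm y))).
  rewrite -(linB _ _ lS); apply: le_trans (bh _) _; rewrite mulrCA.
  by rewrite ler_wpM2l ?(ltW K0) ?h1.
have h3 : rnorm (2%:R *: (S (Q y) - Q (Q y))) <= 2 * (cabs h * (K * (K * (K * rnorm y)))).
  rewrite rnormZ -(rmorph_nat (real_complex R)) cabs_real normr_nat.
  rewrite ler_pM2l // (le_trans (h1 _)) // ler_wpM2l ?rnorm_ge0 //.
  by rewrite !ler_wpM2l ?(ltW K0).
by apply: le_trans (lerD h2 h3) _; rewrite le_eqVlt; apply/predU1P; left; ring.
Qed.

Section moments.
Variable phi : X -> R[i]^o.
Hypothesis bphi : bounded_op phi.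
Let lphi : linear phi := bphi.1.
Notation Rs l x := (resolvent l T x).

(** From [l R x = x + T R x], with the last term moved to the left. Taking [1 <= K] ensures that
    such [l] lie outside the spectrum. *)
Lemma resolvent_decay : exists2 K : R, 1 <= K & forall l x, K < cabs l ->
  rnorm (Rs l x) <= rnorm x / (cabs l - K).
Proof.
have [K K0 hK] := bounded_op_bound bT; exists (1 + K); first by rewrite lerDl.
move=> l x Kl; have l1 : 1 < cabs l by apply: le_lt_trans Kl; rewrite lerDl.
rewrite ler_pdivlMr ?subr_gt0 // mulrBr lerBlDr mulrC -rnormZ (resolventK _ l1).
apply: le_trans (rnormD _ _) _; rewrite lerD2l; apply: le_trans (hK _) _.
by rewrite mulrC ler_wpM2l ?rnorm_ge0 // lerDr.
Qed.

(** The integral does not depend on the radius and decays as the radius tends to infinity. *)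
Lemma circle_int_vanish (g : R[i] -> R[i]) (A B r : R) : 1 < r -> 0 <= A ->
  (forall l, 1 < cabs l -> exists m, cdiff g l m) ->
  (forall l, B < cabs l -> cabs (g l) <= A / (cabs l - B)) ->
  circle_int g r = 0.
Proof.
move=> r1 A0 dg hg; have r0 : 0 < r := lt_trans ltr01 r1.
apply: (@cvg0_unique R R[i]^o _ (2 * (A * (2 * pi))) (Num.max r B)).
  by rewrite mulr_ge0 // mulr_ge0 // ltW // twopi_gt0.
move=> s; rewrite gt_max => /andP[rs Bs]; have s0 := lt_trans r0 rs.
rewrite (circle_int_const r0 (ltW rs)); last first.
  by move=> l /andP[rl _]; apply: dg; exact: lt_le_trans rl.
rewrite (_ : _ / _ = 2 * (A / (s - Num.max r B) * (2 * pi))); last by ring.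
apply: le_circle_int => // [l ls|t _].
  by apply: dg; rewrite ls (lt_trans r1).
have ls : cabs (s%:C * cis t) = s by rewrite cabs_polar // ltW.
apply: le_trans (hg _ _) _; first by rewrite ls.
rewrite ls ler_wpM2l // lef_pV2 ?posrE ?subr_gt0 //; last by rewrite gt_max rs.
by rewrite lerD2l lerN2 le_max lexx orbT.
Qed.

Lemma moment_resolvent0 x r : 1 < r -> circle_int (fun l => phi (Rs l x)) r = 0.
Proof.
move=> r1; have [P P0 hP] := bounded_op_bound bphi; have [K K1 hK] := resolvent_decay.
apply: (@circle_int_vanish _ (P * rnorm x) K) => //.
- by rewrite mulr_ge0 // rnorm_ge0.
- by move=> l l1; exact: cdiff_resolvent.
- move=> l Kl; apply: le_trans (hP _) _; rewrite -mulrA ler_wpM2l //; exact: hK.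
Qed.

(** One decay factor is enough; beyond [K + 1] the other one is at most 1, which explains the
    shift. *)
Lemma moment_resolvent2_0 x r : 1 < r ->
  circle_int (fun l => phi (Rs l (Rs l x))) r = 0.
Proof.
move=> r1; have [P P0 hP] := bounded_op_bound bphi; have [K K1 hK] := resolvent_decay.
apply: (@circle_int_vanish _ (P * rnorm x) (K + 1)) => //.
- by rewrite mulr_ge0 // rnorm_ge0.
- by move=> l l1; exact: cdiff_resolvent2.
- move=> l Kl; have Kl' : K < cabs l by rewrite (lt_trans _ Kl) // ltrDl.
  apply: le_trans (hP _) _; rewrite -mulrA ler_wpM2l //.
  apply: le_trans (hK _ _ Kl') _.
  have Kp : 1 <= cabs l - K by rewrite lerBrDl ltW.
  have Kp0 : 0 < cabs l - K := lt_le_trans ltr01 Kp.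
  have Kp1 : 0 < cabs l - (K + 1) by rewrite subr_gt0.
  apply: (@le_trans _ _ (rnorm x / (cabs l - K))).
    rewrite ler_wpM2r ?invr_ge0 ?(ltW Kp0) //; apply: le_trans (hK _ _ Kl') _.
    by rewrite ler_pdivrMr // ler_peMr ?rnorm_ge0.
  rewrite ler_wpM2l ?rnorm_ge0 // lef_pV2 ?posrE //; lra.
Qed.

Lemma cdiffXn n l : exists m, cdiff (fun l : R[i] => l ^+ n) l m.
Proof. by apply: (@cdiffX R id l 1); exact: cdiff_id. Qed.

Lemma cdiff_moment n x l : 1 < cabs l ->
  exists m, cdiff (fun l => l ^+ n * phi (Rs l x)) l m.
Proof.
move=> l1; have [a ha] := cdiffXn n l; have [b hb] := cdiff_resolvent x bphi l1.
by eexists; exact: cdiffM ha hb.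
Qed.

Lemma cdiff_moment2 n x l : 1 < cabs l ->
  exists m, cdiff (fun l => l ^+ n * phi (Rs l (Rs l x))) l m.
Proof.
move=> l1; have [a ha] := cdiffXn n l; have [b hb] := cdiff_resolvent2 x bphi l1.
by eexists; exact: cdiffM ha hb.
Qed.

(** Each use of [l R x = x + R T x] trades a power of [l] for an application of [T]. The terms
    [l^k phi(x)] with [k > 0] have mean value 0, so only the last constant survives. *)
Lemma moment_resolvent n x r : 1 < r ->
  circle_int (fun l => l ^+ n.+1 * phi (Rs l x)) r = (2 * pi)%:C * phi (iter n T x).
Proof.
move=> r1; have r0 : 0 < r := lt_trans ltr01 r1.
have big l : cabs l = r -> 1 < cabs l by move=> ->.
elim: n x => [|n ih] x /=.
  rewrite (@eq_circle_int _ _ (fun l => phi x + phi (Rs l (T x)))) ?(ltW r0) //; last first.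
    move=> l /big l1; rewrite expr1 -[_ * _](linZ _ _ lphi) resolventK //.
    by rewrite (linD _ _ lphi) resolventC.
  rewrite circle_intD ?circle_int_cst ?moment_resolvent0 ?addr0 // => l.
    by exists 0; exact: cdiff_cst.
  by move=> /big; exact: cdiff_resolvent.
rewrite (@eq_circle_int _ _
  (fun l => l ^+ n.+1 * phi x + l ^+ n.+1 * phi (Rs l (T x)))) ?(ltW r0) //; last first.
  move=> l /big l1; rewrite -mulrDr exprSr -mulrA; congr (_ * _).
  by rewrite -[_ * _](linZ _ _ lphi) resolventK // (linD _ _ lphi) resolventC.
have dx l : exists m, cdiff (fun l => l ^+ n.+1 * phi x) l m.
  by have [a ha] := cdiffXn n.+1 l; eexists; exact: cdiffM ha (cdiff_cst _ _).
rewrite circle_intD //; last by move=> l /big; exact: cdiff_moment.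
rewrite ih -iterSr (@mean_value _ _ r) //.
by rewrite exprS !mul0r mulr0 add0r.
Qed.

(** The same exchange gives [l^(k+1) R^2 x = l^k R x + l^k R^2 T x]. Every step contributes one copy
    of [phi(T^n x)] through [moment_resolvent]; the number of steps is the factor [n + 1]. *)
Lemma moment_resolvent2 n x r : 1 < r ->
  circle_int (fun l => l ^+ n.+2 * phi (Rs l (Rs l x))) r =
  (2 * pi)%:C * (n.+1%:R * phi (iter n T x)).
Proof.
move=> r1; have r0 : 0 < r := lt_trans ltr01 r1.
have big l : cabs l = r -> 1 < cabs l by move=> ->.
have step k y : circle_int (fun l => l ^+ k.+1 * phi (Rs l (Rs l y))) r =
    circle_int (fun l => l ^+ k * phi (Rs l y)) r +
    circle_int (fun l => l ^+ k * phi (Rs l (Rs l (T y)))) r.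
  rewrite -circle_intD //; last 2 first.
  - by move=> l /big; exact: cdiff_moment.
  - by move=> l /big; exact: cdiff_moment2.
  apply: eq_circle_int; first exact: ltW.
  move=> l /big l1; rewrite -mulrDr exprSr -mulrA; congr (_ * _).
  rewrite -[_ * _](linZ _ _ lphi) resolventK // (linD _ _ lphi).
  by rewrite !resolventC.
(* The exchange ends at exponent 1, where the moment is 0; the stated moments start at exponent
   2. *)
have m1 y : circle_int (fun l => l ^+ 1 * phi (Rs l (Rs l y))) r = 0.
  rewrite step (@eq_circle_int _ _ (fun l => phi (Rs l y))) ?(ltW r0) //; last first.
    by move=> l _; rewrite mul1r.
  rewrite (@eq_circle_int _ (fun l => l ^+ 0 * _) (fun l => phi (Rs l (Rs l (T y))))) ?(ltW r0) //; last first.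
    by move=> l _; rewrite mul1r.
  by rewrite moment_resolvent0 // moment_resolvent2_0 // addr0.
elim: n x => [|n ih] x; rewrite step moment_resolvent //.
  by rewrite m1 addr0 mul1r.
rewrite ih -iterSr -[n.+2%:R]natr1; ring.
Qed.

End moments.
End resolvent_moments.

(** * The Besov seminorm *)

Section circle_sup.
Context {R : realType}.
Implicit Types (g : R[i] -> R[i]) (u v s e : R) (z w : R[i]) (p : {poly R[i]}).

(** Locally uniform limits of polynomials on the unit disc. The derivative of a Besov function is
    used through this property, which replaces a proof that it is itself holomorphic. *)
Definition poly_limit g := forall s e, s < 1 -> 0 < e ->
  exists p, forall z, cabs z <= s -> cabs (g z - p.[z]) <= e.

Definition circle_values g u : set R := [set cabs (g (u%:C * cis t)) | t in `[0, 2 * pi[].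
Definition circle_sup g u : R := sup (circle_values g u).

Lemma poly_lipschitz p : exists L : R, [/\ 0 <= L,
  forall z, cabs z <= 1 -> cabs p.[z] <= L &
  forall z w, cabs z <= 1 -> cabs w <= 1 -> cabs (p.[z] - p.[w]) <= L * cabs (z - w)].
Proof.
elim/poly_ind: p => [|p c [L [L0 bL lL]]].
  exists 0; split=> // [z _|z w _ _]; first by rewrite horner0 rnorm0.
  by rewrite !horner0 subrr rnorm0 mul0r.
have c0 := @rnorm_ge0 _ R[i]^o c.
exists (L + L + cabs c); split=> [|z z1|z w z1 w1]; first by rewrite !addr_ge0.
  rewrite hornerMXaddC; apply: le_trans (rnormD _ _) _; rewrite cabsM lerD //.
  apply: (@le_trans _ _ (L * 1)); last by rewrite mulr1 lerDl.
  by apply: ler_pM; rewrite ?rnorm_ge0 ?bL.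
rewrite !hornerMXaddC (_ : _ - _ = (p.[z] - p.[w]) * z + p.[w] * (z - w)); last by ring.
apply: le_trans (rnormD _ _) _; rewrite !cabsM.
apply: (@le_trans _ _ (L * cabs (z - w) + L * cabs (z - w))).
  apply: lerD; last by rewrite ler_wpM2r ?rnorm_ge0 ?bL.
  rewrite -[leRHS]mulr1 ler_pM ?rnorm_ge0 ?lL //.
by rewrite -mulrDl ler_wpM2r ?rnorm_ge0 // lerDl.
Qed.

Section theory.
Variable g : R[i] -> R[i].
Hypothesis pg : poly_limit g.

Lemma poly_limit_bound s : s < 1 -> exists2 B, 0 <= B & forall z, cabs z <= s -> cabs (g z) <= B.
Proof.
move=> s1; have [p hp] := pg s1 ltr01; have [L [L0 bL _]] := poly_lipschitz p.
exists (1 + L) => [|z zs]; first by rewrite addr_ge0.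
rewrite -(subrK p.[z] (g z)); apply: le_trans (rnormD _ _) _.
by rewrite lerD ?hp // bL // (le_trans zs) // ltW.
Qed.

Lemma poly_limit_unif s e : s < 1 -> 0 < e -> exists2 d, 0 < d &
  forall z w, cabs z <= s -> cabs w <= s -> cabs (z - w) < d -> cabs (g z - g w) <= e.
Proof.
move=> s1 e0; have e3 : 0 < e / 3 by rewrite divr_gt0.
have [p hp] := pg s1 e3; have [L [L0 _ lL]] := poly_lipschitz p.
exists (e / 3 / (1 + L)) => [|z w zs ws]; first by rewrite divr_gt0 // ltr_pwDl.
rewrite ltr_pdivlMr ?ltr_pwDl // => zw.
have -> : g z - g w = (g z - p.[z]) - (g w - p.[w]) + (p.[z] - p.[w]) by ring.
have -> : e = e / 3 + e / 3 + e / 3 by field.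
apply: le_trans (rnormD _ _) _; apply: lerD.
  by apply: le_trans (rnormB _ _) _; rewrite lerD ?hp.
apply: le_trans (lL _ _ _ _) _; rewrite ?(le_trans zs) ?(le_trans ws) ?(ltW s1) //.
apply: le_trans (ltW zw); rewrite mulrC ler_wpM2l ?rnorm_ge0 //.
by rewrite lerDr.
Qed.

Lemma poly_limit_continuous z : cabs z < 1 -> {for z, continuous (g : R[i]^o -> R[i]^o)}.
Proof.
move=> z1; apply/(@rcvgP R R[i]^o R[i]^o (nbhs (z : R[i]^o)) _ g (g z)) => e e0.
pose s := (1 + cabs z) / 2.
have s1 : s < 1 by rewrite /s; lra.
have zs : cabs z < s by rewrite /s; lra.
have [d d0 hd] := poly_limit_unif s1 e0.
apply/(@nbhs_rnormP _ R[i]^o); exists (Num.min d (s - cabs z)).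
  by rewrite lt_min d0 subr_gt0.
move=> w; rewrite lt_min => /andP[wd ws]; apply: hd => //; last exact: ltW.
have := ler_rnormB (w : R[i]^o) (z : R[i]^o); lra.
Qed.

Lemma cabs_real_cis u t : cabs (u%:C * cis t) = `|u|.
Proof. by rewrite cabsM cabs_cis mulr1 cabs_real. Qed.

Lemma circle_values0 u : circle_values g u !=set0.
Proof.
exists (cabs (g (u%:C * cis 0))), 0 => //=.
by rewrite in_itv /= lexx twopi_gt0.
Qed.

Lemma circle_values_ub u : `|u| < 1 -> has_ubound (circle_values g u).
Proof.
move=> u1; have [B _ hB] := poly_limit_bound u1.
by exists B => _ [t _ <-]; apply: hB; rewrite cabs_real_cis.
Qed.

Lemma le_circle_sup u t : `|u| < 1 -> 0 <= t <= 2 * pi ->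
  cabs (g (u%:C * cis t)) <= circle_sup g u.
Proof.
move=> u1 /andP[t0 t2]; apply: ub_le_sup; first exact: circle_values_ub.
have [t2'|t2'] := ltP t (2 * pi); first by exists t => //=; rewrite in_itv /= t0.
exists 0 => /=; first by rewrite in_itv /= lexx twopi_gt0.
have -> : t = 2 * pi by apply/eqP; rewrite eq_le t2.
by rewrite cis0 /cis mulr_natl cos2pi sin2pi.
Qed.

Lemma circle_sup_le u B : (forall t, 0 <= t < 2 * pi -> cabs (g (u%:C * cis t)) <= B) ->
  circle_sup g u <= B.
Proof.
move=> h; apply: ge_sup; first exact: circle_values0.
by move=> y [t /=]; rewrite in_itv /= => /h ht <-.
Qed.

Lemma circle_sup_ge0 u : `|u| < 1 -> 0 <= circle_sup g u.
Proof.
move=> u1; apply: le_trans (le_circle_sup u1 (_ : 0 <= 0 <= 2 * pi)).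
  exact: rnorm_ge0.
by rewrite lexx ltW // twopi_gt0.
Qed.

Lemma ereal_sup_circle u : `|u| < 1 ->
  ereal_sup [set (cabs (g (u%:C * cis t)))%:E | t in `[0, 2 * pi[] = (circle_sup g u)%:E.
Proof.
move=> u1; rewrite /circle_sup -ereal_sup_EFin; last 2 first.
- exact: circle_values_ub.
- exact: circle_values0.
by rewrite /circle_values image_comp.
Qed.

(** Points of two circles on the same ray are at distance [|u - v|], so uniform continuity of [g]
    passes to the suprema. Negative radii are allowed, which makes continuity at 0 two-sided. *)
Lemma circle_sup_continuous u : `|u| < 1 -> {for u, continuous (circle_sup g)}.
Proof.
move=> u1; apply/cvgrPdist_le => e e0.
pose s := (1 + `|u|) / 2.
have s1 : s < 1 by rewrite /s; lra.
have us : `|u| < s by rewrite /s; lra.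
have [d d0 hd] := poly_limit_unif s1 e0.
apply/nbhs_ballP; exists (Num.min d (s - `|u|)); first by rewrite /= lt_min d0 subr_gt0.
move=> v; rewrite /ball /= lt_min => /andP[vd vs].
have vs' : `|v| < s.
  have := lerB_dist v u; rewrite distrC; lra.
have v1 := lt_trans vs' s1.
have close t a b : `|a| < s -> `|b| < s -> `|a - b| < d ->
    cabs (g (a%:C * cis t)) <= cabs (g (b%:C * cis t)) + e.
  move=> ha hb hab; rewrite -lerBlDl; apply: le_trans (ler_rnormB _ _) _.
  apply: hd; rewrite ?cabs_real_cis ?ltW //.
  by rewrite -mulrBl -rmorphB cabs_real_cis.
rewrite ler_distl; apply/andP; split.
  rewrite lerBlDr; apply: circle_sup_le => t /andP[t0 t2].
  rewrite distrC in vd; apply: le_trans (close t v u vs' us vd) _; rewrite lerD2r.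
  by apply: le_circle_sup => //; rewrite t0 ltW.
apply: circle_sup_le => t /andP[t0 t2].
apply: le_trans (close t u v us vs' vd) _; rewrite lerD2r.
by apply: le_circle_sup => //; rewrite t0 ltW.
Qed.

(** On a circle of radius [v > cabs z] this follows from the polynomial case by approximation; then
    [v] decreases to [u], by continuity of [circle_sup]. *)
Lemma maximum_principle z u : cabs z <= u -> u < 1 -> cabs (g z) <= circle_sup g u.
Proof.
move=> zu u1; have u0 : 0 <= u := le_trans (rnorm_ge0 _) zu.
have strict v : cabs z < v -> v < 1 -> cabs (g z) <= circle_sup g v.
  move=> zv v1; have v0 : 0 < v := le_lt_trans (rnorm_ge0 _) zv.
  apply/ler_addgt0Pr => e e0; have e2 : 0 < e / 2 by rewrite divr_gt0.
  have [p hp] := pg v1 e2.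
  rewrite -(subrK p.[z] (g z)); apply: le_trans (rnormD _ _) _.
  rewrite [in leRHS](splitr e) addrA addrC lerD ?hp ?(ltW zv) //.
  apply: (max_modulus_poly zv) => t; rewrite in_itv /= => ht.
  have h1 : cabs (g (v%:C * cis t)) <= circle_sup g v by rewrite le_circle_sup // gtr0_norm.
  have h2 : cabs (g (v%:C * cis t) - p.[v%:C * cis t]) <= e / 2.
    by apply: hp; rewrite cabs_real_cis gtr0_norm.
  have := ler_rnormB (p.[v%:C * cis t] : R[i]^o) (g (v%:C * cis t) : R[i]^o).
  rewrite rdistC; lra.
apply/ler_addgt0Pr => e e0.
have uu : `|u| < 1 by rewrite ger0_norm.
have /cvgrPdist_le/(_ _ e0)/(@nbhs_ballP R R)[d /= d0 hd] := circle_sup_continuous uu.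
pose v := u + Num.min (d / 2) ((1 - u) / 2).
have m0 : 0 < Num.min (d / 2) ((1 - u) / 2) by rewrite lt_min !divr_gt0 // subr_gt0.
have m1 : Num.min (d / 2) ((1 - u) / 2) < d.
  by rewrite gt_min ltr_pdivrMr // ltr_pMr // ltr1n.
have m2 : Num.min (d / 2) ((1 - u) / 2) <= (1 - u) / 2 by rewrite ge_min lexx orbT.
have := strict v; rewrite /v => /(_ _ _)/le_trans; apply; [by lra|by lra|].
have := hd v; rewrite /ball /= /v opprD addNKr normrN gtr0_norm // => /(_ m1).
rewrite ler_distl; lra.
Qed.

Lemma measurable_circle_sup : measurable_fun (`[0, 1[ : set R) (circle_sup g).
Proof.
have : measurable_fun (`](-1), 1[ : set R) (circle_sup g).
  apply: open_continuous_measurable_fun; first exact: interval_open.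
  move=> u; rewrite inE /= in_itv /= => hu; apply: circle_sup_continuous.
  by rewrite ltr_norml.
apply: measurable_funS => //; apply: subset_itv; rewrite bnd_simp //; lra.
Qed.

End theory.
End circle_sup.

Section real_curves.
Context {R : realType}.
Implicit Types (f g : R[i] -> R[i]) (a b s : R).

Lemma cdiff_real_is_derive g s m : cdiff g s%:C m ->
  is_derive s (1 : R) (fun s : R => complex.Re (g s%:C)) (complex.Re m) /\
  is_derive s (1 : R) (fun s : R => complex.Im (g s%:C)) (complex.Im m).
Proof.
move=> hg.
(* Real and imaginary part are treated at once, as real-linear contractions. *)
have key (P : R[i] -> R) (PB : forall x y, P (x - y) = P x - P y)
    (PZ : forall (r : R) x, P (r%:C * x) = r * P x) (Ple : forall x, `|P x| <= cabs x) :
    is_derive s (1 : R) (fun s : R => P (g s%:C)) (P m).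
  have lim : h^-1 *: (((fun s : R => P (g s%:C)) \o shift s) (h *: 1) - P (g s%:C))
      @[h --> (0 : R)^'] --> P m.
    apply/cvgrPdist_le => e e0; have [d d0 hd] := hg e e0.
    apply/nbhs_ballP; exists d => // h; rewrite /ball /= sub0r normrN => hh h0.
    have h0' : 0 < `|h| by rewrite normr_gt0.
    rewrite -(ler_pM2r h0') -normrM mulrBl [h *: 1]mulr1.
    rewrite [_ *: _]/(_ * _) mulrAC mulVf // mul1r [P m * h]mulrC -PZ -!PB.
    apply: le_trans (Ple _) _; rewrite rdistC.
    have := hd h%:C; rewrite cabs_real => /(_ hh).
    by rewrite rmorphD [h%:C + _]addrC [m * _]mulrC.
  by split; [apply/cvg_ex; exists (P m)|apply: cvg_lim lim].
split; apply: key.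
- exact: cReB.
- by move=> r x; rewrite cReM /= mul0r subr0.
- exact: ler_Re_cabs.
- exact: cImB.
- by move=> r x; rewrite cImM /= mul0r addr0.
- exact: ler_Im_cabs.
Qed.

Lemma cintegral_cdiff_line f f' (c : R[i]) a b : a <= b ->
  (forall s, a <= s <= b -> cdiff f (c * s%:C) (f' (c * s%:C))) ->
  (forall s, a <= s <= b -> ccont (fun s => f' (c * s%:C)) s) ->
  cintegral `[a, b] (fun s => c * f' (c * s%:C)) = f (c * b%:C) - f (c * a%:C).
Proof.
move=> ab hf cf'.
have cc s : a <= s <= b -> ccont (fun s => c * f' (c * s%:C)) s.
  by move=> /cf'; apply: ccontM; exact: ccont_cst.
have dd s (hs : a <= s <= b) := cdiff_real_is_derive (cdiff_scale (hf s hs)).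
apply: complexP; rewrite ?cReB ?cImB /=.
  apply: (@in_continuous_FTC2 _ (fun s => complex.Re (c * f' (c * s%:C)))
    (fun s => complex.Re (f (c * s%:C)))) => // [s|s /dd[]//].
  by rewrite in_itv /= => /cc /ccont_ReIm[].
apply: (@in_continuous_FTC2 _ (fun s => complex.Im (c * f' (c * s%:C)))
  (fun s => complex.Im (f (c * s%:C)))) => // [s|s /dd[]//].
by rewrite in_itv /= => /cc /ccont_ReIm[].
Qed.

End real_curves.

(** * Seminorm, algebra operations and the sup bound *)

Section besov.
Context {R : realType}.
Notation mu := (@lebesgue_measure R).
Implicit Types (f g : R[i] -> R[i]) (u s : R) (z : R[i]) (p : {poly R[i]}).

Lemma cabs_mulDmul_le (a b c d : R[i]) :
  cabs (a * b + c * d) <= cabs a * cabs b + cabs c * cabs d.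
Proof. by rewrite -!cabsM rnormD. Qed.

Lemma unit_discE z : unit_disc z <-> cabs z < 1.
Proof. by rewrite /unit_disc /= -[1]/(1%:C) ltc_cabs. Qed.

Lemma holomorphic_cdiff f z : holomorphic_on unit_disc f -> cabs z < 1 ->
  cdiff f z (cderive f z).
Proof. by move=> hf /unit_discE/hf; exact: derivable_cdiff. Qed.

Lemma cdiff_holomorphic f : (forall z, cabs z < 1 -> exists l, cdiff f z l) ->
  holomorphic_on unit_disc f.
Proof. by move=> hf z /unit_discE/hf[l /cdiff_derivable[]]. Qed.

Lemma cderiveE f z l : cdiff f z l -> cderive f z = l.
Proof. by case/cdiff_derivable. Qed.

Lemma cderive_horner p z : cderive (horner p) z = p^`().[z].
Proof. exact/cderiveE/cdiff_horner. Qed.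

(** On a disc of radius [rho < 1], [poly_approx_deriv] approximates [f'] uniformly by derivatives of
    polynomials. *)
Lemma poly_limit_cderive f : holomorphic_on unit_disc f -> poly_limit (cderive f).
Proof.
move=> hf s e s1 e0; pose rho := (1 + Num.max s 0) / 2.
have m1 : Num.max s 0 < 1 by rewrite gt_max s1 ltr01.
have ms : s <= Num.max s 0 by rewrite le_max lexx.
have m0 : 0 <= Num.max s 0 by rewrite le_max lexx orbT.
have r0 : 0 < rho by rewrite /rho; lra.
have sr : s < rho by rewrite /rho; lra.
have r1 : rho < 1 by rewrite /rho; lra.
have hd : cdiff_disc f rho.
  by move=> z zr; exists (cderive f z); apply: holomorphic_cdiff => //; exact: le_lt_trans r1.
have [p hp] := poly_approx_deriv r0 hd sr e0.
by exists p^`() => z /hp[].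
Qed.

Definition besov_semi f : R := fine (besov_seminorm f).

Lemma besov_seminormE f : holomorphic_on unit_disc f ->
  besov_seminorm f = (\int[mu]_(u in `[0%R, 1%R[) (circle_sup (cderive f) u)%:E)%E.
Proof.
move=> hf; apply: eq_integral => u; rewrite inE /= in_itv /= => /andP[u0 u1].
by apply: ereal_sup_circle; [exact: poly_limit_cderive|rewrite ger0_norm].
Qed.

Lemma itv01P u : u \in `[0%R, 1%R[ -> `|u| < 1.
Proof. by rewrite in_itv /= => /andP[u0 u1]; rewrite ger0_norm. Qed.

Lemma besov_fin f : besov f -> besov_seminorm f = (besov_semi f)%:E.
Proof.
move=> [hf foo]; rewrite /besov_semi fineK // ge0_fin_numE //.
rewrite besov_seminormE //; apply: integral_ge0 => u /itv01P u1.
by rewrite lee_fin circle_sup_ge0 //; exact: poly_limit_cderive.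
Qed.

Lemma besov_integrable f : besov f ->
  mu.-integrable `[0%R, 1%R[ (EFin \o circle_sup (cderive f)).
Proof.
move=> [hf foo]; have pf := poly_limit_cderive hf.
apply/integrableP; split.
  by apply/measurable_EFinP; exact: measurable_circle_sup.
have <- : (besov_seminorm f = \int[mu]_(u in `[0%R, 1%R[)
    `|(EFin \o circle_sup (cderive f)) u|)%E; last exact: foo.
rewrite besov_seminormE //; apply: eq_integral => u; rewrite inE /= => /itv01P u1.
by rewrite ger0_norm // circle_sup_ge0.
Qed.

Lemma besov_semiE f : besov f ->
  besov_semi f = \int[mu]_(u in `[0, 1[) circle_sup (cderive f) u.
Proof. by move=> [hf _]; rewrite /besov_semi besov_seminormE. Qed.

Opaque besov_semi.

(** The common criterion for sums, multiples, products and polynomials: an integrable radial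
    majorant of [f'] yields membership and the seminorm bound together. *)
Lemma besov_dominated f (k : R -> R) : holomorphic_on unit_disc f ->
  mu.-integrable `[0, 1[ (EFin \o k) ->
  (forall u t, 0 <= u < 1 -> 0 <= t < 2 * pi -> cabs (cderive f (u%:C * cis t)) <= k u) ->
  besov f /\ besov_semi f <= \int[mu]_(u in `[0, 1[) k u.
Proof.
move=> hf ik fk; have pf := poly_limit_cderive hf.
have le u : u \in `[0%R, 1%R[ -> circle_sup (cderive f) u <= k u.
  by rewrite in_itv /= => hu; apply: circle_sup_le => t ht; exact: fk.
have ge u : u \in `[0%R, 1%R[ -> 0 <= circle_sup (cderive f) u.
  by move=> /itv01P u1; exact: circle_sup_ge0.
have i : mu.-integrable `[0%R, 1%R[ (EFin \o circle_sup (cderive f)).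
  apply: (le_integrable _ _ _ ik) => //.
    by apply/measurable_EFinP; exact: measurable_circle_sup.
  move=> u /= hu; rewrite lee_fin ger0_norm ?ge //.
  by apply: le_trans (le u hu) _; exact: ler_norm.
have b : besov f.
  split=> //; rewrite besov_seminormE //.
  have /integrableP[_] := i.
  congr (_ < +oo)%E; apply: eq_integral => u; rewrite inE /= => /ge u0.
  by rewrite ger0_norm.
split=> //; rewrite besov_semiE //; apply: le_Rintegral => //.
Qed.

Lemma besov_semi_ge0 f : besov f -> 0 <= besov_semi f.
Proof.
move=> bf; rewrite besov_semiE //; apply: Rintegral_ge0 => u /itv01P u1.
by apply: circle_sup_ge0 => //; apply: poly_limit_cderive; case: bf.
Qed.

Lemma besovD f g : besov f -> besov g -> besov (fun z => f z + g z) /\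
  besov_semi (fun z => f z + g z) <= besov_semi f + besov_semi g.
Proof.
move=> bf bg; have [hf _] := bf; have [hg _] := bg.
have If := besov_integrable bf; have Ig := besov_integrable bg.
have d z : cabs z < 1 -> cdiff (fun z => f z + g z) z (cderive f z + cderive g z).
  by move=> z1; apply: cdiffD; exact: holomorphic_cdiff.
have hh : holomorphic_on unit_disc (fun z => f z + g z).
  by apply: cdiff_holomorphic => z /d; eexists; eassumption.
have I : mu.-integrable `[0, 1[
    (EFin \o (fun u => circle_sup (cderive f) u + circle_sup (cderive g) u)).
  exact: integrableD If Ig.
have [|b le] := besov_dominated hh I.
  move=> u t /andP[u0 u1] /andP[t0 t2].
  have uu : `|u| < 1 by rewrite ger0_norm.
  rewrite (cderiveE (d _ _)) ?cabs_real_cis //.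
  apply: le_trans (rnormD _ _) _.
  by apply: lerD; apply: le_circle_sup; rewrite ?t0 ?(ltW t2) //; exact: poly_limit_cderive.
split=> //; apply: le_trans le _.
rewrite (besov_semiE bf) (besov_semiE bg) RintegralD;
  [exact: lexx|exact: measurable_itv|exact: If|exact: Ig].
Qed.

Lemma besovZ c f : besov f -> besov (fun z => c * f z) /\
  besov_semi (fun z => c * f z) <= cabs c * besov_semi f.
Proof.
move=> bf; have [hf _] := bf; have If := besov_integrable bf.
have d z : cabs z < 1 -> cdiff (fun z => c * f z) z (c * cderive f z).
  by move=> z1; apply: cdiffZ; exact: holomorphic_cdiff.
have hh : holomorphic_on unit_disc (fun z => c * f z).
  by apply: cdiff_holomorphic => z /d; eexists; eassumption.
have I := integrable_scale (cabs c) (measurable_itv _) If.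
have [|b le] := besov_dominated hh I.
  move=> u t /andP[u0 u1] /andP[t0 t2].
  have uu : `|u| < 1 by rewrite ger0_norm.
  rewrite (cderiveE (d _ _)) ?cabs_real_cis // cabsM ler_wpM2l ?rnorm_ge0 //.
  by apply: le_circle_sup; rewrite ?t0 ?(ltW t2) //; exact: poly_limit_cderive.
split=> //; apply: le_trans le _.
rewrite (besov_semiE bf) RintegralZl;
  [exact: lexx|exact: measurable_itv|exact: If].
Qed.

Lemma besovM f g (F G : R) : besov f -> besov g ->
  (forall z, cabs z < 1 -> cabs (f z) <= F) ->
  (forall z, cabs z < 1 -> cabs (g z) <= G) ->
  besov (fun z => f z * g z) /\
  besov_semi (fun z => f z * g z) <= F * besov_semi g + G * besov_semi f.
Proof.
move=> bf bg fF gG; have [hf _] := bf; have [hg _] := bg.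
have If := besov_integrable bf; have Ig := besov_integrable bg.
have igF := integrable_scale F (measurable_itv _) Ig.
have ifG := integrable_scale G (measurable_itv _) If.
have d z : cabs z < 1 -> cdiff (fun z => f z * g z) z (f z * cderive g z + g z * cderive f z).
  by move=> z1; apply: cdiffM; exact: holomorphic_cdiff.
have hh : holomorphic_on unit_disc (fun z => f z * g z).
  by apply: cdiff_holomorphic => z /d; eexists; eassumption.
have I : mu.-integrable `[0, 1[
    (EFin \o (fun u => F * circle_sup (cderive g) u + G * circle_sup (cderive f) u)).
  exact: integrableD igF ifG.
have F0 : 0 <= F by apply: le_trans (fF 0 _); rewrite ?rnorm0 ?rnorm_ge0.
have G0 : 0 <= G by apply: le_trans (gG 0 _); rewrite ?rnorm0 ?rnorm_ge0.
have [|b le] := besov_dominated hh I.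
  move=> u t /andP[u0 u1] /andP[t0 t2].
  have uu : `|u| < 1 by rewrite ger0_norm.
  rewrite (cderiveE (d _ _)) ?cabs_real_cis //.
  apply: le_trans (cabs_mulDmul_le _ _ _ _) _.
  apply: lerD; apply: ler_pM; rewrite ?rnorm_ge0 ?fF ?gG ?cabs_real_cis //;
    by apply: le_circle_sup; rewrite ?t0 ?(ltW t2) //; exact: poly_limit_cderive.
split=> //; apply: le_trans le _.
have E1 : \int[mu]_(u in `[0, 1[) (F * circle_sup (cderive g) u) =
    F * \int[mu]_(u in `[0, 1[) circle_sup (cderive g) u.
  by apply: RintegralZl; [exact: measurable_itv|exact: Ig].
have E2 : \int[mu]_(u in `[0, 1[) (G * circle_sup (cderive f) u) =
    G * \int[mu]_(u in `[0, 1[) circle_sup (cderive f) u.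
  by apply: RintegralZl; [exact: measurable_itv|exact: If].
rewrite (besov_semiE bf) (besov_semiE bg) -E1 -E2 RintegralD;
  [exact: lexx|exact: measurable_itv|exact: igF|exact: ifG].
Qed.

Lemma besov_horner p : besov (horner p).
Proof.
have [L [L0 hL _]] := poly_lipschitz p^`().
apply: (@besov_dominated _ (fun=> L) _ _ _).1.
- by apply: cdiff_holomorphic => z _; eexists; exact: cdiff_horner.
- apply: integrableS (in_continuous_integrable _ : mu.-integrable `[0, 1] (EFin \o fun=> L)) => //.
    by apply: subset_itvl; rewrite bnd_simp.
  by move=> u _; exact: cvg_cst.
- move=> u t /andP[u0 u1] _; rewrite cderive_horner; apply: hL.
  by rewrite cabs_real_cis ger0_norm // ltW.
Qed.

(** Integrate [f'] along the ray from 0 to [z]; at distance [s] from 0 it is at most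
    [circle_sup (cderive f) s]. *)
Lemma besov_sup f z : besov f -> cabs z < 1 -> cabs (f z - f 0) <= 2 * besov_semi f.
Proof.
move=> bf z1; have [hf _] := bf; have pf := poly_limit_cderive hf.
have [->|z0] := eqVneq z 0; first by rewrite subrr rnorm0 mulr_ge0 // besov_semi_ge0.
have zp : 0 < cabs z by rewrite lt_neqAle rnorm_ge0 andbT eq_sym rnorm_eq0.
pose c := z / (cabs z)%:C.
have c1 : cabs c = 1 by rewrite cabsM cabsV cabs_real gtr0_norm // divff // gt_eqF.
have zC : (cabs z)%:C != 0 :> R[i] by rewrite (inj_eq (@complexI R)) gt_eqF.
have E : cintegral `[0, cabs z] (fun s => c * cderive f (c * s%:C)) = f z - f 0.
  rewrite (@cintegral_cdiff_line _ f (cderive f)) ?rnorm_ge0 //.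
  - by rewrite mulr0 divfK.
  - move=> s /andP[s0 sz]; apply: holomorphic_cdiff => //.
    by rewrite cabsM c1 mul1r cabs_real ger0_norm // (le_lt_trans sz).
  - move=> s /andP[s0 sz]; apply: ccont_comp.
      by apply: ccontM; [exact: ccont_cst|apply: ccont_real; exact: cvg_id].
    apply: poly_limit_continuous => //.
    by rewrite cabsM c1 mul1r cabs_real ger0_norm // (le_lt_trans sz).
have sub : `[0, cabs z]%classic `<=` (`[0, 1[%classic : set R).
  by apply: subset_itvl; rewrite bnd_simp.
have iz : mu.-integrable `[0, cabs z] (EFin \o circle_sup (cderive f)).
  apply: integrableS (besov_integrable bf);
    [exact: measurable_itv|exact: measurable_itv|exact: sub].
rewrite -E; apply: le_trans (le_cintegral _ _ iz _) _ => //.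
- apply: cintegrable_cont => s; rewrite in_itv /= => /andP[s0 sz].
  apply: ccontM; first exact: ccont_cst.
  apply: ccont_comp.
    by apply: ccontM; [exact: ccont_cst|apply: ccont_real; exact: cvg_id].
  apply: poly_limit_continuous => //.
  by rewrite cabsM c1 mul1r cabs_real ger0_norm // (le_lt_trans sz).
- move=> s /=; rewrite in_itv /= => /andP[s0 sz].
  (* The maximum principle applies to any point of modulus [s], so the argument of [z] need not be
     produced. *)
  rewrite cabsM c1 mul1r; apply: maximum_principle => //; last exact: le_lt_trans z1.
  by rewrite cabsM c1 mul1r cabs_real ger0_norm.
rewrite ler_pM2l // besov_semiE // /Rintegral fine_le ?integrable_fin_num //.
  exact: besov_integrable.
apply: ge0_subset_integral => //.
  by apply/measurable_EFinP; exact: measurable_circle_sup.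
by move=> u /itv01P u1; rewrite lee_fin circle_sup_ge0.
Qed.

End besov.

(** * The integral formula *)

Section inversion_substitution.
Context {R : realType}.
Notation mu := (@lebesgue_measure R).

Lemma is_derive_inv (x : R) : x != 0 -> is_derive x (1 : R) (fun y : R => y^-1) (- x ^- 2).
Proof.
move=> x0; have := @is_deriveV R id x 1 1 x0 (is_derive_id _ _).
by rewrite [_ *: 1]mulr1.
Qed.

Lemma derive1_inv (x : R) : x != 0 -> derive1 (fun y : R => y^-1) x = - x ^- 2.
Proof. by move=> /is_derive_inv[_ <-]; rewrite derive1E. Qed.

Lemma continuous_sqrV (x : R) : x != 0 -> {for x, continuous (fun y : R => y ^- 2)}.
Proof.
by move=> x0; apply: cvgV; [rewrite expf_neq0|exact: exprn_continuous].
Qed.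

Lemma derive1_inv_cvg (x : R) : 0 < x -> derive1 (fun y : R => y^-1) y @[y --> x] --> - x ^- 2.
Proof.
move=> x0; apply: cvg_trans (cvgN (continuous_sqrV (lt0r_neq0 x0))).
apply: near_eq_cvg; near=> y; rewrite derive1_inv //; apply: lt0r_neq0.
by near: y; exact: lt_nbhsr.
Unshelve. all: by end_near. Qed.

Lemma inversion_itv (M : R -> R) (a b : R) : 0 < a -> a <= b ->
  {within `[b^-1, a^-1], continuous M} ->
  (\int[mu]_(u in `[b^-1%R, a^-1%R]) (M u)%:E =
   \int[mu]_(r in `[a, b]) (M r^-1 * r ^- 2)%R%:E)%E.
Proof.
move=> a0 ab cM; have b0 := lt_le_trans a0 ab.
rewrite (@integration_by_substitution_decreasing R (fun r => r^-1) M a b) //.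
- apply: eq_integral => r; rewrite inE /= in_itv /= => /andP[ar _].
  by rewrite !fctE /= derive1_inv ?opprK // lt0r_neq0 // (lt_le_trans a0).
- move=> x y; rewrite !in_itv /= => /andP[ax _] /andP[ay _] xy.
  by rewrite ltf_pV2 // posrE (lt_le_trans a0).
- move=> x; rewrite in_itv /= => /andP[ax _]; have x0 := lt_trans a0 ax.
  by rewrite /continuous_at derive1_inv ?lt0r_neq0 //; exact: derive1_inv_cvg.
- by apply/cvg_ex; exists (- a ^- 2); apply: cvg_at_right_filter; exact: derive1_inv_cvg.
- by apply/cvg_ex; exists (- b ^- 2); apply: cvg_at_left_filter; exact: derive1_inv_cvg.
- split=> [x||].
  + rewrite in_itv /= => /andP[ax _].
    by case: (is_derive_inv (lt0r_neq0 (lt_trans a0 ax))).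
  + by apply: cvg_at_right_filter; apply: cvgV => //; exact: lt0r_neq0.
  + by apply: cvg_at_left_filter; apply: cvgV => //; exact: lt0r_neq0.
Qed.

(** The substitution [u = 1/r] is made on compact intervals exhausting []1, +oo[]; monotone
    convergence gives the limit, and each piece is bounded by the integral over [[0, 1[]. *)
Lemma inversion_integral (M : R -> R) :
  (forall u, `|u| < 1 -> {for u, continuous M}) ->
  (forall u, 0 <= u < 1 -> 0 <= M u) ->
  mu.-integrable `[0, 1[ (EFin \o M) ->
  mu.-integrable `]1, +oo[ (EFin \o (fun r => M r^-1 * r ^- 2)) /\
  \int[mu]_(r in `]1, +oo[) (M r^-1 * r ^- 2) <= \int[mu]_(u in `[0, 1[) M u.
Proof.
move=> cM M0 iM; pose k r := M r^-1 * r ^- 2.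
have inv1 (r : R) : 1 < r -> 0 <= r^-1 < 1.
  move=> r1; have r0 : 0 < r := lt_trans ltr01 r1.
  have h : r^-1 < 1 by rewrite invf_lt1.
  by rewrite h invr_ge0 ltW.
have k0 (r : R) : 1 < r -> 0 <= k r.
  by move=> r1; rewrite mulr_ge0 ?M0 ?inv1 // invr_ge0 sqr_ge0.
have ck (r : R) : 1 < r -> {for r, continuous k}.
  move=> r1; have r0 : r != 0 by rewrite lt0r_neq0 // (lt_trans ltr01).
  apply: cvgM; last exact: continuous_sqrV.
  apply: continuous_comp; first exact: cvgV.
  by have /andP[? ?] := inv1 r r1; apply: cM; rewrite ger0_norm.
have mk : measurable_fun (`]1, +oo[ : set R) k.
  apply: open_continuous_measurable_fun; first exact: interval_open.
  by move=> r; rewrite inE /= in_itv /= andbT => /ck.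
(* The shifts ensure [1 < a n <= 2 <= b n], so no interval is empty. *)
pose a n : R := 1 + n.+1%:R^-1; pose b n : R := n.+2%:R.
have a1 n : 1 < a n by rewrite ltrDl invr_gt0.
have a0 n : 0 < a n := lt_trans ltr01 (a1 n).
have ab n : a n <= b n.
  by rewrite /a /b -[n.+2%:R]natr1 addrC lerD2r; apply: le_trans (_ : 1 <= _); rewrite ?invf_le1 ?ler1n.
pose F n : set (measurableTypeR R) := `[a n, b n]%classic.
have FU : \bigcup_n F n = `]1, +oo[%classic.
  apply/seteqP; split=> r /=.
    by case=> n _; rewrite /F /= !in_itv /= andbT => /andP[/(lt_le_trans (a1 n))].
  rewrite in_itv /= andbT => r1; have r10 : 0 < r - 1 by rewrite subr_gt0.
  exists (maxn (Num.truncn (r - 1)^-1) (Num.truncn r)) => //; rewrite /F /= in_itv /=.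
  set N := maxn _ _; apply/andP; split.
    rewrite /a -lerBrDl invf_ple ?posrE // ltW //.
    apply: lt_le_trans (truncnS_gt _) _; rewrite ler_nat ltnS; exact: leq_maxl.
  rewrite /b ltW //; apply: lt_le_trans (truncnS_gt _) _; rewrite ler_nat ltnS.
  by rewrite leqW // leq_maxr.
have FS n : F n `<=` `]1, +oo[%classic by rewrite -FU; exact: bigcup_sup.
have ndF : nondecreasing_seq F.
  move=> m n mn; apply/subsetPset; apply: subset_itv; rewrite bnd_simp.
    by rewrite lerD2l lef_pV2 ?posrE // ler_nat.
  by rewrite ler_nat.
have mF n : measurable (F n) by exact: measurable_itv.
have := @ge0_nondecreasing_set_cvg_integral _ (measurableTypeR R) R F (EFin \o k) mu ndF mF.
have mkF n : measurable_fun (F n) (EFin \o k).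
  by apply/measurable_EFinP; apply: measurable_funS (FS n) mk.
have kF n x : F n x -> (0 <= (EFin \o k) x)%E.
  by move=> /FS; rewrite /= in_itv /= andbT lee_fin; exact: k0.
move=> /(_ mkF kF); rewrite FU => cvgk.
have lek : (\int[mu]_(r in `]1%R, +oo[) (k r)%:E <= \int[mu]_(u in `[0%R, 1%R[) (M u)%:E)%E.
  rewrite -(cvg_lim _ cvgk) //; apply: lime_le; first by apply/cvg_ex; eexists; exact: cvgk.
  apply: nearW => n; rewrite -[X in (X <= _)%E](@inversion_itv M (a n) (b n)) //; last first.
    apply: continuous_in_subspaceT => u; rewrite inE /= in_itv /= => /andP[bu ua].
    apply: cM; rewrite ger0_norm; last by apply: le_trans bu; rewrite invr_ge0.
    by apply: le_lt_trans ua _; rewrite invf_lt1.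
  apply: ge0_subset_integral => //=.
  - by apply: measurable_int iM.
  - apply: subset_itv; rewrite bnd_simp ?invr_ge0 // invf_lt1 //.
have iMfin : (\int[mu]_(u in `[0%R, 1%R[) (M u)%:E)%E \is a fin_num.
  by apply: integrable_fin_num iM.
have ik : mu.-integrable `]1, +oo[ (EFin \o k).
  apply/integrableP; split; first exact/measurable_EFinP.
  apply: (@le_lt_trans _ _ (\int[mu]_(u in `[0%R, 1%R[) (M u)%:E)%E).
    apply: le_trans lek; rewrite le_eqVlt; apply/predU1P; left.
    apply: eq_integral => r; rewrite inE /= in_itv /= andbT => r1.
    by rewrite ger0_norm ?k0.
  by rewrite ltey_eq iMfin.
split=> //; rewrite /Rintegral fine_le //.
exact: integrable_fin_num.
Qed.

End inversion_substitution.

(** * The kernel of the formula and its inner integral *)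

Section besov_formula.
Context {R : realType} {X : completeNormedModType R[i]}.
Notation mu := (@lebesgue_measure R).
Variable T : X -> X.
Hypothesis sT : spectrum T `<=` [set l | `|l| <= 1].
Implicit Types (f g : R[i] -> R[i]) (r t : R) (x : X) (phi : X -> R[i]^o).

Lemma besov_inversion f : besov f ->
  mu.-integrable `]1, +oo[ (EFin \o (fun r => circle_sup (cderive f) r^-1 * r ^- 2)) /\
  \int[mu]_(r in `]1, +oo[) (circle_sup (cderive f) r^-1 * r ^- 2) <= besov_semi f.
Proof.
move=> bf; have [hf _] := bf; have pf := poly_limit_cderive hf.
have If := besov_integrable bf; rewrite (besov_semiE bf).
move: (circle_sup_continuous pf) (fun u => @circle_sup_ge0 _ _ pf u) If.
move: (circle_sup (cderive f)) => M cM M0 iM.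
apply: inversion_integral => // u /andP[u0 u1].
by apply: M0; rewrite ger0_norm.
Qed.

Lemma ccont_ext (g h : R -> R[i]) t :
  (\forall s \near t, g s = h s) -> ccont g t -> ccont h t.
Proof.
move=> gh /rcvgP hg; apply/(@rcvgP R R[i]^o R (nbhs t) _ h (h t)) => e e0.
rewrite -(nbhs_singleton gh).
by apply: filterS2 gh (hg e e0) => s ->.
Qed.

(* [besov_kernel] as a function of l = r e^{it}: then e^{it} / r = l / |l|^2. *)
Definition polar_kernel f x phi (l : R[i]) : R[i] :=
  l ^+ 3 / `|l| ^+ 5 * cderive f (l / `|l| ^+ 2)
  * phi (resolvent l T (resolvent l T x)).

Lemma polar_kernelE f x phi r t : 1 < r ->
  besov_kernel T f x phi r t = polar_kernel f x phi (r%:C * cis t).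
Proof.
move=> r1; have r0 : 0 < r := lt_trans ltr01 r1.
rewrite /besov_kernel /polar_kernel.
have -> : `|r%:C * cis t| = r%:C :> R[i].
  by rewrite (norm_rnorm (r%:C * cis t : R[i]^o)) cabs_polar // ltW.
have rC : r%:C != 0 :> R[i] by rewrite (inj_eq (@complexI R)) gt_eqF.
have -> : r%:C * cis t / r%:C ^+ 2 = cis t / r%:C by field.
congr (_ * _ * _); rewrite -[3]/(3%:R) cis_nat rmorphXn /=; by field.
Qed.

(** The kernel involves the modulus of [l], so it is treated as a continuous function, which is what
    [circle_int_continuous] asks for. The point [l / |l|^2] is the reflection of [l] in the unit
    circle. *)
Lemma polar_kernel_continuous f x phi l : holomorphic_on unit_disc f -> bounded_op phi ->
  1 < cabs l -> {for l, continuous (polar_kernel f x phi : R[i]^o -> R[i]^o)}.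
Proof.
move=> hf bphi l1; have l0 : 0 < cabs l := lt_trans ltr01 l1.
have nl0 : `|l| != 0 :> R[i].
  by rewrite (norm_rnorm (l : R[i]^o)) (inj_eq (@complexI R)) gt_eqF.
have cX k (z : R[i]) : (m ^+ k : R[i]^o) @[m --> (z : R[i]^o)] --> (z ^+ k : R[i]^o).
  by have [m /cdiff_continuous] := cdiffXn k z.
have cn k : (`|m| ^- k : R[i]^o) @[m --> (l : R[i]^o)] --> (`|l| ^- k : R[i]^o).
  apply: (@cvgV _ _ (nbhs (l : R[i]^o)) _ (fun m => `|m| ^+ k)); first exact: expf_neq0.
  apply: (@continuous_comp R[i]^o R[i]^o R[i]^o (fun m => `|m|) (fun m => m ^+ k)).
    exact: (@norm_continuous _ R[i]^o).
  exact: cX.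
have [m /cdiff_continuous hR] := cdiff_resolvent2 sT x bphi l1.
have FF : Filter (nbhs (l : R[i]^o)) by exact: nbhs_filter.
have hA := @cvgM _ _ _ FF _ _ _ _ (cX 3 l) (cn 5).
have hw : (m / `|m| ^+ 2 : R[i]^o) @[m --> (l : R[i]^o)] --> (l / `|l| ^+ 2 : R[i]^o).
  have hid : (m : R[i]^o) @[m --> (l : R[i]^o)] --> (l : R[i]^o) by exact: cvg_id.
  exact (cvgM hid (cn 2)).
have hD : {for l / `|l| ^+ 2, continuous (cderive f : R[i]^o -> R[i]^o)}.
  apply: poly_limit_continuous; first exact: poly_limit_cderive.
  rewrite cabsM cabsV cabsX (norm_rnorm (l : R[i]^o)) cabs_real gtr0_norm //.
  by rewrite expr2 invfM mulrA divff ?gt_eqF // mul1r invf_lt1.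
have hB := @continuous_comp R[i]^o R[i]^o R[i]^o (fun m => m / `|m| ^+ 2) (cderive f) l hw hD.
exact (@cvgM _ _ _ FF _ _ _ _ (@cvgM _ _ _ FF _ _ _ _ hA hB) hR).
Qed.

Definition besov_inner f x phi r : R[i] := cintegral `[0, 2 * pi] (besov_kernel T f x phi r).
Definition besov_outer f x phi r : R[i] := (r ^+ 2 - 1)%:C * besov_inner f x phi r.
Definition besov_formula f x phi : R[i] :=
  (pi^-1)%:C * cintegral `]1, +oo[ (besov_outer f x phi) + f 0 * phi x.

Lemma besov_kernel_ccont f x phi r t : holomorphic_on unit_disc f -> bounded_op phi ->
  1 < r -> ccont (besov_kernel T f x phi r) t.
Proof.
move=> hf bphi r1.
have -> : besov_kernel T f x phi r = fun t => polar_kernel f x phi (r%:C * cis t).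
  by apply/funext => s; exact: polar_kernelE.
apply: ccont_comp; first by apply: ccontM; [exact: ccont_cst|exact: ccont_cis].
apply: polar_kernel_continuous => //.
by rewrite cabs_polar // ltW // (lt_trans ltr01).
Qed.

Lemma besov_kernel_cintegrable f x phi r : holomorphic_on unit_disc f -> bounded_op phi ->
  1 < r -> cintegrable `[0, 2 * pi] (besov_kernel T f x phi r).
Proof. by move=> hf bphi r1; apply: cintegrable_cont => t _; exact: besov_kernel_ccont. Qed.

Lemma besov_inner_ccont f x phi r : holomorphic_on unit_disc f -> bounded_op phi ->
  1 < r -> ccont (besov_inner f x phi) r.
Proof.
move=> hf bphi r1.
have : ccont (circle_int (polar_kernel f x phi)) r.
  apply: (@circle_int_continuous R _ ((1 + r) / 2) (r + 1)); [lra|apply/andP; split; lra|].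
  move=> z /andP[rz _]; apply: polar_kernel_continuous => //; lra.
(* [polar_kernelE] identifies the two integrals for radii above 1, so they are compared on a
   neighbourhood of [r] of such radii. *)
apply: ccont_ext; apply/nbhs_ballP; exists (r - 1); first by rewrite /= subr_gt0.
move=> s; rewrite /ball /= ltr_distl => /andP[_ s1].
apply/esym; apply: eq_cintegral => t _; apply: polar_kernelE; lra.
Qed.

Section gfs.
Variable C : R.
Hypothesis gfs : forall r x phi, 1 < r -> bounded_op phi ->
  (\int[mu]_(t in `[0%R, (2 * pi)%R])
     (cabs (phi (iter 2 (resolvent (r%:C * cis t) T) x)))%:E
   <= (C / ((r + 1) * (r - 1) ^+ 1) * rnorm x * opnorm phi)%:E)%E.

(** On the circle of radius [1/r] the derivative is at most its supremum, which leaves the integral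
    that the GFS bound controls. *)
Lemma le_besov_inner f x phi r : besov f -> bounded_op phi -> 1 < r ->
  cabs (besov_inner f x phi r) <=
  2 * (circle_sup (cderive f) r^-1 * r ^- 2 * (C / (r ^+ 2 - 1) * rnorm x * opnorm phi)).
Proof.
move=> bf bphi r1; have r0 : 0 < r := lt_trans ltr01 r1; have [hf _] := bf.
have rV1 : `|r^-1| < 1 by rewrite gtr0_norm ?invr_gt0 // invf_lt1.
have pf := poly_limit_cderive hf.
pose G t := cabs (phi (iter 2 (resolvent (r%:C * cis t) T) x)).
have cG t : {for t, continuous G}.
  have h : ccont (fun t => phi (iter 2 (resolvent (r%:C * cis t) T) x)) t.
    apply: (ccont_comp (f := fun l => phi (resolvent l T (resolvent l T x)))).
      by apply: ccontM; [exact: ccont_cst|exact: ccont_cis].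
    have [|m /cdiff_continuous] := @cdiff_resolvent2 _ _ T sT phi x (r%:C * cis t) bphi; last exact.
    by rewrite cabs_polar // ltW.
  apply: cvg_Re; apply: (@continuous_comp R R[i]^o R[i]^o _ (fun m => `|m|)); first exact: h.
  exact: (@norm_continuous _ R[i]^o).
have iG : mu.-integrable `[0, 2 * pi] (EFin \o G).
  by apply: in_continuous_integrable => t _; exact: cG.
have lG : \int[mu]_(t in `[0, 2 * pi]) G t <= C / (r ^+ 2 - 1) * rnorm x * opnorm phi.
  have := gfs x r1 bphi; rewrite expr1 (_ : (r + 1) * (r - 1) = r ^+ 2 - 1); last by ring.
  rewrite -lee_fin /Rintegral fineK //; exact: integrable_fin_num.
set M := circle_sup (cderive f) r^-1.
have M0 : 0 <= M * r ^- 2 by rewrite mulr_ge0 ?circle_sup_ge0 // invr_ge0 sqr_ge0.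
have iMG := integrable_scale (M * r ^- 2) (measurable_itv _) iG.
apply: (@le_trans _ _ (2 * \int[mu]_(t in `[0, 2 * pi]) (M * r ^- 2 * G t))).
  apply: le_cintegral => //; first exact: besov_kernel_cintegrable.
  move=> t; rewrite /= in_itv /= => ht.
  rewrite /besov_kernel 2!cabsM -/(G t) ler_wpM2r ?rnorm_ge0 //.
  rewrite cabsM cabs_cis mul1r cabsV cabs_real ger0_norm ?sqr_ge0 // mulrC.
  rewrite ler_wpM2r ?invr_ge0 ?sqr_ge0 //.
  have -> : cis t / r%:C = r^-1%:C * cis t :> R[i] by rewrite fmorphV mulrC.
  exact: le_circle_sup.
by rewrite ler_pM2l // RintegralZl // ler_wpM2l.
Qed.

End gfs.
End besov_formula.

(** * The radial integral for monomials *)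

Section monomial_weight.
Context {R : realType}.
Notation mu := (@lebesgue_measure R).

(** The radial factor of the outer integrand for [z^(n+1)]. The exponent is [2 + n + (n + 3)]: the
    explicit [1/r^2], the power [(e^{it}/r)^n] in the derivative, and the completion of
    [e^{(n+3)it}] to [l^(n+3)]. *)
Definition weight (n : nat) (r : R) : R := (r ^+ 2 - 1) * r^-1 ^+ (2 * n).+4.+1.

Lemma weight_ge0 n r : 1 <= r -> 0 <= weight n r.
Proof.
move=> r1; rewrite mulr_ge0 //; first by rewrite subr_ge0 exprn_ege1.
by rewrite exprn_ge0 // invr_ge0 (le_trans ler01).
Qed.

Lemma weight_continuous n r : 1 <= r -> {for r, continuous (weight n)}.
Proof.
move=> r1; have r0 : r != 0 by rewrite lt0r_neq0 // (lt_le_trans ltr01).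
apply: cvgM; first by apply: cvgB; [exact: exprn_continuous|exact: cvg_cst].
apply: (@continuous_comp R R R (fun r => r^-1) (fun v => v ^+ (2 * n).+4.+1)).
  exact: cvgV.
exact: exprn_continuous.
Qed.

(** With [v = 1/r] the weight is [v^(2n+3) - v^(2n+5)], whose primitive in [r] is [P(1/r)] for the
    polynomial [P] below. The integral is [-P(1) = 1/(2n+2) - 1/(2n+4)]. *)
Lemma integral_weight n :
  (\int[mu]_(r in `]1%R, +oo[) (weight n r)%:E = ((2 * (n.+1%:R * n.+2%:R))^-1)%:E)%E.
Proof.
have nS k : k.+1%:R != 0 :> R by rewrite pnatr_eq0.
pose P : {poly R} := (2 * n).+4%:R^-1 *: 'X^((2 * n).+4) - (2 * n).+2%:R^-1 *: 'X^((2 * n).+2).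
have dP r : r != 0 -> is_derive r (1 : R) (horner P \o (fun r => r^-1)) (weight n r).
  move=> r0; have h := @is_derive1_comp R (horner P) (fun r => r^-1) r _ _
    (is_derive_poly P r^-1) (is_derive_inv r0).
  suff <- : P^`().[r^-1] * - r ^- 2 = weight n r by exact: h.
  have cancel k (v : R) : k.+1%:R^-1 * (v *+ k.+1) = v.
    by rewrite -[v *+ _]mulr_natl mulKf.
  rewrite /P derivB !derivZ !derivXn hornerD hornerN !hornerZ !hornerMn !hornerXn.
  rewrite !cancel -[(2 * n).+4.-1]/((2 * n).+3) -[(2 * n).+2.-1]/((2 * n).+1).
  rewrite /weight -!exprVn.
  have rE : r = (r^-1)^-1 by rewrite invrK.
  have v0 : r^-1 != 0 by rewrite invr_neq0.
  rewrite !exprS; move: (r^-1) v0 rE => v v0 ->; move: (v ^+ (2 * n)) => w.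
  by field.
have mw : measurable_fun (`]1, +oo[ : set R) (weight n).
  apply: open_continuous_measurable_fun; first exact: interval_open.
  by move=> r; rewrite inE /= in_itv /= andbT => r1; apply: weight_continuous; exact: ltW.
rewrite integral_itv_obnd_cbnd; last exact/measurable_EFinP.
have gt0n (r : R) : 1 < r -> r != 0 by move=> r1; rewrite lt0r_neq0 // (lt_trans ltr01).
rewrite (@ge0_continuous_FTC2y R (weight n) (horner P \o (fun r => r^-1)) 1 0).
- rewrite -EFinB; congr EFin; rewrite /= invr1 /P hornerD hornerN !hornerZ !hornerXn !expr1n !mulr1.
  rewrite ![(2 * n).+4%:R]mulrS ![(2 * n).+3%:R]mulrS ![(2 * n).+2%:R]mulrS ![(2 * n).+1%:R]mulrS.
  have := nS n; have := nS n.+1; have := nS (2 * n).+3; have := nS (2 * n).+1.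
  rewrite !mulrS natrM => h1 h2 h3 h4.
  by field; rewrite ?h1 ?h2 ?h3 ?h4.
- by move=> r; exact: weight_ge0.
- apply: continuous_in_subspaceT => r; rewrite inE /= in_itv /= andbT.
  exact: weight_continuous.
- have -> : 0 = P.[0] by rewrite /P hornerD hornerN !hornerZ !hornerXn !expr0n /= !mulr0 subr0.
  apply: continuous_cvg; first exact: continuous_horner.
  by apply/gtr0_cvgV0; [exact: nbhs_pinfty_gt|exact: cvg_id].
- by move=> r /gt0n/dP[].
- apply: cvg_at_right_filter; apply: differentiable_continuous.
  by apply/derivable1_diffP; case: (dP 1 (oner_neq0 _)).
- move=> r; rewrite in_itv /= andbT => /gt0n/dP[_ <-].
  by rewrite derive1E.
Qed.

End monomial_weight.

Section besov_formula_theory.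
Context {R : realType} {X : completeNormedModType R[i]}.
Notation mu := (@lebesgue_measure R).
Variable T : X -> X.
Hypothesis sT : spectrum T `<=` [set l | `|l| <= 1].
Variable C : R.
Hypothesis C0 : 0 < C.
Hypothesis gfs : forall (r : R) (x : X) (phi : X -> R[i]^o), 1 < r -> bounded_op phi ->
  (\int[mu]_(t in `[0%R, (2 * pi)%R])
     (cabs (phi (iter 2 (resolvent (r%:C * cis t) T) x)))%:E
   <= (C / ((r + 1) * (r - 1) ^+ 1) * rnorm x * opnorm phi)%:E)%E.
Implicit Types (f g : R[i] -> R[i]) (r t : R) (x : X) (phi : X -> R[i]^o) (p : {poly R[i]}).

Lemma itv1yP r : (`]1, +oo[%classic : set R) r -> 1 < r.
Proof. by rewrite /= in_itv /= andbT. Qed.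

(** The weight [r^2 - 1] cancels the denominator in [le_besov_inner], and what remains is the
    majorant of [besov_inversion]. The 4 is two applications of [le_cintegral]. *)
Lemma besov_outer_cintegrable f x phi : besov f -> bounded_op phi ->
  cintegrable `]1, +oo[ (besov_outer T f x phi) /\
  cabs (cintegral `]1, +oo[ (besov_outer T f x phi)) <=
    4 * C * besov_semi f * rnorm x * opnorm phi.
Proof.
move=> bf bphi; have [hf _] := bf.
have [ik lk] := besov_inversion bf.
have le r : 1 < r -> cabs (besov_outer T f x phi r) <=
    2 * C * rnorm x * opnorm phi * (circle_sup (cderive f) r^-1 * r ^- 2).
  move=> r1; have r2 : 0 < r ^+ 2 - 1 by rewrite subr_gt0 exprn_egt1.
  rewrite /besov_outer cabsM cabs_real gtr0_norm //.
  apply: le_trans (ler_wpM2l (ltW r2) (le_besov_inner sT gfs x bf bphi r1)) _.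
  rewrite le_eqVlt; apply/predU1P; left.
  move: (circle_sup _ _) (r ^- 2) => M s.
  by field; rewrite lt0r_neq0.
have bnd0 r : 1 < r -> 0 <= 2 * C * rnorm x * opnorm phi * (circle_sup (cderive f) r^-1 * r ^- 2).
  by move=> /le; apply: le_trans; exact: rnorm_ge0.
have cont r : 1 < r -> ccont (besov_outer T f x phi) r.
  move=> r1; apply: ccontM; last exact: besov_inner_ccont.
  by apply: ccont_real; apply: cvgB; [exact: exprn_continuous|exact: cvg_cst].
have {}ik := integrable_scale (2 * C * rnorm x * opnorm phi) (measurable_itv _) ik.
have i : cintegrable `]1, +oo[ (besov_outer T f x phi).
  split; apply: (le_integrable _ _ _ ik); try exact: measurable_itv.
  - apply/measurable_EFinP; apply: open_continuous_measurable_fun; first exact: interval_open.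
    by move=> r; rewrite inE /= in_itv /= andbT => /cont/ccont_ReIm[].
  - move=> r /itv1yP r1; suff : `|complex.Re (besov_outer T f x phi r)| <=
        `|2 * C * rnorm x * opnorm phi * (circle_sup (cderive f) r^-1 * r ^- 2)|.
      by rewrite -lee_fin.
    by rewrite (le_trans (ler_Re_cabs _)) // (le_trans (le r r1)) // ler_norm.
  - apply/measurable_EFinP; apply: open_continuous_measurable_fun; first exact: interval_open.
    by move=> r; rewrite inE /= in_itv /= andbT => /cont/ccont_ReIm[].
  - move=> r /itv1yP r1; suff : `|complex.Im (besov_outer T f x phi r)| <=
        `|2 * C * rnorm x * opnorm phi * (circle_sup (cderive f) r^-1 * r ^- 2)|.
      by rewrite -lee_fin.
    by rewrite (le_trans (ler_Im_cabs _)) // (le_trans (le r r1)) // ler_norm.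
split=> //.
apply: le_trans (le_cintegral (measurable_itv _) i ik _) _.
  by move=> r /itv1yP /le.
have [ik' _] := besov_inversion bf.
rewrite RintegralZl; [|exact: measurable_itv|exact: ik'].
rewrite [leRHS](_ : _ = 2 * (2 * C * rnorm x * opnorm phi * besov_semi f)); last by ring.
rewrite ler_pM2l // ler_wpM2l //.
by rewrite !mulr_ge0 ?rnorm_ge0 ?opnorm_ge0 // ltW.
Qed.

Lemma le_besov_formula f x phi : besov f -> bounded_op phi ->
  cabs (besov_formula T f x phi) <=
  (pi^-1 * (4 * C) + 1) * (besov_semi f + cabs (f 0)) * rnorm x * opnorm phi.
Proof.
move=> bf bphi; have [_ hI] := besov_outer_cintegrable x bf bphi.
have s0 := besov_semi_ge0 bf; have N0 := opnorm_ge0 bphi.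
have x0 := rnorm_ge0 x; have f0 := @rnorm_ge0 _ R[i]^o (f 0).
have p0 : 0 < pi^-1 :> R by rewrite invr_gt0 pi_gt0.
apply: le_trans (rnormD _ _) _; rewrite (cabsM (pi^-1)%:C) (cabsM (f 0)).
rewrite cabs_real (gtr0_norm p0).
apply: le_trans (lerD (ler_wpM2l (ltW p0) hI) (ler_wpM2l f0 (le_opnorm x bphi))) _.
have xN : 0 <= rnorm x * opnorm phi by rewrite mulr_ge0.
rewrite -subr_ge0 (_ : _ - _ = pi^-1 * (4 * C) * cabs (f 0) * (rnorm x * opnorm phi) +
  besov_semi f * (rnorm x * opnorm phi)); last by ring.
by rewrite addr_ge0 // !mulr_ge0 // ltW.
Qed.

Lemma disc_pt r t : 1 < r -> cabs (cis t / r%:C) < 1.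
Proof.
move=> r1; have r0 : 0 < r := lt_trans ltr01 r1.
by rewrite cabsM cabs_cis mul1r cabsV cabs_real gtr0_norm // invf_lt1.
Qed.

Lemma cintegral_eqS (D : set (measurableTypeR R)) (g h : R -> R[i]) :
  (forall t, D t -> g t = h t) -> cintegral D g = cintegral D h.
Proof. by move=> gh; apply: eq_cintegral => t; rewrite inE; exact: gh. Qed.

Lemma besov_formulaD f g x phi : besov f -> besov g -> bounded_op phi ->
  besov_formula T (fun z => f z + g z) x phi =
  besov_formula T f x phi + besov_formula T g x phi.
Proof.
move=> bf bg bphi; have [hf _] := bf; have [hg _] := bg.
have K r t : 1 < r -> besov_kernel T (fun z => f z + g z) x phi r t =
    besov_kernel T f x phi r t + besov_kernel T g x phi r t.
  move=> r1; rewrite /besov_kernel.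
  have -> := cderiveE (cdiffD (holomorphic_cdiff hf (disc_pt t r1)) (holomorphic_cdiff hg (disc_pt t r1))).
  by rewrite mulrDr mulrDl.
have I r : 1 < r -> besov_outer T (fun z => f z + g z) x phi r =
    besov_outer T f x phi r + besov_outer T g x phi r.
  move=> r1; rewrite /besov_outer -mulrDr /besov_inner -cintegralD //;
    try exact: besov_kernel_cintegrable.
  by congr (_ * _); apply: cintegral_eqS => t _; exact: K.
have [If _] := besov_outer_cintegrable x bf bphi.
have [Ig _] := besov_outer_cintegrable x bg bphi.
have E : cintegral `]1, +oo[ (besov_outer T (fun z => f z + g z) x phi) =
    cintegral `]1, +oo[ (besov_outer T f x phi) + cintegral `]1, +oo[ (besov_outer T g x phi).
  apply: etrans (cintegralD (measurable_itv _) If Ig).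
  by apply: cintegral_eqS => r /itv1yP; exact: I.
have H (p a b y u v w : R[i]) : u = v + w ->
    p * u + (a + b) * y = (p * v + a * y) + (p * w + b * y) by move=> ->; ring.
exact (H _ _ _ _ _ _ _ E).
Qed.

Lemma besov_formulaZ c f x phi : besov f -> bounded_op phi ->
  besov_formula T (fun z => c * f z) x phi = c * besov_formula T f x phi.
Proof.
move=> bf bphi; have [hf _] := bf.
have K r t : 1 < r -> besov_kernel T (fun z => c * f z) x phi r t =
    c * besov_kernel T f x phi r t.
  move=> r1; rewrite /besov_kernel.
  have -> := cderiveE (cdiffZ c (holomorphic_cdiff hf (disc_pt t r1))).
  by move: (cderive f _) (phi _) => D P; ring.
have I r : 1 < r -> besov_outer T (fun z => c * f z) x phi r = c * besov_outer T f x phi r.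
  move=> r1.
  have Z : besov_inner T (fun z => c * f z) x phi r = c * besov_inner T f x phi r.
    apply: etrans (cintegralZ c (measurable_itv _) (besov_kernel_cintegrable sT x hf bphi r1)).
    by apply: cintegral_eqS => t _; exact: K.
  have H (a u v : R[i]) : u = c * v -> a * u = c * (a * v) by move=> ->; ring.
  exact (H _ _ _ Z).
have [If _] := besov_outer_cintegrable x bf bphi.
have E : cintegral `]1, +oo[ (besov_outer T (fun z => c * f z) x phi) =
    c * cintegral `]1, +oo[ (besov_outer T f x phi).
  apply: etrans (cintegralZ c (measurable_itv _) If).
  by apply: cintegral_eqS => r /itv1yP; exact: I.
have H (p a y u v : R[i]) : u = c * v ->
    p * u + (c * a) * y = c * (p * v + a * y) by move=> ->; ring.
exact (H _ _ _ _ _ E).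
Qed.

End besov_formula_theory.

Section real_cintegral.
Context {R : realType}.
Notation mu := (@lebesgue_measure R).
Implicit Types (D : set (measurableTypeR R)) (k : R -> R).

Lemma cintegral_real D k : cintegral D (fun r => (k r)%:C) = (\int[mu]_(r in D) k r)%:C.
Proof. by apply: complexP => //=; rewrite /Rintegral integral0. Qed.

Lemma cintegrable_real D k : measurable D -> mu.-integrable D (EFin \o k) ->
  cintegrable D (fun r => (k r)%:C).
Proof. by move=> mD ik; split => //=; exact: integrable0. Qed.

Lemma weight_cintegral n :
  cintegrable (`]1, +oo[%classic : set R) (fun r => (weight n r : R)%:C) /\
  cintegral `]1, +oo[ (fun r => (weight n r : R)%:C) = (2 * (n.+1%:R * n.+2%:R))^-1%:C.
Proof.
have iw : mu.-integrable `]1, +oo[ (EFin \o weight n).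
  apply/integrableP; split.
    apply/measurable_EFinP; apply: open_continuous_measurable_fun; first exact: interval_open.
    by move=> r; rewrite inE /= in_itv /= andbT => r1; apply: weight_continuous; exact: ltW.
  rewrite (_ : integral _ _ _ = ((2 * (n.+1%:R * n.+2%:R))^-1)%:E) ?ltry //.
  rewrite -integral_weight; apply: eq_integral => r; rewrite inE => /itv1yP r1.
  by rewrite /= ger0_norm // weight_ge0 // ltW.
split; first exact: cintegrable_real.
by rewrite cintegral_real /Rintegral integral_weight.
Qed.

End real_cintegral.

(** * The formula for polynomials and the resulting bound *)

Section besov_formula_poly.
Context {R : realType} {X : completeNormedModType R[i]}.
Notation mu := (@lebesgue_measure R).
Variable T : X -> X.
Hypothesis bT : bounded_op T.
Hypothesis sT : spectrum T `<=` [set l | `|l| <= 1].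
Variable C : R.
Hypothesis C0 : 0 < C.
Hypothesis gfs : forall (r : R) (x : X) (phi : X -> R[i]^o), 1 < r -> bounded_op phi ->
  (\int[mu]_(t in `[0%R, (2 * pi)%R])
     (cabs (phi (iter 2 (resolvent (r%:C * cis t) T) x)))%:E
   <= (C / ((r + 1) * (r - 1) ^+ 1) * rnorm x * opnorm phi)%:E)%E.
Implicit Types (r t : R) (x : X) (phi : X -> R[i]^o) (p : {poly R[i]}).

Lemma cderive_exp n (z : R[i]) : cderive (fun z => z ^+ n.+1) z = n.+1%:R * z ^+ n.
Proof.
have -> : (fun z : R[i] => z ^+ n.+1) = horner 'X^(n.+1).
  by apply/funext => w; rewrite hornerXn.
by rewrite cderive_horner derivXn hornerMn hornerXn mulr_natl.
Qed.

Lemma besov_formula_exp0 x phi : besov_formula T (fun z => z ^+ 0) x phi = phi x.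
Proof.
have d z : cderive (fun z : R[i] => z ^+ 0) z = 0 by apply: cderiveE; exact: cdiff_cst.
have E0 (D : set (measurableTypeR R)) : cintegral D (fun=> 0) = 0.
  by apply: complexP; rewrite /= /Rintegral integral0.
have K r : besov_kernel T (fun z => z ^+ 0) x phi r = fun=> 0.
  by apply/funext => t; rewrite /besov_kernel d mulr0 mul0r.
have O : besov_outer T (fun z => z ^+ 0) x phi = fun=> 0.
  by apply/funext => r; rewrite /besov_outer /besov_inner K E0 mulr0.
by rewrite /besov_formula O E0 mulr0 add0r expr0 mul1r.
Qed.

Lemma besov_formula_expS n x phi : bounded_op phi ->
  besov_formula T (fun z => z ^+ n.+1) x phi = phi (iter n.+1 T x).
Proof.
move=> bphi; set y := phi (iter n.+1 T x).
(* [n + 1] comes from differentiating the monomial, [2 pi (n + 2)] from the moment of exponent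
   [n + 3]. The integral of the weight cancels all but [pi], and the prefactor of the formula
   cancels that. *)
have O r : 1 < r -> besov_outer T (fun z => z ^+ n.+1) x phi r =
    (2 * pi * (n.+1%:R * n.+2%:R))%:C * y * (weight n r)%:C.
  move=> r1; have r0 : 0 < r := lt_trans ltr01 r1.
  have rC : r%:C != 0 :> R[i] by rewrite (inj_eq (@complexI R)) gt_eqF.
  pose c : R[i] := n.+1%:R * r%:C^-1 ^+ (2 * n).+4.+1.
  have K t : besov_kernel T (fun z => z ^+ n.+1) x phi r t =
      c * ((r%:C * cis t) ^+ n.+3 * phi (resolvent (r%:C * cis t) T (resolvent (r%:C * cis t) T x))).
    rewrite /besov_kernel cderive_exp /=; move: (phi _) => v.
    rewrite [RHS]mulrA; congr (_ * v); rewrite /c -[3]/(3%:R) cis_nat rmorphXn /=.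
    rewrite [(_ * cis t) ^+ _]exprMn [(cis t / _) ^+ n]exprMn.
    rewrite mul2n -addnn !exprS exprD !exprVn; move: (cis t ^+ n) (cis t) => e w.
    have rn : r%:C ^+ n != 0 :> R[i] by rewrite expf_neq0.
    by move: (r%:C) (r%:C ^+ n) rC rn => a b a0 b0; field; rewrite a0 b0.
  have I : besov_inner T (fun z => z ^+ n.+1) x phi r = c * ((2 * pi)%:C * (n.+2%:R * y)).
    rewrite -(moment_resolvent2 bT sT bphi n.+1 x r1).
    have dm (l : R[i]) : cabs l = r -> exists m, cdiff
        (fun l => l ^+ n.+3 * phi (resolvent l T (resolvent l T x))) l m.
      by move=> lr; apply: cdiff_moment2 => //; rewrite lr.
    rewrite -(circle_intZ c r0 dm).
    by apply: eq_cintegral => t _; exact: K.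
  have wE : (weight n r)%:C = (r ^+ 2 - 1)%:C * r%:C^-1 ^+ (2 * n).+4.+1.
    by rewrite /weight rmorphM; congr (_ * _); rewrite rmorphXn fmorphV.
  have cE : (2 * pi * (n.+1%:R * n.+2%:R))%:C = (2 * pi)%:C * (n.+1%:R * n.+2%:R) :> R[i].
    by rewrite rmorphM; congr (_ * _); rewrite rmorphM !(rmorph_nat (real_complex R)).
  rewrite /besov_outer I /c wE cE.
  by move: (r%:C^-1 ^+ _) ((r ^+ 2 - 1)%:C) ((2 * pi)%:C) => v u w; ring.
have [iw Iw] := @weight_cintegral R n.
have E : cintegral `]1, +oo[ (besov_outer T (fun z => z ^+ n.+1) x phi) = pi%:C * y.
  transitivity (cintegral (`]1, +oo[%classic : set R)
      (fun r => (2 * pi * (n.+1%:R * n.+2%:R))%:C * y * (weight n r)%:C)).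
    by apply: cintegral_eqS => r /itv1yP; exact: O.
  rewrite cintegralZ; [|exact: measurable_itv|exact: iw].
  rewrite Iw mulrAC -rmorphM; congr (_%:C * _).
  have : n.+1%:R * n.+2%:R != 0 :> R by rewrite mulf_neq0 // pnatr_eq0.
  by move: (n.+1%:R * n.+2%:R) => a a0; field.
rewrite /besov_formula E exprS !mul0r addr0 mulrA -rmorphM mulVf ?mul1r //.
exact: lt0r_neq0 (pi_gt0 R).
Qed.

Lemma besov_formula_poly p x phi : bounded_op phi ->
  besov_formula T (horner p) x phi = phi (poly_op T p x).
Proof.
move=> bphi; have lphi := bphi.1.
have bX k : besov (fun z : R[i] => z ^+ k).
  have -> : (fun z : R[i] => z ^+ k) = horner 'X^k by apply/funext => z; rewrite hornerXn.
  exact: besov_horner.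
have mono k : besov_formula T (fun z => z ^+ k) x phi = phi (iter k T x).
  by case: k => [|k]; [exact: besov_formula_exp0|exact: besov_formula_expS].
(* Membership is carried along the induction because linearity of the formula, which rests on
   integrability, requires it. *)
have H n : besov (fun z => \sum_(k < n) p`_k * z ^+ k) /\
    besov_formula T (fun z => \sum_(k < n) p`_k * z ^+ k) x phi =
    phi (\sum_(k < n) p`_k *: iter k T x).
  elim: n => [|n [b ih]].
    have -> : (fun z => \sum_(k < 0) p`_k * z ^+ k) = (fun z : R[i] => 0 * z ^+ 0).
      by apply/funext => z; rewrite big_ord0 mul0r.
    split; first exact: (besovZ 0 (bX 0%N)).1.
    by rewrite (besov_formulaZ sT C0 gfs) // big_ord0 mul0r (lin0 lphi).
  have -> : (fun z => \sum_(k < n.+1) p`_k * z ^+ k) =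
      (fun z => (fun z => \sum_(k < n) p`_k * z ^+ k) z + (fun z => p`_n * z ^+ n) z).
    by apply/funext => z; rewrite big_ord_recr.
  have bn := (besovZ p`_n (bX n)).1.
  split; first exact: (besovD b bn).1.
  rewrite (besov_formulaD sT C0 gfs _ b bn bphi) ih.
  rewrite (besov_formulaZ sT C0 gfs _ _ (bX n) bphi) mono.
  by rewrite big_ord_recr /= (linD _ _ lphi) (linZ _ _ lphi).
have [_ <-] := H (size p); congr (besov_formula T _ x phi).
by apply/funext => z; rewrite horner_coef.
Qed.

(** The bound for the formula, transferred to the operator by duality: [4 C / pi] comes from the
    integral, 1 from the value at 0, and the outer 2 from the norming functionals. *)
Lemma le_poly_op p x : rnorm (poly_op T p x) <=
  2 * (pi^-1 * (4 * C) + 1) * (besov_semi (horner p) + cabs p.[0]) * rnorm x.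
Proof.
have s0 := besov_semi_ge0 (besov_horner p).
have K0 : 0 <= pi^-1 * (4 * C) + 1 by rewrite addr_ge0 // mulr_ge0 ?invr_ge0 ?pi_ge0 // mulr_ge0 // ltW.
rewrite -!mulrA; apply: le_rnorm_dual.
  by rewrite mulr_ge0 // mulr_ge0 ?rnorm_ge0 // addr_ge0 ?rnorm_ge0.
move=> phi bphi; rewrite -besov_formula_poly //.
have := le_besov_formula sT C0 gfs x (besov_horner p) bphi.
by rewrite !mulrA.
Qed.

End besov_formula_poly.

(** * Density of the polynomials *)

Section polynomial_density.
Context {R : realType}.
Notation mu := (@lebesgue_measure R).
Implicit Types (f g : R[i] -> R[i]) (u s e : R) (z : R[i]) (p : {poly R[i]}).

Lemma dominated_small (D : set (measurableTypeR R)) (d : nat -> R -> R) (g : R -> R) (e : R) :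
  measurable D -> (forall n, measurable_fun D (d n)) ->
  (forall n u, D u -> 0 <= d n u <= g u) ->
  (forall u, D u -> d n u @[n --> \oo] --> 0) ->
  mu.-integrable D (EFin \o g) -> 0 < e ->
  \forall n \near \oo, \int[mu]_(u in D) d n u <= e.
Proof.
move=> mD md dg d0 ig e0.
have md' n : measurable_fun D (fun u => (d n u)%:E) by exact/measurable_EFinP.
have m0 : measurable_fun D (fun=> 0%E : \bar R) by exact: measurable_cst.
have lim : {ae mu, forall u, D u -> (fun n => (d n u)%:E) @ \oo --> 0%E}.
  by apply: aeW => u /d0 cu; apply/fine_cvgP; split; [exact: nearW|exact: cu].
have dom : {ae mu, forall u n, D u -> (`|(d n u)%:E| <= (g u)%:E)%E}.
  by apply: aeW => u n /(dg n) /andP[a b]; rewrite lee_fin ger0_norm.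
have [_ _] := @dominated_convergence _ (measurableTypeR R) R mu D mD
  (fun n u => (d n u)%:E) (fun=> 0%E) (EFin \o g) md' m0 lim ig dom.
rewrite integral0 => cv.
move/fine_cvgP : cv => [_ /cvgrPdist_le/(_ _ e0)].
by apply: filterS => n; rewrite sub0r normrN; exact/le_trans/ler_norm.
Qed.

(** The difference is written with [-1 *] so that [besovD] and [besovZ] apply to it as it stands. *)
Definition besov_dist f g : R :=
  besov_semi (fun z => f z + -1 * g z) + cabs (f 0 + -1 * g 0).

Lemma harmonic_small e : 0 < e -> \forall n \near \oo, (n.+1%:R^-1 : R) <= e.
Proof.
move=> e0; have /cvgrPdist_le/(_ _ e0) := @cvg_harmonic R.
by apply: filterS => n; rewrite sub0r normrN ger0_norm // invr_ge0.
Qed.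

(** Polynomials approximate [f] and [f'] only on smaller discs. So [q n] is taken close to [f] on
    [|z| <= s n] and dilated back, [P n (z) = q n (s n z)]; its derivative is close to that of
    [f(s n z)] on the whole disc. Dominated convergence then handles the seminorm of [f - P n]. *)
Lemma besov_density f e : besov f -> 0 < e -> exists p, besov_dist f (horner p) <= e.
Proof.
move=> bf e0; have [hf _] := bf; have pf := poly_limit_cderive hf.
pose s n : R := 1 - n.+2%:R^-1.
have s1 n : s n < 1 by rewrite gtrBl invr_gt0.
have s0 n : 0 < s n by rewrite subr_gt0 invf_lt1 // ltr1n.
have ex n : exists q : {poly R[i]}, forall z, cabs z <= s n ->
    cabs (f z - q.[z]) <= n.+1%:R^-1 /\ cabs (cderive f z - q^`().[z]) <= n.+1%:R^-1.
  have sr : s n < (1 + s n) / 2 by have := s1 n; lra.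
  have r0 : 0 < (1 + s n) / 2 by have := s0 n; lra.
  apply: poly_approx_deriv r0 _ sr _; last by rewrite invr_gt0.
  move=> z zr; exists (cderive f z); apply: holomorphic_cdiff => //.
  by apply: le_lt_trans zr _; have := s1 n; lra.
have [q qP] := choice ex.
pose P n := q n \Po ((s n)%:C *: 'X).
have PE n z : (P n).[z] = (q n).[(s n)%:C * z].
  by rewrite /P horner_comp hornerZ hornerX.
have P'E n z : (P n)^`().[z] = (s n)%:C * (q n)^`().[(s n)%:C * z].
  rewrite /P deriv_comp hornerM horner_comp derivZ derivX !hornerZ hornerX hornerC mulr1.
  exact: mulrC.
pose h n z := f z + -1 * (P n).[z].
have bh n : besov (h n) by exact: (besovD bf (besovZ _ (besov_horner _)).1).1.
have h'E n z : cabs z < 1 -> cderive (h n) z = cderive f z - (s n)%:C * (q n)^`().[(s n)%:C * z].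
  move=> z1; rewrite -P'E -mulN1r; apply: cderiveE; apply: cdiffD.
    exact: holomorphic_cdiff.
  by apply: cdiffZ; exact: cdiff_horner.
have sz n z : cabs ((s n)%:C * z) = s n * cabs z.
  by rewrite cabsM cabs_real gtr0_norm.
have approx n z u : cabs z = u -> 0 <= u -> u < 1 ->
    cabs (cderive f ((s n)%:C * z) - (q n)^`().[(s n)%:C * z]) <= n.+1%:R^-1 /\
    cabs (cderive f ((s n)%:C * z)) <= circle_sup (cderive f) u.
  move=> zu u0 u1; split.
    by apply: (qP n _ _).2; rewrite sz zu -[leRHS]mulr1 ler_wpM2l ?ltW.
  by apply: maximum_principle => //; rewrite sz zu -[leRHS]mul1r ler_wpM2r ?(ltW (s1 n)).
have near_small : \forall n \near \oo, besov_semi (h n) <= e / 2.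
  have nE n : besov_semi (h n) = \int[mu]_(u in `[0, 1[) circle_sup (cderive (h n)) u.
    exact: besov_semiE (bh n).
  have mh n : measurable_fun (`[0, 1[%classic : set R) (circle_sup (cderive (h n))).
    by apply: measurable_circle_sup; apply: poly_limit_cderive; have [] := bh n.
  have ge n u : 0 <= u < 1 -> 0 <= circle_sup (cderive (h n)) u.
    move=> /andP[u0 u1]; apply: circle_sup_ge0; last by rewrite ger0_norm.
    by apply: poly_limit_cderive; have [] := bh n.
  (* By the maximum principle [f'(s n z)] is at most the supremum on the larger circle through [z];
     [f'(z)] gives the second copy, and the approximation error is at most 1. *)
  have le n u : 0 <= u < 1 -> circle_sup (cderive (h n)) u <= 2 * circle_sup (cderive f) u + 1.
    move=> /andP[u0 u1]; apply: circle_sup_le => t /andP[t0 t2].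
    have zu : cabs (u%:C * cis t) = u by rewrite cabs_real_cis ger0_norm.
    rewrite h'E ?zu //; have [a1 a2] := approx n _ u zu u0 u1.
    have a3 : cabs (cderive f (u%:C * cis t)) <= circle_sup (cderive f) u.
      by apply: maximum_principle => //; rewrite zu.
    move: a1 a2 a3; move: (cderive f _) (cderive f _) (_.[_]) (circle_sup _ _) => A B Q M.
    move=> a1 a2 a3; apply: le_trans (rnormB _ _) _.
    have n1 : n.+1%:R^-1 <= 1 :> R by rewrite invf_le1 // ler1n.
    have hQ : cabs Q <= M + 1.
      have := rnormB (B : R[i]^o) (B - Q : R[i]^o); rewrite subKr.
      by move=> /le_trans; apply; rewrite lerD // (le_trans a1).
    have hsQ : cabs ((s n)%:C * Q) <= M + 1.
      apply: le_trans hQ; rewrite cabsM cabs_real gtr0_norm // -[leRHS]mul1r.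
      by rewrite ler_wpM2r ?rnorm_ge0 // ltW.
    by have := lerD a3 hsQ; rewrite mulr_natl mulr2n addrA.
  have lim u : 0 <= u < 1 -> circle_sup (cderive (h n)) u @[n --> \oo] --> 0.
    move=> hu; have /andP[u0 u1] := hu; apply/cvgrPdist_le => eps eps0.
    have eps3 : 0 < eps / 3 by rewrite divr_gt0.
    have [d d0 hd] := poly_limit_unif pf u1 eps3.
    have M0 : 0 <= circle_sup (cderive f) u by apply: circle_sup_ge0 => //; rewrite ger0_norm.
    have N1 := harmonic_small eps3.
    have N2 : \forall n \near \oo, (n.+1%:R^-1 : R) <= d / 2 by apply: harmonic_small; rewrite divr_gt0.
    have N3 : \forall n \near \oo, (n.+1%:R^-1 : R) <= eps / 3 / (1 + circle_sup (cderive f) u).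
      by apply: harmonic_small; rewrite divr_gt0 // ltr_pwDl.
    near=> n; rewrite sub0r normrN ger0_norm ?ge //.
    have n1 : n.+1%:R^-1 <= eps / 3 by near: n.
    have n2 : n.+1%:R^-1 <= d / 2 by near: n.
    have n3 : n.+1%:R^-1 <= eps / 3 / (1 + circle_sup (cderive f) u) by near: n.
    have sn : 1 - s n <= n.+1%:R^-1.
      by rewrite /s opprB addrCA subrr addr0 lef_pV2 ?posrE // ler_nat.
    have sn0 : 0 <= 1 - s n by rewrite subr_ge0 ltW.
    apply: circle_sup_le => t /andP[t0 t2].
    have zu : cabs (u%:C * cis t) = u by rewrite cabs_real_cis ger0_norm.
    rewrite h'E ?zu //; have [a1 a2] := approx n _ u zu u0 u1.
    have a3 : cabs (cderive f (u%:C * cis t) - cderive f ((s n)%:C * (u%:C * cis t))) <= eps / 3.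
      apply: hd; rewrite ?sz ?zu // ?lexx //.
        by rewrite -[leRHS]mul1r ler_wpM2r ?(ltW (s1 n)).
      rewrite -{1}[u%:C * cis t]mul1r -mulrBl -[1]/(1%:C) -rmorphB cabsM zu cabs_real ger0_norm //.
      apply: (@le_lt_trans _ _ (d / 2 * 1)).
        by rewrite ler_pM ?(ltW u1) // (le_trans sn).
      by rewrite mulr1 ltr_pdivrMr // ltr_pMr // ltr1n.
    move: a1 a2 a3 n3 M0.
    move: (cderive f (u%:C * cis t)) (cderive f _) (_.[_]) (circle_sup _ _) => A B Q M a1 a2 a3 n3 M0.
    (* Uniform continuity of [f'], the dilation factor, and the approximation error each account for
       a third of [eps]. *)
    have -> : A - (s n)%:C * Q = (A - B) + (1 - s n)%:C * B + (s n)%:C * (B - Q).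
      have -> : (1 - s n)%:C = 1 - (s n)%:C by exact: (rmorphB (real_complex R)).
      by move: ((s n)%:C) => c; ring.
    have -> : eps = eps / 3 + eps / 3 + eps / 3 by field.
    apply: le_trans (rnormD _ _) _; apply: lerD.
      apply: le_trans (rnormD _ _) _; apply: lerD => //.
      rewrite cabsM cabs_real ger0_norm //.
      apply: (@le_trans _ _ (eps / 3 / (1 + M) * M)).
        by rewrite ler_pM ?rnorm_ge0 // (le_trans sn).
      rewrite mulrAC ler_pdivrMr ?ltr_pwDl // ler_pM2l //.
      by rewrite lerDr.
    rewrite cabsM cabs_real gtr0_norm // -[leRHS]mul1r.
    by rewrite ler_pM ?rnorm_ge0 ?(ltW (s0 n)) ?(ltW (s1 n)) // (le_trans a1).
  have iM := besov_integrable bf.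
  have ig : mu.-integrable `[0, 1[ (EFin \o (fun u => 2 * circle_sup (cderive f) u + 1)).
    have i2 := integrable_scale 2 (measurable_itv _) iM.
    have i1 : mu.-integrable `[0, 1[ (EFin \o fun=> 1).
      apply: integrableS (in_continuous_integrable _ : mu.-integrable `[0, 1] (EFin \o fun=> 1));
        [exact: measurable_itv|exact: measurable_itv|by apply: subset_itvl; rewrite bnd_simp|].
      by move=> u _; exact: cvg_cst.
    exact: integrableD i2 i1.
  have e2 : 0 < e / 2 by rewrite divr_gt0.
  have mem u : (`[0, 1[%classic : set R) u -> 0 <= u < 1 by rewrite /= in_itv.
  have := @dominated_small `[0, 1[%classic (fun n => circle_sup (cderive (h n))) _ (e / 2)
    (measurable_itv _) mh _ _ ig e2.
  move=> H; have {}H := H _ _.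
  apply: filterS (H _ _) => [n|n u /mem hu|u /mem hu]; last exact: lim.
    by rewrite nE.
  by rewrite ge // le.
have e2 : 0 < e / 2 by rewrite divr_gt0.
have [n [n1 n2]] : exists n, besov_semi (h n) <= e / 2 /\ n.+1%:R^-1 <= e / 2.
  have [n _ /(_ n (leqnn n))] := filterI near_small (harmonic_small e2).
  by move=> [a b]; exists n.
exists (P n); rewrite /besov_dist [e]splitr lerD //.
apply: le_trans n2; rewrite mulN1r PE mulr0.
by apply: (qP n 0 _).1; rewrite rnorm0 ltW.
Unshelve. all: by end_near. Qed.

End polynomial_density.

(** * The polynomial calculus *)

Section poly_op_theory.
Context {R : realType} {X : normedModType R[i]}.
Variable T : X -> X.
Hypothesis bT : bounded_op T.
Let lT : linear T := bT.1.
Implicit Types (p q : {poly R[i]}) (x : X) (c : R[i]).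

Lemma iter_bounded k : bounded_op (iter k T).
Proof.
elim: k => [|k ih]; last exact: bounded_op_comp ih bT.
by split=> // x; exact: cvg_id.
Qed.

(** Polynomials of different sizes get a common range of summation; a sum may also have smaller size
    than its terms. *)
Lemma poly_op_widen n p x : (size p <= n)%N ->
  poly_op T p x = \sum_(k < n) p`_k *: iter k T x.
Proof.
move=> pn; rewrite /poly_op (big_ord_widen n (fun k => p`_k *: iter k T x) pn).
rewrite big_mkcond; apply: eq_bigr => k _; case: ltnP => // pk.
by rewrite nth_default // scale0r.
Qed.

Lemma poly_op_linear p : linear (poly_op T p).
Proof.
move=> a x y; rewrite /poly_op scaler_sumr -big_split; apply: eq_bigr => k _ /=.
by rewrite (iter_bounded k).1 scalerDr !scalerA [p`_k * a]mulrC.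
Qed.

Lemma poly_opD p q x : poly_op T (p + q) x = poly_op T p x + poly_op T q x.
Proof.
pose n := maxn (size p) (size q).
rewrite (@poly_op_widen n p) ?leq_maxl // (@poly_op_widen n q) ?leq_maxr //.
rewrite (@poly_op_widen n) ?size_polyD // -big_split; apply: eq_bigr => k _ /=.
by rewrite coefD scalerDl.
Qed.

Lemma poly_opZ c p x : poly_op T (c *: p) x = c *: poly_op T p x.
Proof.
rewrite (@poly_op_widen (size p)) ?size_scale_leq // /poly_op scaler_sumr.
by apply: eq_bigr => k _; rewrite coefZ scalerA.
Qed.

Lemma poly_op0 x : poly_op T 0 x = 0.
Proof. by rewrite /poly_op size_poly0 big_ord0. Qed.

Lemma poly_opMX p x : poly_op T (p * 'X) x = poly_op T p (T x).
Proof.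
rewrite (@poly_op_widen (size p).+1); last first.
  have [->|p0] := eqVneq p 0; first by rewrite mul0r size_poly0.
  by rewrite size_mulX.
rewrite big_ord_recl coefMX eqxx scale0r add0r /poly_op; apply: eq_bigr => k _ /=.
by rewrite coefMX /= -iterSr.
Qed.

Lemma poly_opC c x : poly_op T c%:P x = c *: x.
Proof. by rewrite (@poly_op_widen 1) ?size_polyC_leq1 // big_ord1 coefC eqxx. Qed.

Lemma poly_op_comm p x : poly_op T p (T x) = T (poly_op T p x).
Proof.
elim/poly_ind: p x => [|p c ih] x; first by rewrite !poly_op0 (lin0 lT).
by rewrite !poly_opD !poly_opMX ih (linD _ _ lT) !poly_opC (linZ _ _ lT).
Qed.

Lemma poly_opM p q x : poly_op T (p * q) x = poly_op T p (poly_op T q x).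
Proof.
elim/poly_ind: p x => [|p c ih] x; first by rewrite mul0r !poly_op0.
rewrite mulrDl mulrAC !poly_opD !poly_opMX ih poly_op_comm poly_opC; congr (_ + _).
by rewrite mul_polyC poly_opZ.
Qed.

End poly_op_theory.

(** * A norm equivalent to the Besov norm *)

Section besov_distance.
Context {R : realType}.
Implicit Types (f g h : R[i] -> R[i]) (c : R[i]).

(** A real-valued stand-in for [besov_norm], comparable to it up to a factor 3 by
    [besov_norm_fin]. *)
Definition besov_size f : R := besov_semi f + cabs (f 0).

Lemma besov_size_ge0 f : besov f -> 0 <= besov_size f.
Proof. by move=> bf; rewrite addr_ge0 ?rnorm_ge0 // besov_semi_ge0. Qed.

Lemma besov_sizeD f g : besov f -> besov g ->
  besov_size (fun z => f z + g z) <= besov_size f + besov_size g.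
Proof.
move=> bf bg; rewrite /besov_size addrACA; apply: lerD; first exact: (besovD bf bg).2.
exact: rnormD.
Qed.

Lemma besov_sizeZ c f : besov f -> besov_size (fun z => c * f z) <= cabs c * besov_size f.
Proof.
move=> bf; rewrite /besov_size mulrDr; apply: lerD; first exact: (besovZ c bf).2.
by rewrite cabsM.
Qed.

Lemma besov_size_sup f z : besov f -> cabs z < 1 -> cabs (f z) <= 2 * besov_size f.
Proof.
move=> bf z1; rewrite -(subrK (f 0) (f z)); apply: le_trans (rnormD _ _) _.
rewrite mulrDr; apply: lerD; first exact: besov_sup.
by rewrite mulr_natl mulr2n lerDl rnorm_ge0.
Qed.

(** The product rule with the sup bounds [2 * besov_size]; the product of the two seminorms collects
    the coefficient 4, which 5 covers. *)
Lemma besov_sizeM f g : besov f -> besov g -> besov (fun z => f z * g z) /\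
  besov_size (fun z => f z * g z) <= 5 * besov_size f * besov_size g.
Proof.
move=> bf bg; have [b le] := besovM bf bg (fun z => besov_size_sup bf) (fun z => besov_size_sup bg).
split=> //; have f0 := @rnorm_ge0 _ R[i]^o (f 0); have g0 := @rnorm_ge0 _ R[i]^o (g 0).
have sf := besov_semi_ge0 bf; have sg := besov_semi_ge0 bg.
rewrite {1}/besov_size cabsM; apply: le_trans (lerD le (lexx _)) _.
rewrite /besov_size; move: (besov_semi f) (besov_semi g) (cabs (f 0)) (cabs (g 0)) sf sg f0 g0.
move=> a b' c d a0 b0 c0 d0.
rewrite -subr_ge0 (_ : _ - _ = a * b' + a * d * 3 + c * b' * 3 + c * d * 4); last by ring.
by rewrite !addr_ge0 // !mulr_ge0.
Qed.

(** The disc is open, so vanishing on it forces zero derivatives there. This makes the calculus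
    blind to the values of the total functions outside the disc. *)
Lemma besov_size_eq0 f : besov f -> (forall z, cabs z < 1 -> f z = 0) -> besov_size f <= 0.
Proof.
move=> bf f0; rewrite /besov_size f0 ?rnorm0 // addr0; have [hf _] := bf.
have i0 : (@lebesgue_measure R).-integrable `[0, 1[ (EFin \o fun=> 0) by exact: integrable0.
have [|_] := besov_dominated hf i0; last by rewrite /Rintegral integral0.
move=> u t /andP[u0 u1] _; set z := u%:C * cis t.
have z1 : cabs z < 1 by rewrite cabs_real_cis ger0_norm.
suff -> : cderive f z = 0 by rewrite rnorm0.
apply: cderiveE; apply: cdiff_ext (cdiff_cst 0 z).
apply/nbhs_rnormP; exists (1 - cabs z); first by rewrite subr_gt0.
move=> w wz; rewrite f0 //; have := ler_rnormB (w : R[i]^o) (z : R[i]^o); lra.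
Qed.

Lemma besov_diff f g : besov f -> besov g -> besov (fun z => f z + -1 * g z).
Proof. by move=> bf bg; exact: (besovD bf (besovZ _ bg).1).1. Qed.

Lemma besov_distE f g : besov_dist f g = besov_size (fun z => f z + -1 * g z).
Proof. by []. Qed.

Lemma besov_dist_triangle f g h : besov f -> besov g -> besov h ->
  besov_dist f h <= besov_dist f g + besov_dist g h.
Proof.
move=> bf bg bh; rewrite !besov_distE.
rewrite (_ : (fun z => f z + -1 * h z) =
  fun z => (fun z => f z + -1 * g z) z + (fun z => g z + -1 * h z) z).
  by apply: besov_sizeD; exact: besov_diff.
by apply/funext => z /=; ring.
Qed.

Lemma besov_dist_sym f g : besov f -> besov g -> besov_dist f g <= besov_dist g f.
Proof.
move=> bf bg; rewrite !besov_distE.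
rewrite (_ : (fun z => f z + -1 * g z) = fun z => -1 * (fun z => g z + -1 * f z) z).
  apply: le_trans (besov_sizeZ _ (besov_diff bg bf)) _.
  by rewrite rnormN cabs1 mul1r.
by apply/funext => z /=; ring.
Qed.

Lemma besov_distD f g h k : besov f -> besov g -> besov h -> besov k ->
  besov_dist (fun z => f z + g z) (fun z => h z + k z) <= besov_dist f h + besov_dist g k.
Proof.
move=> bf bg bh bk; rewrite !besov_distE.
rewrite (_ : (fun z => f z + g z + -1 * (h z + k z)) =
  fun z => (fun z => f z + -1 * h z) z + (fun z => g z + -1 * k z) z).
  by apply: besov_sizeD; exact: besov_diff.
by apply/funext => z /=; ring.
Qed.

Lemma besov_distZ c f g : besov f -> besov g ->
  besov_dist (fun z => c * f z) (fun z => c * g z) <= cabs c * besov_dist f g.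
Proof.
move=> bf bg; rewrite !besov_distE.
rewrite (_ : (fun z => c * f z + -1 * (c * g z)) = fun z => c * (fun z => f z + -1 * g z) z).
  by apply: besov_sizeZ; exact: besov_diff.
by apply/funext => z /=; ring.
Qed.

Lemma besov_distM f g h k : besov f -> besov g -> besov h -> besov k ->
  besov_dist (fun z => f z * g z) (fun z => h z * k z) <=
  5 * besov_dist f h * besov_size g + 5 * besov_size h * besov_dist g k.
Proof.
move=> bf bg bh bk; rewrite !besov_distE.
have [b1 l1] := besov_sizeM (besov_diff bf bh) bg.
have [b2 l2] := besov_sizeM bh (besov_diff bg bk).
rewrite (_ : (fun z => f z * g z + -1 * (h z * k z)) =
  fun z => (fun z => (f z + -1 * h z) * g z) z + (fun z => h z * (g z + -1 * k z)) z).
  exact: le_trans (besov_sizeD b1 b2) (lerD l1 l2).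
by apply/funext => z /=; ring.
Qed.

Lemma besov_dist_disc f g : besov f -> besov g ->
  (forall z, cabs z < 1 -> f z = g z) -> besov_dist f g <= 0.
Proof.
move=> bf bg fg; rewrite besov_distE; apply: besov_size_eq0; first exact: besov_diff.
by move=> z /fg ->; rewrite mulN1r subrr.
Qed.

Lemma besov_dist_ge0 f g : besov f -> besov g -> 0 <= besov_dist f g.
Proof. by move=> bf bg; rewrite besov_distE; apply: besov_size_ge0; exact: besov_diff. Qed.

Lemma besov_dist0 f : besov_dist f (horner 0) = besov_size f.
Proof.
rewrite besov_distE; congr besov_size; apply/funext => z.
by rewrite horner0 mulr0 addr0.
Qed.

Lemma besov_size_le f g : besov f -> besov g -> besov_size g <= besov_size f + besov_dist f g.
Proof.
move=> bf bg; have b0 := @besov_horner R 0.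
rewrite -!besov_dist0 addrC; apply: le_trans (besov_dist_triangle bg bf b0) _.
by rewrite lerD2r besov_dist_sym.
Qed.

(** The 3 is 1 for the seminorm plus 2 for the supremum, by [besov_size_sup]. *)
Lemma besov_norm_fin f : besov f -> exists r : R, [/\ besov_norm f = r%:E,
  besov_size f <= r & r <= 3 * besov_size f].
Proof.
move=> bf; pose S : set R := [set cabs (f z) | z in unit_disc].
have d0 : unit_disc (0 : R[i]) by apply/unit_discE; rewrite rnorm0.
have S0 : S !=set0 by exists (cabs (f 0)), 0.
have Sle : ubound S (2 * besov_size f).
  by move=> _ [z /unit_discE z1 <-]; exact: besov_size_sup.
have Sub : has_ubound S by eexists; exact: Sle.
exists (besov_semi f + sup S); split.
- rewrite /besov_norm (besov_fin bf) EFinD; congr (_ + _)%E.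
  by rewrite -ereal_sup_EFin // /S image_comp.
- by rewrite lerD2l; apply: ub_le_sup => //; exists 0.
- rewrite (_ : 3 * besov_size f = besov_size f + 2 * besov_size f); last by ring.
  apply: lerD; first by rewrite lerDl rnorm_ge0.
  exact: ge_sup.
Qed.

End besov_distance.

(** * The functional calculus *)

Lemma subr_addACA (V : zmodType) (a b c d e : V) :
  a - (b + c) = (a - (d + e)) - ((b - d) + (c - e)).
Proof. by rewrite [b - d + _]addrACA -[- d - e]opprD opprB subrKA. Qed.

Section besov_extension.
Context {R : realType} {X : completeNormedModType R[i]}.
Variable T : X -> X.
Hypothesis bT : bounded_op T.
Variable K : R.
Hypothesis K0 : 0 <= K.
Hypothesis poly_op_le : forall p x,
  rnorm (poly_op T p x) <= K * besov_size (horner p) * rnorm x.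
Implicit Types (f g : R[i] -> R[i]) (p q : {poly R[i]}) (x y : X) (A : X -> X).

(** Restricting to [e <= 1] allows bounds in which the size of an approximating polynomial is itself
    controlled through [e], as in [besov_opM]. *)
Lemma rnorm_small (V : normedModType R[i]) (v : V) (c : R) : 0 <= c ->
  (forall e, 0 < e -> e <= 1 -> rnorm v <= c * e) -> v = 0.
Proof.
move=> c0 h; apply: rnorm_le0 => e e0.
have c1 : 0 < 1 + c by rewrite ltr_pwDl.
have m0 : 0 < Num.min 1 (e / (1 + c)) by rewrite lt_min ltr01 divr_gt0.
apply: le_trans (h _ m0 _) _; first by rewrite ge_min lexx.
apply: (@le_trans _ _ ((1 + c) * (e / (1 + c)))); last by rewrite mulrCA divff ?mulr1 // gt_eqF.
by rewrite ler_pM ?(ltW m0) ?lerDr // ge_min lexx orbT.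
Qed.

Lemma poly_op_dist p q x : rnorm (poly_op T p x - poly_op T q x) <=
  K * besov_dist (horner p) (horner q) * rnorm x.
Proof.
have -> : poly_op T p x - poly_op T q x = poly_op T (p - q) x.
  by rewrite -[- q]scaleN1r poly_opD poly_opZ scaleN1r.
rewrite besov_distE (_ : (fun z => p.[z] + -1 * q.[z]) = horner (p - q)) //.
by apply/funext => z; rewrite hornerD hornerN mulN1r.
Qed.

(* The operator f(T): the values p(T) at polynomials determine it by density. *)
Definition is_besov_op f A := bounded_op A /\ forall p x,
  rnorm (A x - poly_op T p x) <= K * besov_dist f (horner p) * rnorm x.

(** The pointwise limit of [p(T) x] along polynomials tending to [f], which exists because [X] is
    complete. The estimate against every polynomial passes to the limit, and linearity follows by
    comparison with one nearby polynomial. *)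
Lemma besov_op_exists f : besov f -> exists A, is_besov_op f A.
Proof.
move=> bf.
have ex n : exists p, besov_dist f (horner p) <= n.+1%:R^-1.
  by apply: besov_density => //; rewrite invr_gt0.
have [u hu] := choice ex.
have bh p := besov_horner p.
have d0 n : 0 <= besov_dist f (horner (u n)) by exact: besov_dist_ge0 bf (bh _).
(* This estimate is used twice: with [p] a member of the sequence for the Cauchy property, and with
   [p] arbitrary for the limit. *)
have un p x n : rnorm (poly_op T (u n) x - poly_op T p x) <=
    K * (n.+1%:R^-1 + besov_dist f (horner p)) * rnorm x.
  apply: le_trans (poly_op_dist _ _ _) _; rewrite ler_wpM2r ?rnorm_ge0 // ler_wpM2l //.
  apply: le_trans (besov_dist_triangle (bh _) bf (bh _)) _; rewrite lerD2r.
  by apply: le_trans (besov_dist_sym (bh _) bf) (hu n).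
have cvx x : cvg (poly_op T (u n) x @[n --> \oo]).
  apply: cauchy_cvg; apply/cauchyP => e e0.
  have eE : e = (complex.Re e)%:C by rewrite RRe_real // gtr0_real.
  have e0' : 0 < complex.Re e by rewrite -ltcR -eE.
  have c0 : 0 < 1 + K * 2 * rnorm x by rewrite ltr_pwDl // !mulr_ge0 // rnorm_ge0.
  have [N _ hN] := harmonic_small (divr_gt0 e0' c0).
  exists (poly_op T (u N) x); exists N => // n /= Nn.
  rewrite -ball_normE /= distrC norm_rnorm eE ltcR; apply: le_lt_trans (un _ _ _) _.
  have h1 := hN n Nn; have h2 := le_trans (hu N) (hN N (leqnn N)).
  apply: (@le_lt_trans _ _ (K * 2 * rnorm x * (complex.Re e / (1 + K * 2 * rnorm x)))).
    move: h1 h2; move: (_ / _) => d h1 h2.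
    rewrite (_ : K * 2 * rnorm x * d = K * (d + d) * rnorm x); last by ring.
    by rewrite ler_wpM2r ?rnorm_ge0 // ler_wpM2l // lerD.
  by rewrite mulrCA gtr_pMr // ltr_pdivrMr // mul1r ltrDr.
pose A x := lim (poly_op T (u n) x @[n --> \oo]).
have hA p x : rnorm (A x - poly_op T p x) <= K * besov_dist f (horner p) * rnorm x.
  apply/ler_addgt0Pr => e e0; have e2 : 0 < e / 2 by rewrite divr_gt0.
  have c0 : 0 < 1 + K * rnorm x by rewrite ltr_pwDl // !mulr_ge0 // rnorm_ge0.
  have /rcvgP/(_ _ e2) h1 := cvx x.
  have [n _ /(_ n (leqnn n))[{}h1 h2]] := filterI h1 (harmonic_small (divr_gt0 e2 c0)).
  rewrite -(subrKA (poly_op T (u n) x)); apply: le_trans (rnormD _ _) _.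
  have h3 : rnorm (A x - poly_op T (u n) x) <= e / 2 by rewrite rdistC.
  apply: le_trans (lerD h3 (un _ _ _)) _.
  have h4 : K * rnorm x * n.+1%:R^-1 <= e / 2.
    apply: (@le_trans _ _ (K * rnorm x * (e / 2 / (1 + K * rnorm x)))).
      by rewrite ler_wpM2l // mulr_ge0 ?rnorm_ge0.
    by rewrite mulrCA ger_pMr // ler_pdivrMr // mul1r lerDr.
  move: h4; move: (n.+1%:R^-1) (besov_dist _ _) (rnorm x) => h d N h4.
  rewrite (_ : K * (h + d) * N = K * N * h + K * d * N); last by ring.
  lra.
exists A; split=> //.
have lA : linear A.
  move=> a x y; apply/eqP; rewrite -subr_eq0; apply/eqP.
  apply: (@rnorm_small _ _ (K * rnorm (a *: x + y) + cabs a * (K * rnorm x) + K * rnorm y)).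
    by rewrite !addr_ge0 ?mulr_ge0 ?rnorm_ge0 // mulr_ge0 ?rnorm_ge0.
  move=> e e0 _; have [p hp] := besov_density bf e0.
  have le z : rnorm (A z - poly_op T p z) <= K * rnorm z * e.
    apply: le_trans (hA p z) _; rewrite mulrAC ler_wpM2l ?mulr_ge0 ?rnorm_ge0 //.
  have -> : A (a *: x + y) - (a *: A x + A y) =
     (A (a *: x + y) - poly_op T p (a *: x + y)) -
     (a *: (A x - poly_op T p x) + (A y - poly_op T p y)).
    by rewrite (poly_op_linear bT) scalerBr; exact: subr_addACA.
  apply: le_trans (rnormB _ _) _; rewrite !mulrDl -addrA; apply: lerD; first exact: le.
  apply: le_trans (rnormD _ _) _; apply: lerD; last exact: le.
  by rewrite rnormZ -mulrA ler_wpM2l ?rnorm_ge0.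
apply: (@bound_bounded_op _ _ _ A (K * besov_dist f (horner 0))) => // x.
by have := hA 0 x; rewrite poly_op0 subr0.
Qed.

Definition besov_op f : X -> X := xget (fun=> 0) [set A | is_besov_op f A].

Lemma besov_opP f : besov f -> is_besov_op f (besov_op f).
Proof. by move=> bf; have := besov_op_exists bf; exact: xgetPex. Qed.

(** Both operators are compared with [p(T)] for one polynomial near [f]; the triangle inequality for
    [besov_dist] keeps the constant [K], up to an arbitrarily small error. *)
Lemma besov_op_dist f g x : besov f -> besov g ->
  rnorm (besov_op f x - besov_op g x) <= K * besov_dist f g * rnorm x.
Proof.
move=> bf bg; rewrite -subr_le0.
have [_ hf] := besov_opP bf; have [_ hg] := besov_opP bg.
apply/ler_addgt0Pr => e e0; rewrite add0r lerBlDr.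
have c0 : 0 < 1 + K * 2 * rnorm x by rewrite ltr_pwDl // !mulr_ge0 // rnorm_ge0.
have [p hp] := besov_density bf (divr_gt0 e0 c0).
have bp := besov_horner p.
rewrite -(subrKA (poly_op T p x)); apply: le_trans (rnormD _ _) _.
rewrite [X in _ + X]rdistC; apply: le_trans (lerD (hf p x) (hg p x)) _.
have tr : besov_dist g (horner p) <= besov_dist f g + besov_dist f (horner p).
  by apply: le_trans (besov_dist_triangle bg bf bp) _; rewrite lerD2r besov_dist_sym.
have x0 := rnorm_ge0 x.
have h4 : K * 2 * rnorm x * besov_dist f (horner p) <= e.
  apply: (@le_trans _ _ (K * 2 * rnorm x * (e / (1 + K * 2 * rnorm x)))).
    by rewrite ler_wpM2l // !mulr_ge0.
  by rewrite mulrCA ger_pMr // ler_pdivrMr // mul1r lerDr.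
move: tr h4; move: (besov_dist g _) (besov_dist f (horner p)) (besov_dist f g) => a b c tr h4.
have : K * a * rnorm x <= K * (c + b) * rnorm x by rewrite ler_wpM2r // ler_wpM2l.
rewrite (_ : K * (c + b) * rnorm x = K * c * rnorm x + K * b * rnorm x); last by ring.
rewrite (_ : K * 2 * rnorm x * b = K * b * rnorm x + K * b * rnorm x) in h4; last by ring.
lra.
Qed.

Lemma besov_op_eq f g : besov f -> besov g -> besov_dist f g <= 0 -> besov_op f = besov_op g.
Proof.
move=> bf bg d0; apply/funext => x; apply/eqP; rewrite -subr_eq0; apply/eqP.
apply: rnorm_le0 => e e0; apply: le_trans (besov_op_dist x bf bg) _.
apply: le_trans (ltW e0); rewrite mulrAC mulr_ge0_le0 //.
by rewrite mulr_ge0 ?rnorm_ge0.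
Qed.

Lemma besov_op_poly p : besov_op (horner p) = poly_op T p.
Proof.
have bp := besov_horner p; have [_ hp] := besov_opP bp.
apply/funext => x; apply/eqP; rewrite -subr_eq0; apply/eqP.
apply: rnorm_le0 => e e0; apply: le_trans (hp p x) _.
apply: le_trans (ltW e0); rewrite mulrAC mulr_ge0_le0 //; first by rewrite mulr_ge0 ?rnorm_ge0.
exact: besov_dist_disc.
Qed.

Lemma besov_op_size f x : besov f -> rnorm (besov_op f x) <= K * besov_size f * rnorm x.
Proof.
by move=> bf; have [_ /(_ 0 x)] := besov_opP bf; rewrite poly_op0 subr0 besov_dist0.
Qed.

Lemma besov_opD f g x : besov f -> besov g ->
  besov_op (fun z => f z + g z) x = besov_op f x + besov_op g x.
Proof.
move=> bf bg; apply/eqP; rewrite -subr_eq0; apply/eqP.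
have x0 := rnorm_ge0 x.
apply: (@rnorm_small _ _ (4 * (K * rnorm x))) => [|e e0 _]; first by rewrite !mulr_ge0.
have [p hp] := besov_density bf e0; have [q hq] := besov_density bg e0.
have bp := besov_horner p; have bq := besov_horner q.
have dpq := le_trans (besov_distD bf bg bp bq) (lerD hp hq).
have [_ hs] := besov_opP (besovD bf bg).1.
have Epq : (fun z => p.[z] + q.[z]) = horner (p + q).
  by apply/funext => z; rewrite hornerD.
rewrite Epq in dpq.
rewrite (subr_addACA _ _ _ (poly_op T p x) (poly_op T q x)) -(poly_opD T p q).
have le (a : X) (d : R) : rnorm a <= K * d * rnorm x -> d <= e + e -> rnorm a <= 2 * (K * rnorm x) * e.
  move=> /le_trans h de; apply: h.
  rewrite (_ : 2 * (K * rnorm x) * e = K * (e + e) * rnorm x); last by ring.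
  by rewrite ler_wpM2r // ler_wpM2l.
apply: le_trans (rnormB _ _) _.
rewrite (_ : 4 * (K * rnorm x) * e = 2 * (K * rnorm x) * e + (K * e * rnorm x + K * e * rnorm x)); last by ring.
apply: lerD; first exact: le _ _ (hs _ x) dpq.
apply: le_trans (rnormD _ _) _; apply: lerD.
  by apply: le_trans ((besov_opP bf).2 p x) _; rewrite ler_wpM2r // ler_wpM2l.
by apply: le_trans ((besov_opP bg).2 q x) _; rewrite ler_wpM2r // ler_wpM2l.
Qed.

Lemma besov_opZ c f x : besov f -> besov_op (fun z => c * f z) x = c *: besov_op f x.
Proof.
move=> bf; apply/eqP; rewrite -subr_eq0; apply/eqP.
have x0 := rnorm_ge0 x; have c0 := @rnorm_ge0 _ R[i]^o c.
apply: (@rnorm_small _ _ (2 * (K * cabs c * rnorm x))) => [|e e0 _]; first by rewrite !mulr_ge0.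
have [p hp] := besov_density bf e0; have bp := besov_horner p.
have dp := le_trans (besov_distZ c bf bp) (ler_wpM2l c0 hp).
have [_ hs] := besov_opP (besovZ c bf).1.
have Ep : (fun z => c * p.[z]) = horner (c *: p) by apply/funext => z; rewrite hornerZ.
rewrite Ep in dp.
rewrite -(subrKA (poly_op T (c *: p) x)) poly_opZ -scalerBr.
apply: le_trans (rnormD _ _) _.
rewrite (_ : 2 * (K * cabs c * rnorm x) * e =
  K * (cabs c * e) * rnorm x + cabs c * (K * e * rnorm x)); last by ring.
apply: lerD.
  by rewrite -poly_opZ; apply: le_trans (hs _ x) _; rewrite ler_wpM2r // ler_wpM2l.
rewrite rnormZ ler_wpM2l // rdistC.
by apply: le_trans ((besov_opP bf).2 p x) _; rewrite ler_wpM2r // ler_wpM2l.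
Qed.

Lemma besov_opM f g x : besov f -> besov g ->
  besov_op (fun z => f z * g z) x = besov_op f (besov_op g x).
Proof.
move=> bf bg; apply/eqP; rewrite -subr_eq0; apply/eqP.
have x0 := rnorm_ge0 x; have F0 := besov_size_ge0 bf; have G0 := besov_size_ge0 bg.
set N := rnorm x in x0; set F := besov_size f in F0; set G := besov_size g in G0.
apply: (@rnorm_small _ _ (5 * K * N * (F + G + 1) + K * K * N * (F + G + 1))) => [|e e0 e1].
  have S0 : 0 <= F + G + 1 by rewrite addr_ge0 // addr_ge0.
  by apply: addr_ge0; rewrite !mulr_ge0.
have [p hp] := besov_density bf e0; have [q hq] := besov_density bg e0.
have bp := besov_horner p; have bq := besov_horner q.
have b := (besov_sizeM bf bg).1.
have P0 := besov_size_ge0 bp.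
have PF : besov_size (horner p) <= F + 1.
  by apply: le_trans (besov_size_le bf bp) _; rewrite lerD2l (le_trans hp).
have dpq : besov_dist (fun z => f z * g z) (fun z => p.[z] * q.[z]) <= 5 * (F + G + 1) * e.
  apply: le_trans (besov_distM bf bg bp bq) _.
  rewrite (_ : 5 * (F + G + 1) * e = 5 * e * G + 5 * (F + 1) * e); last by ring.
  have five : 0 <= 5 :> R by [].
  apply: lerD; first exact: ler_wpM2r G0 _ _ (ler_wpM2l five hp).
  exact: ler_pM (mulr_ge0 five P0) (besov_dist_ge0 bg bq) (ler_wpM2l five PF) hq.
have [_ hs] := besov_opP b.
have Epq : (fun z => p.[z] * q.[z]) = horner (p * q).
  by apply/funext => z; rewrite hornerM.
rewrite Epq in dpq.
have [[lf _] hf] := besov_opP bf.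
(* Through [(pq)(T) = p(T) q(T)]: the first error is that of the product, the second replaces [f] by
   [p], the third [g] by [q]. In the last one the factor [p(T)] is controlled by [PF], where
   [e <= 1] enters. *)
have -> : besov_op (fun z => f z * g z) x - besov_op f (besov_op g x) =
  (besov_op (fun z => f z * g z) x - poly_op T (p * q) x) -
  ((besov_op f (besov_op g x) - poly_op T p (besov_op g x)) +
   poly_op T p (besov_op g x - poly_op T q x)).
  rewrite (linB _ _ (poly_op_linear bT p)) -(poly_opM bT).
  by rewrite subrKA opprB addrA subrK.
apply: le_trans (rnormB _ _) _; rewrite mulrDl; apply: lerD.
  apply: le_trans (hs _ x) _.
  rewrite (_ : 5 * K * N * (F + G + 1) * e = K * (5 * (F + G + 1) * e) * N); last by ring.
  by rewrite ler_wpM2r // ler_wpM2l.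
rewrite (_ : K * K * N * (F + G + 1) * e =
  K * e * (K * G * N) + K * (F + 1) * (K * e * N)); last by ring.
apply: le_trans (rnormD _ _) _; apply: lerD.
  apply: le_trans (hf p _) _.
  exact: ler_pM (mulr_ge0 K0 (besov_dist_ge0 bf bp)) (rnorm_ge0 _) (ler_wpM2l K0 hp)
    (besov_op_size x bg).
apply: le_trans (poly_op_le _ _) _.
apply: ler_pM (mulr_ge0 K0 P0) (rnorm_ge0 _) (ler_wpM2l K0 PF) _.
by apply: le_trans ((besov_opP bg).2 q x) _; rewrite ler_wpM2r // ler_wpM2l.
Qed.

Lemma opnorm_besov_op f : besov f -> opnorm (besov_op f) <= K * besov_size f.
Proof.
move=> bf; apply: opnorm_le => [|x]; last exact: besov_op_size.
by rewrite mulr_ge0 // besov_size_ge0.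
Qed.

Lemma besov_op_calculus : besov_calculus T besov_op.
Proof.
split.
- by move=> f /besov_opP[].
- move=> f g bf bg fg; apply: besov_op_eq => //; apply: besov_dist_disc => // z z1.
  by apply: fg; rewrite inE; exact/unit_discE.
- by move=> f g bf bg; apply/funext => x; exact: besov_opD.
- by move=> c f bf; apply/funext => x; exact: besov_opZ.
- by move=> f g bf bg; apply/funext => x; exact: besov_opM.
- exists K => f bf; have [r [-> fr _]] := besov_norm_fin bf.
  by rewrite -EFinM lee_fin (le_trans (opnorm_besov_op bf)) // ler_wpM2l.
- exact: besov_op_poly.
Qed.

(** Both maps agree on polynomials and are bounded, so they are compared at a polynomial near [f];
    for [Psi] the comparison goes through its value at the difference [f - p]. *)
Lemma besov_calculus_unique Psi f : besov_calculus T Psi -> besov f -> Psi f = besov_op f.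
Proof.
move=> cP bf; have [M hM] := besov_calc_bounded cP.
apply/funext => x; apply/eqP; rewrite -subr_eq0; apply/eqP.
have x0 := rnorm_ge0 x.
apply: (@rnorm_small _ _ (`|M| * 3 * rnorm x + K * rnorm x)) => [|e e0 _].
  by rewrite addr_ge0 ?mulr_ge0.
have [p hp] := besov_density bf e0; have bp := besov_horner p.
have bd := besov_diff bf bp.
rewrite -(subrKA (poly_op T p x)); apply: le_trans (rnormD _ _) _.
rewrite mulrDl; apply: lerD; last first.
  rewrite rdistC mulrAC; apply: le_trans ((besov_opP bf).2 p x) _.
  by rewrite ler_wpM2r // ler_wpM2l.
have -> : Psi f x - poly_op T p x = Psi (fun z => f z + -1 * p.[z]) x.
  rewrite (besov_calcD cP bf (besovZ _ bp).1) (besov_calcZ cP _ bp) (besov_calc_poly cP).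
  by rewrite scaleN1r.
apply: le_trans (le_opnorm x (besov_calc_op cP bd)) _.
rewrite mulrAC ler_wpM2r //.
have := hM _ bd; have [r [-> r1 r2]] := besov_norm_fin bd.
rewrite -EFinM lee_fin => /le_trans; apply.
have r0 : 0 <= r := le_trans (besov_size_ge0 bd) r1.
(* The bound [M] in [besov_calc_bounded] comes without a sign. *)
apply: (@le_trans _ _ (`|M| * r)); first by rewrite ler_wpM2r // ler_norm.
rewrite -mulrA ler_wpM2l //; apply: le_trans r2 _.
by rewrite ler_pM2l.
Qed.

End besov_extension.

Section besov_representation.
Context {R : realType} {X : completeNormedModType R[i]}.
Notation mu := (@lebesgue_measure R).
Variable T : X -> X.
Hypothesis bT : bounded_op T.
Hypothesis sT : spectrum T `<=` [set l | `|l| <= 1].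
Variable C : R.
Hypothesis C0 : 0 < C.
Hypothesis gfs : forall (r : R) (x : X) (phi : X -> R[i]^o), 1 < r -> bounded_op phi ->
  (\int[mu]_(t in `[0%R, (2 * pi)%R])
     (cabs (phi (iter 2 (resolvent (r%:C * cis t) T) x)))%:E
   <= (C / ((r + 1) * (r - 1) ^+ 1) * rnorm x * opnorm phi)%:E)%E.
Variable K : R.
Hypothesis K0 : 0 <= K.
Hypothesis poly_op_le : forall p x,
  rnorm (poly_op T p x) <= K * besov_size (horner p) * rnorm x.

(** Both sides agree at polynomials and change by at most a multiple of [besov_dist]: the left by
    construction of the operator, the right by [le_besov_formula]. *)
Lemma besov_op_formula (f : R[i] -> R[i]) (x : X) (phi : X -> R[i]^o) :
  besov f -> bounded_op phi -> phi (besov_op T K f x) = besov_formula T f x phi.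
Proof.
move=> bf bphi; apply/eqP; rewrite -subr_eq0; apply/eqP.
have lphi := bphi.1; have x0 := rnorm_ge0 x; have N0 := opnorm_ge0 bphi.
set K' := pi^-1 * (4 * C) + 1.
have K'0 : 0 <= K' by rewrite addr_ge0 // mulr_ge0 ?invr_ge0 ?pi_ge0 // mulr_ge0 // ltW.
apply: (@rnorm_small R R[i]^o _ (K * rnorm x * opnorm phi + K' * rnorm x * opnorm phi)) => [|e e0 _].
  by rewrite addr_ge0 // !mulr_ge0.
have [p hp] := besov_density bf e0; have bp := besov_horner p.
have bd := besov_diff bf bp.
have E1 : besov_formula T (fun z => f z + -1 * p.[z]) x phi =
    besov_formula T f x phi - phi (poly_op T p x).
  have ED := besov_formulaD sT C0 gfs x bf (besovZ (-1) bp).1 bphi.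
  have EZ := besov_formulaZ sT C0 gfs (-1) x bp bphi.
  have EP := besov_formula_poly bT sT C0 gfs p x bphi.
  have H (a b c d e' : R[i]) : a = b + c -> c = -1 * d -> d = e' -> a = b - e'.
    by move=> -> -> ->; rewrite mulN1r.
  exact: (H _ _ _ _ _ ED EZ EP).
have h1 := le_besov_formula sT C0 gfs x bd bphi; rewrite E1 in h1.
have h2 : rnorm (phi (besov_op T K f x) - phi (poly_op T p x)) <= opnorm phi * (K * e * rnorm x).
  rewrite -(linB _ _ lphi); apply: le_trans (le_opnorm _ bphi) _; rewrite ler_wpM2l //.
  apply: le_trans ((besov_opP bT K0 poly_op_le bf).2 p x) _.
  by rewrite ler_wpM2r // ler_wpM2l.
have h3 : K' * (besov_semi (fun z => f z + -1 * p.[z]) + cabs (f 0 + -1 * p.[0])) * rnorm x * opnorm phi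
    <= K' * e * rnorm x * opnorm phi.
  by rewrite !ler_wpM2r // ler_wpM2l.
have {}h1 := le_trans h1 h3.
rewrite -(subrKA (phi (poly_op T p x))); apply: le_trans (rnormD _ _) _.
rewrite [X in _ + X]rdistC; apply: le_trans (lerD h2 h1) _.
by rewrite le_eqVlt; apply/predU1P; left; ring.
Qed.

End besov_representation.

Theorem theorem3p2 (R : realType) (X : completeNormedModType R[i]) (T : X -> X)
    (hT : GFS_operator T) :
  exists Phi : (R[i] -> R[i]) -> X -> X,
    [/\ besov_calculus T Phi,
        (forall Psi : (R[i] -> R[i]) -> X -> X, besov_calculus T Psi ->
           forall f : R[i] -> R[i], besov f -> Psi f = Phi f)
      & forall (f : R[i] -> R[i]) (x : X) (phi : X -> R[i]^o),
          besov f -> bounded_op phi ->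
          let inner (r : R) : R[i] :=
            cintegral `[0, 2 * pi] (besov_kernel T f x phi r) in
          let outer (r : R) : R[i] := (r ^+ 2 - 1)%:C * inner r in
          [/\ forall r : R, 1 < r ->
                cintegrable `[0, 2 * pi] (besov_kernel T f x phi r),
              cintegrable `]1, +oo[ outer
            & phi (Phi f x) =
                (pi^-1)%:C * cintegral `]1, +oo[ outer + f 0 * phi x]].
Proof.
have [bT [sT [C C0 gfs]]] := hT.
have K_ge0 : 0 <= 2 * (pi^-1 * (4 * C) + 1) :> R.
  by rewrite mulr_ge0 // addr_ge0 // mulr_ge0 ?invr_ge0 ?pi_ge0 // mulr_ge0 // ltW.
have poly_le p x := le_poly_op bT sT C0 gfs p x.
(* [besov_op] is specified by an estimate that contains its constant, so the constant of
   [le_poly_op] appears in the witness. *)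
exists (besov_op T (2 * (pi^-1 * (4 * C) + 1))); split.
- exact: besov_op_calculus.
- by move=> Psi cP f bf; exact: besov_calculus_unique.
- move=> f x phi bf bphi inner outer; split.
  + by move=> r r1; exact: (besov_kernel_cintegrable sT x bf.1 bphi r1).
  + exact: (besov_outer_cintegrable sT C0 gfs x bf bphi).1.
  + exact: (besov_op_formula bT sT C0 gfs K_ge0 poly_le x bf bphi).
Qed.
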